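(* There exists a non-negative integer-valued random variable $\xi$ with $\mathbb E\xi=1$ and $0<\operatorname{Var}\xi<\infty$ such that for any $\alpha_0\in\mathbb C$ with $\operatorname{Re}\alpha_0=\frac12$, $$\limsup_{\alpha\to\alpha_0,\ \operatorname{Re}\alpha<\frac12}|\mu'(\alpha)|=\infty.$$ In particular, $\mu(\alpha)$ has no analytic extension in a neighborhood of any such $\alpha_0$. In other words, the line $\operatorname{Re}\alpha=\frac12$ is a natural boundary for $\mu(\alpha)$.
   Context: Let $\mathcal T$ be the Galton--Watson tree with offspring distribution $\xi$ (each node has a number of children that is an independent copy of $\xi$), and $|\mathcal T|$ its (a.s. finite) number of nodes. For $\operatorname{Re}\alpha<\frac12$, $\mu(\alpha):=\mathbb E|\mathcal T|^\alpha=\sum_{n\ge1}n^\alpha\,\mathbb P(|\mathcal T|=n)$, which is an analytic function in this half-plane; $\mu'$ is its derivative. *)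

(* Defs.v *)
From HB Require Import structures.
From mathcomp Require Import all_boot all_order all_algebra.
From mathcomp Require Import complex.
From mathcomp Require Import all_classical all_reals all_analysis.

Set Implicit Arguments.
Unset Strict Implicit.
Unset Printing Implicit Defensive.

Import Order.TTheory GRing.Theory Num.Theory.
Import numFieldNormedType.Exports.

Local Open Scope classical_set_scope.
Local Open Scope complex_scope.
Local Open Scope ring_scope.

(* [R[i]^o] rather than [R[i]]: only the former carries the topological and
   normed-module structures over the field [R[i]]; with it, [derive1] is the
   complex derivative. *)
Notation CC R := (R[i]^o).

Definition Cexp (R : realType) (z : CC R) : CC R :=
  (expR (complex.Re z))%:C * (cos (complex.Im z) +i* sin (complex.Im z)).

(* For [n >= 1] only: [ln 0 = 0], so this is not the power at [n = 0]. *)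
Definition natpowC (R : realType) (n : nat) (a : CC R) : CC R :=
  Cexp (a * (ln (n%:R : R))%:C).

Definition analytic_at (R : realType) (f : CC R -> CC R) (z0 : CC R) : Prop :=
  exists (c : nat -> CC R) (r : R), 0 < r /\
    forall z : CC R, Normc.normc (z - z0) < r ->
      (fun N => \sum_(0 <= k < N) c k * (z - z0) ^+ k) @ \oo --> f z.

Definition analytic_on (R : realType) (D : set (CC R)) (f : CC R -> CC R) :
    Prop :=
  forall z, D z -> analytic_at f z.

Definition has_analytic_extension_near (R : realType) (D : set (CC R))
    (f : CC R -> CC R) (z0 : CC R) : Prop :=
  exists (U : set (CC R)) (g : CC R -> CC R),
    [/\ open_nbhs z0 U, analytic_on U g & forall z, U z -> D z -> g z = f z].

Definition left_half_plane (R : realType) : set (CC R) :=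
  [set a | complex.Re a < 2^-1].

Definition critical_line (R : realType) : set (CC R) :=
  [set a | complex.Re a = 2^-1].

(* [B] is meant to be (part of) the boundary of the domain [D]. *)
Definition natural_boundary (R : realType) (D B : set (CC R))
    (f : CC R -> CC R) : Prop :=
  analytic_on D f /\ forall z0, B z0 -> ~ has_analytic_extension_near D f z0.

Definition mutually_independent d d' (T : measurableType d)
    (T' : measurableType d') (R : realType) (P : probability T R)
    (I : eqType) (X : I -> {RV P >-> T'}) : Prop :=
  forall (s : seq I) (A : I -> set T'),
    uniq s -> (forall i, measurable (A i)) ->
    P (\bigcap_(i in [set` s]) (X i @^-1` A i)) =
    (\prod_(i <- s) P (X i @^-1` A i))%E.

Definition iid_copies d0 d d' (T0 : measurableType d0) (T : measurableType d)
    (T' : measurableType d') (R : realType)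
    (P0 : probability T0 R) (P : probability T R)
    (xi : {RV P0 >-> T'}) (I : eqType) (X : I -> {RV P >-> T'}) : Prop :=
  mutually_independent X /\
  forall i A, measurable A -> distribution P (X i) A = distribution P0 xi A.

(* Ulam-Harris encoding: a potential node is a word [u] of naturals, the root
   is [[::]], the children of [u] are [rcons u 0, ..., rcons u (c u - 1)] where
   [c u] is the number of children of [u]. *)
Definition ulam_harris_tree (c : seq nat -> nat) : set (seq nat) :=
  [set u | forall k, (k < size u)%N -> (nth 0%N u k < c (take k u))%N].

Definition gw_tree d (T : measurableType d) (R : realType)
    (P : probability T R) (X : seq nat -> {RV P >-> nat}) (w : T) :
    set (seq nat) :=
  ulam_harris_tree (fun u => X u w).

Definition gw_size_prob d (T : measurableType d) (R : realType)
    (P : probability T R) (X : seq nat -> {RV P >-> nat}) (n : nat) : R :=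
  fine (P [set w | (gw_tree X w #= `I_n)%card]).

Definition gw_mu d (T : measurableType d) (R : realType)
    (P : probability T R) (X : seq nat -> {RV P >-> nat}) (a : CC R) : CC R :=
  limn (fun N : nat =>
    \sum_(1 <= n < N) natpowC n a * (gw_size_prob X n)%:C : CC R).

(* Main.v *)
Require Import Defs.
From HB Require Import structures.
From mathcomp Require Import all_boot all_order all_algebra.
From mathcomp Require Import complex.
From mathcomp Require Import all_classical all_reals all_analysis.
From mathcomp Require Import measurable_realfun ring lra.

(** The offspring law is a mixture of explicit laws living at scales [M_j] that
    grow super-exponentially: [M_0 = 4] and [ln M_(j+1) = M_j ^+ 2].  With the
    weights [b_j = 2^-(j+1)] put

      B u = sum_j b_j / (1 + u M_j),      phi s = s + (1 - s)^2 B (1 - s).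

    [phi] is the generating function of a probability law on the naturals with
    mean 1 and variance 2 ([offspring_gen], [offspring_mean],
    [offspring_sqr]).  Let [T] be the total progeny and
    [tail x = 1 - E exp(- x T)].  The usual fixed point equation for the total
    progeny reads

      tail x ^ 2 * B (tail x) = (1 - tail x) * (exp x - 1)     ([tail_eq]).

    As [B u] tends to 1 when [u] tends to 0, [tail x] is equivalent to the
    square root of [x]; hence [E T^alpha] is finite for [Re alpha < 1/2].
    But [B u] loses the amount [b_j] when [u] crosses [1 / M_j], and this
    leaves a mark of relative size [b_j] on [tail x] near [x = M_j ^- 2].  In
    the variable [t = - ln x] the marks sit at the very sparse places
    [2 ln M_j], and their sizes decay only geometrically in [j].  They forbid
    the derivative of [mu alpha = E T^alpha] to stay bounded near any point
    of the critical line.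

    To see this, suppose that [mu'] is bounded near [alpha_0 = 1/2 + i tau_0],
    so that [mu] is Lipschitz on the left of [alpha_0] ([dsum_lipschitz]).
    For [1 < rho <= 2] consider

      kappa t = rho * tail (exp (- t)) - tail (rho^2 exp (- t)),

    in which the leading square roots cancel.  Its Fourier transform against
    [exp (s t)] at [tau] is [ccoef s tau * mu (s + i tau)] with a factor that
    is bounded and Lipschitz in [tau] ([FT_kappa], [ccoef_bound], [ccoef_lip]);
    so it changes by [O (1 / ln M_J)] between [tau_0] and
    [tau_0 + pi / (2 ln M_J)], uniformly in [1/4 <= s < 1/2].

    On the other hand [kappa] is, up to an error [O (exp (- t))], the sum of
    the marks ([kappa_expansion]).  Take [s = 1/2 - 1 / ln M_J].  The marks of
    the levels below [J] and the error have a transform that changes by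
    [O (1 / M_(J-1))] only ([wlow_difference]), because it is Lipschitz in
    [tau] with constant [O (M_(J-1))] while [ln M_J = M_(J-1) ^ 2].  The marks
    above [J] are damped by the choice of [s] ([whigh_difference]).  The mark
    of level [J] is [b_J] times the translate by [2 ln M_J] of a function that
    converges to a fixed [profile] ([rescaled_cvg]); the two frequencies are
    such that the translation multiplies the transform by opposite phases
    ([Cexp_twist]), so that the difference of the two values is of exact order
    [b_J] as soon as the transform of [profile] does not vanish at [tau_0].
    This can be arranged by taking [rho] close to 1: after division by
    [rho - 1] the profile tends to [1 / (4 cosh^2 (t / 4))], whose Fourier
    transform is positive ([sech_moment2_gt0], [profile_transform_gt0]).
    Since [b_J] is of the order of [2^-J] and [M_(J-1) >= 4^J], this is a
    contradiction, which proves [progeny_blowup].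

    The blow-up of [mu'] excludes an analytic extension, because an analytic
    function is Lipschitz near each point ([analytic_lipschitz]). *)

Import Order.TTheory GRing.Theory Num.Theory.
Import numFieldNormedType.Exports.

Local Open Scope classical_set_scope.
Local Open Scope ring_scope.

Set Implicit Arguments.
Unset Strict Implicit.
Unset Printing Implicit Defensive.

(** * Integration on the real line *)

Section Line.
Context {R : realType}.
Implicit Types (f g : R -> R).

Definition integrableR f := (@lebesgue_measure R).-integrable setT (EFin \o f).
Definition intR f : R := (\int[@lebesgue_measure R]_x f x)%R.

Lemma integrableR_measurable f : integrableR f -> measurable_fun setT f.
Proof. by move=> /measurable_int/measurable_EFinP. Qed.

Lemma integrableR_le f g : measurable_fun setT f -> integrableR g -> (forall t, `|f t| <= g t) -> integrableR f.
Proof.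
move=> mf integrableR_g fg; apply: (le_integrable _ _ _ integrableR_g) => //.
  exact/measurable_EFinP.
by move=> t _; rewrite /= lee_fin (le_trans (fg t))// ler_norm.
Qed.

Lemma integrableRD f g : integrableR f -> integrableR g -> integrableR (fun t => f t + g t).
Proof. by move=> hf hg; exact: (integrableD measurableT hf hg). Qed.

Lemma integrableRZ (c : R) f : integrableR f -> integrableR (fun t => c * f t).
Proof. by move=> hf; exact: (integrableZl measurableT c hf). Qed.

Lemma intRD f g : integrableR f -> integrableR g -> intR (fun t => f t + g t) = intR f + intR g.
Proof. by move=> hf hg; rewrite /intR RintegralD. Qed.

Lemma intRZ (c : R) f : integrableR f -> intR (fun t => c * f t) = c * intR f.
Proof. by move=> hf; rewrite /intR RintegralZl. Qed.

Lemma intR_le f g : integrableR f -> integrableR g -> (forall t, f t <= g t) -> intR f <= intR g.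
Proof. by move=> hf hg fg; apply: le_Rintegral. Qed.

Lemma intR_norm_le f g : measurable_fun setT f -> integrableR g ->
  (forall t, `|f t| <= g t) -> `|intR f| <= intR g.
Proof.
move=> mf hg fg; have hf : integrableR f by exact: integrableR_le fg.
apply: (le_trans (le_normr_Rintegral _ _)) => //.
apply: le_Rintegral => //; exact: (integrable_norm hf).
Qed.

Lemma intR_dct (fn : nat -> R -> R) f g :
  (forall n, measurable_fun setT (fn n)) -> integrableR g ->
  (forall n t, `|fn n t| <= g t) ->
  (forall t, fn ^~ t @ \oo --> f t) ->
  integrableR f /\ intR \o fn @ \oo --> intR f.
Proof.
move=> mfn hg fng fnf.
have mf : measurable_fun setT f.
  by apply: (measurable_fun_cvg _ (h := fn)) => // t _; exact: fnf.
have h1 : {ae @lebesgue_measure R, forall x, setT x ->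
    (EFin \o fn n) x @[n --> \oo] --> (EFin \o f) x}.
  by apply: aeW => t _; apply: cvg_EFin; [exact: nearW|exact: fnf].
have h2 : {ae @lebesgue_measure R, forall x n, setT x ->
    (`|(EFin \o fn n) x| <= (EFin \o g) x)%E}.
  by apply: aeW => t n _; rewrite /= lee_fin.
have [hf _ h] := @dominated_convergence _ _ R (@lebesgue_measure R) setT
  measurableT (fun n => EFin \o fn n) (EFin \o f) (EFin \o g)
  (fun n => (measurable_EFinP _ _).2 (mfn n)) ((measurable_EFinP _ _).2 mf)
  h1 hg h2.
split=> //.
have hff : (\int[@lebesgue_measure R]_x (f x)%:E)%E \is a fin_num.
  exact: integrable_fin_num.
by move: h; rewrite -(fineK hff) => h; exact: (fine_cvg h).
Qed.

Lemma measurable_shift (c : R) :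
  measurable_fun setT (fun x : measurableTypeR R => x + c : measurableTypeR R).
Proof. exact: measurable_funD. Qed.

(** The two measures agree on the half-open intervals, which determine a
    measure. *)
Lemma lebesgue_measure_shift (c : R) (A : set R) : measurable A ->
  pushforward (@lebesgue_measure R) ((fun x => x + c) : _ -> measurableTypeR R) A
  = lebesgue_measure A.
Proof.
move=> mA; apply/esym/lebesgue_measure_unique => //=.
  exact: measurable_shift.
move=> _ _ [[a b]] _ <-.
rewrite /pushforward.
have -> : (fun x : R => x + c) @^-1` `]a, b] = `]a - c, b - c]%classic.
  by apply/seteqP; split=> x /=; rewrite !in_itv/= ltrBlDr lerBrDr.
rewrite !lebesgue_measure_itv/= !lte_fin ltrD2r.
by case: ifP => // _; rewrite -!EFinB; congr EFin; ring.
Qed.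

Section MeasurePreserving.
Variable phi : measurableTypeR R -> measurableTypeR R.
Hypothesis mphi : measurable_fun setT phi.
Hypothesis phiE : forall A : set (measurableTypeR R), measurable A ->
  pushforward (@lebesgue_measure R) phi A = lebesgue_measure A.

Lemma measurable_fun_preserving f :
  measurable_fun setT f -> measurable_fun setT (fun t : R => f (phi t)).
Proof. by move=> mf; exact: (measurableT_comp mf mphi). Qed.

Lemma integrableR_preserving f : integrableR f -> integrableR (fun t => f (phi t)).
Proof.
move=> hf; have mf := integrableR_measurable hf.
apply/integrableP; split.
  by apply/measurable_EFinP; exact: measurable_fun_preserving.
move/integrableP : hf => [_]; apply: le_lt_trans.
rewrite le_eqVlt; apply/orP; left; apply/eqP.
have -> : [set: measurableTypeR R] = phi @^-1` setT by [].
rewrite -(ge0_integral_pushforward mphi lebesgue_measure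
  (f := fun t => `|(f t)%:E|%E)) //=; last first.
  by apply/measurable_EFinP; exact: measurableT_comp.
by apply: eq_measure_integral => A mA _; exact: phiE.
Qed.

Lemma intR_preserving f : integrableR f -> intR (fun t => f (phi t)) = intR f.
Proof.
move=> hf; have mf := integrableR_measurable hf; rewrite /intR /Rintegral; congr fine.
have -> : [set: measurableTypeR R] = phi @^-1` setT by [].
rewrite -(integral_pushforward mphi (f := EFin \o f)) //=.
- by apply: eq_measure_integral => A mA _; exact: phiE.
- exact/measurable_EFinP.
- exact: integrableR_preserving.
Qed.

End MeasurePreserving.

Lemma measurable_fun_shift (c : R) f :
  measurable_fun setT f -> measurable_fun setT (fun t : R => f (t + c)).
Proof. by move=> mf; exact: (measurable_fun_preserving (measurable_shift c)). Qed.

Lemma integrableR_shift (c : R) f : integrableR f -> integrableR (fun t => f (t + c)).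
Proof. exact: (integrableR_preserving (measurable_shift c) (lebesgue_measure_shift c)). Qed.

Lemma intR_shift (c : R) f : integrableR f -> intR (fun t => f (t + c)) = intR f.
Proof. exact: (intR_preserving (measurable_shift c) (lebesgue_measure_shift c)). Qed.

Let measurable_opp :
  measurable_fun setT (fun x : measurableTypeR R => - x : measurableTypeR R).
Proof. exact: oppr_measurable. Qed.

Lemma integrableR_opp f : integrableR f -> integrableR (fun t => f (- t)).
Proof. exact: (integrableR_preserving measurable_opp (@lebesgue_measureN R)). Qed.

Lemma intR_opp f : integrableR f -> intR (fun t => f (- t)) = intR f.
Proof. exact: (intR_preserving measurable_opp (@lebesgue_measureN R)). Qed.

(** Every integrand below is dominated by a multiple of such a function. *)
Definition expabs (a t : R) : R := expR (- (a * `|t|)).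

Lemma measurable_expabs a : measurable_fun setT (expabs a).
Proof.
apply: (measurableT_comp (@measurable_expR R)).
apply: measurableT_comp => //.
apply: measurable_funM => //.
Qed.

Lemma integrableR_exponential_pdf a : 0 < a -> integrableR (exponential_pdf a).
Proof.
move=> a0; apply/integrableP; split.
  by apply/measurable_EFinP; exact: measurable_exponential_pdf.
under eq_integral => x _.
  rewrite /= ger0_norm; last by rewrite exponential_pdf_ge0 // ltW.
  over.
by rewrite integral_exponential_pdf // ltry.
Qed.

(** Each half-line carries an exponential density, so integrability and the
    value of the integral come from the exponential distribution. *)
Lemma expabs_le_pdf a t : 0 < a ->
  expabs a t <= a^-1 * (exponential_pdf a t + exponential_pdf a (- t)).
Proof.
move=> a0; rewrite /expabs.
have pos x : 0 <= exponential_pdf a x by rewrite exponential_pdf_ge0 // ltW.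
have [t0|t0] := leP 0 t.
  rewrite ger0_norm // mulrDr; apply: ler_wpDr.
    by rewrite mulr_ge0 // invr_ge0 ltW.
  by rewrite exponential_pdfE // mulKf ?gt_eqF // mulNr.
rewrite ltr0_norm // mulrDr; apply: ler_wpDl.
  by rewrite mulr_ge0 // invr_ge0 ltW.
have t0' : 0 <= - t by rewrite oppr_ge0 ltW.
by rewrite exponential_pdfE // mulKf ?gt_eqF // mulNr.
Qed.

Lemma integrableR_expabs a : 0 < a -> integrableR (expabs a).
Proof.
move=> a0.
apply: (integrableR_le (g := fun t => a^-1 * (exponential_pdf a t + exponential_pdf a (- t)))).
- exact: measurable_expabs.
- by apply: integrableRZ; apply: integrableRD; [|apply: integrableR_opp]; exact: integrableR_exponential_pdf.
- by move=> t; rewrite ger0_norm ?expR_ge0 // expabs_le_pdf.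
Qed.

Lemma intR_expabs_le a : 0 < a -> intR (expabs a) <= 2 / a.
Proof.
move=> a0; have hp := integrableR_exponential_pdf a0; have hn := integrableR_opp hp.
apply: (le_trans (y := intR (fun t => a^-1 * (exponential_pdf a t + exponential_pdf a (- t))))).
  apply: intR_le; first exact: integrableR_expabs.
    by apply: integrableRZ; apply: integrableRD.
  by move=> t; exact: expabs_le_pdf.
rewrite intRZ; last exact: integrableRD.
rewrite intRD // (intR_opp hp) /intR /Rintegral integral_exponential_pdf //=.
by rewrite -[1 + 1]/2 mulrC.
Qed.

End Line.

(** * One-variable calculus *)

Section Calculus.
Context {R : realType}.
Implicit Types (f g : R -> R).

(** The rules of differentiation are restated for functions given by an
    expression in a bound variable, so that the derivatives of explicit
    formulas are assembled by application. *)
Lemma is_derive_add f g (t df dg : R) : is_derive t 1 f df ->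
  is_derive t 1 g dg -> is_derive t 1 (fun x => f x + g x) (df + dg).
Proof. by move=> hf hg; exact: (is_deriveD hf hg). Qed.

Lemma is_derive_mul f g (t df dg : R) : is_derive t 1 f df ->
  is_derive t 1 g dg -> is_derive t 1 (fun x => f x * g x) (f t * dg + g t * df).
Proof. by move=> hf hg; exact: (is_deriveM hf hg). Qed.

Lemma is_derive_chain f g (t df dg : R) : is_derive (g t) 1 f df ->
  is_derive t 1 g dg -> is_derive t 1 (fun x => f (g x)) (df * dg).
Proof.
move=> hf hg.
exact: (is_derive1_comp hf hg).
Qed.

Lemma is_derive_const (c t : R) : is_derive t 1 (fun _ : R => c) 0.
Proof. exact: (is_derive_cst c t 1). Qed.

Lemma is_derive_cmul (c t : R) f df :
  is_derive t 1 f df -> is_derive t 1 (fun x : R => c * f x) (c * df).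
Proof.
move=> hf; have := is_derive_mul (is_derive_cst c t 1) hf.
by rewrite mulr0 addr0.
Qed.

Lemma is_derive_scale (c t : R) : is_derive t 1 (fun x : R => c * x) c.
Proof. by have := is_derive_cmul c (is_derive_id t 1); rewrite mulr1. Qed.

Lemma is_derive_continuous f (df : R -> R) :
  (forall t : R, is_derive t 1 f (df t)) -> continuous f.
Proof.
move=> h t; apply: differentiable_continuous; apply/derivable1_diffP.
by case: (h t).
Qed.

Lemma is_derive_inv f (t df : R) : f t != 0 -> is_derive t 1 f df ->
  is_derive t 1 (fun x => (f x)^-1) (- (f t) ^- 2 * df).
Proof.
move=> f0 hf; exact: (is_deriveV f0 hf).
Qed.

Lemma is_derive_pow f (t df : R) n : is_derive t 1 f df ->
  is_derive t 1 (fun x => f x ^+ n.+1) (n.+1%:R * f t ^+ n * df).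
Proof.
move=> hf; have := is_deriveX n.+1 hf.
by congr is_derive; apply/funext => x; rewrite exprfctE.
Qed.

(** Mean value theorem for the difference [G - F]. *)
Lemma le_of_derive (F G f g : R -> R) (a b : R) : a <= b ->
  (forall s : R, is_derive s 1 F (f s)) -> (forall s : R, is_derive s 1 G (g s)) ->
  (forall s, a <= s <= b -> f s <= g s) -> F b - F a <= G b - G a.
Proof.
move=> ab dF dG fg.
pose H x := G x + (-1) * F x.
have dH (s : R) : is_derive s 1 H (g s + (-1) * f s).
  by apply: is_derive_add => //; exact: is_derive_cmul.
have cH := is_derive_continuous dH.
have [|c cab] := @MVT_segment R H (fun s => g s + (-1) * f s) a b ab (fun x _ => dH x).
  exact: continuous_subspaceT.
rewrite /H !mulN1r => e.
have : 0 <= (g c - f c) * (b - a).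
  by rewrite mulr_ge0 ?subr_ge0 // fg; move: cab; rewrite in_itv.
by rewrite -e => h; rewrite -subr_ge0; apply: le_trans h _; rewrite le_eqVlt; apply/orP; left; apply/eqP; ring.
Qed.

Lemma sin_lip (x y : R) : `|sin x - sin y| <= `|x - y|.
Proof.
wlog yx : x y / y <= x => [h|].
  by have /orP[/h //|/h] := le_total y x; rewrite distrC [`|y - x|]distrC.
rewrite [`|x - y|]ger0_norm ?subr_ge0 // ler_norml; apply/andP; split.
  have h : -1 * sin x - (-1 * sin y) <= x - y.
    apply: (@le_of_derive (fun s => -1 * sin s) id (fun s => -1 * cos s) (fun=> 1)) => //.
  by lra.
apply: (@le_of_derive sin id cos (fun=> 1)) => //.
Qed.

Lemma cos_lip (x y : R) : `|cos x - cos y| <= `|x - y|.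
Proof.
have h z : cos z = sin (z + pi / 2) by rewrite sinDpihalf.
by rewrite !h (le_trans (sin_lip _ _)) // opprD addrACA subrr addr0.
Qed.

Lemma cos_ge1Bsqr (x : R) : 1 - x ^+ 2 / 2 <= cos x.
Proof.
wlog x0 : x / 0 <= x => [h|].
  by have /orP[/h //|] := le_total 0 x; rewrite -oppr_ge0 => /h; rewrite sqrrN cosN.
have h : -1 * cos x - (-1 * cos 0) <= 2^-1 * (x * x) - 2^-1 * (0 * 0).
  apply: (@le_of_derive (fun s => -1 * cos s) (fun s => 2^-1 * (s * s))
      (fun s => -1 * - sin s) (fun s => 2^-1 * (s * 1 + s * 1))) => //.
  move=> s /andP[s0 _]; rewrite mulN1r opprK mulr1.
    have -> : 2^-1 * (s + s) = s by field.
    have := sin_lip s 0; rewrite sin0 !subr0 (ger0_norm s0).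
    exact/le_trans/ler_norm.
move: h; rewrite cos0 !mulr0 subr0 !mulN1r opprK => h.
have -> : x ^+ 2 / 2 = 2^-1 * (x * x) by rewrite expr2 mulrC.
by lra.
Qed.

Lemma expabs_nat_cvg0 (a : R) : 0 < a ->
  (fun n : nat => expabs a n%:R) @ \oo --> 0.
Proof.
move=> a0.
have h : (fun n : nat => expR (- a) ^+ n) @ \oo --> (0 : R).
  by apply: cvg_expr; rewrite ger0_norm ?expR_ge0 // expR_lt1 oppr_lt0.
apply: cvg_trans h; apply: near_eq_cvg; apply: nearW => n.
by rewrite /expabs ger0_norm // -expRM_natl mulrC -mulNr mulrC.
Qed.

(** Fundamental theorem of calculus on [[- n, n]], then dominated convergence
    in [n]. *)
Lemma intR_derivative G g : (forall t : R, is_derive t 1 G (g t)) ->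
  continuous g -> integrableR g ->
  (fun n : nat => G n%:R) @ \oo --> 0 -> (fun n : nat => G (- n%:R)) @ \oo --> 0 ->
  intR g = 0.
Proof.
move=> dG cg hg Gy GNy.
pose fn (n : nat) := g \_ (`[- n.+1%:R, n.+1%:R]).
have mg := integrableR_measurable hg.
have cG := is_derive_continuous dG.
have [||||_ h] := @intR_dct R fn g (fun t => `|g t|).
- by move=> n; apply/measurable_restrict => //; exact: measurable_funTS.
- exact: (integrable_norm hg).
- by move=> n t; rewrite /fn patchE; case: ifP => // _; rewrite normr0.
- move=> t; apply/cvgrPdist_lt => e e0; near=> n.
  rewrite /fn patchE ifT ?subrr ?normr0 // inE /= in_itv /= -ler_norml.
  near: n; exists (Num.truncn `|t|) => // n /= hn.
  by apply: ltW; rewrite (lt_le_trans (truncnS_gt _)) // ler_nat ltnS.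
have h2 : intR \o fn @ \oo --> (0 : R).
  have e : intR \o fn = (fun n : nat => G n.+1%:R - G (- n.+1%:R)).
    apply/funext => n /=; rewrite /intR -Rintegral_mkcond /Rintegral.
    have n0 : - n.+1%:R < n.+1%:R :> R by rewrite (@lt_trans _ _ 0) ?oppr_lt0 ?ltr0n.
    rewrite (@continuous_FTC2 R g G) //.
    - exact: continuous_subspaceT.
    - split; first by move=> x _; case: (dG x).
      + by apply: cvg_at_right_filter; exact: cG.
      + by apply: cvg_at_left_filter; exact: cG.
    - by move=> x _; rewrite derive1E; case: (dG x).
  rewrite e -[X in _ --> X](subrr 0); apply: cvgB.
    by have := Gy; rewrite -(cvg_shiftS (fun n : nat => G n%:R)).
  by have := GNy; rewrite -(cvg_shiftS (fun n : nat => G (- n%:R))).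
exact: (cvg_unique _ h h2).
Unshelve. all: by end_near.
Qed.

End Calculus.

(** * Positivity of the Fourier transform of a power of sech *)

Section Sech.
Context {R : realType}.
Implicit Types (t tau : R) (m : nat).

Let a : R := 4^-1.
Let a0 : 0 < a. Proof. by rewrite /a invr_gt0. Qed.

Definition ch4 t : R := 2^-1 * (expR (a * t) + expR (- a * t)).
Definition sh4 t : R := 2^-1 * (expR (a * t) - expR (- a * t)).

(** With [t / 4] in the argument, [sech4 t ^+ 2 / 4] is the limit as [rho]
    tends to 1 of [profile rho t / (rho - 1)], see [profile_near]. *)
Definition sech4 t : R := (ch4 t)^-1.

Lemma ch4_gt0 t : 0 < ch4 t.
Proof. by rewrite mulr_gt0 // addr_gt0 ?expR_gt0. Qed.

Lemma sech4_gt0 t : 0 < sech4 t.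
Proof. by rewrite invr_gt0 ch4_gt0. Qed.

Lemma ch4_ge0 t : 0 <= ch4 t.
Proof. exact/ltW/ch4_gt0. Qed.

Lemma sech4_ge0 t : 0 <= sech4 t.
Proof. exact/ltW/sech4_gt0. Qed.

Lemma ch4_sh4 t : sh4 t ^+ 2 = ch4 t ^+ 2 - 1.
Proof.
have h : expR (a * t) * expR (- a * t) = 1.
  by rewrite -expRD mulNr subrr expR0.
rewrite /ch4 /sh4; move: h.
set x := expR _; set y := expR _ => h.
have -> : (2^-1 * (x + y)) ^+ 2 = (2^-1 * (x - y)) ^+ 2 + x * y by field.
by rewrite h addrK.
Qed.

Lemma is_derive_ch4 t : is_derive t 1 ch4 (a * sh4 t).
Proof.
have h (c : R) : is_derive t 1 (fun x => expR (c * x)) (expR (c * t) * c).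
  apply: (@is_derive_chain R expR) => //.
  exact: is_derive_scale.
have := is_derive_cmul 2^-1 (is_derive_add (h a) (h (- a))).
congr (is_derive _ _ _ _).
by rewrite /sh4; field.
Qed.

Lemma is_derive_sh4 t : is_derive t 1 sh4 (a * ch4 t).
Proof.
have h (c : R) : is_derive t 1 (fun x => expR (c * x)) (expR (c * t) * c).
  apply: (@is_derive_chain R expR) => //.
  exact: is_derive_scale.
have e : sh4 = (fun x => 2^-1 * (expR (a * x) + (-1) * expR (- a * x))).
  by apply/funext => x; rewrite /sh4 mulN1r.
have := is_derive_cmul 2^-1 (is_derive_add (h a) (is_derive_cmul (-1) (h (- a)))).
rewrite -e; congr (is_derive _ _ _ _).
by rewrite /ch4; field.
Qed.

Lemma is_derive_sech4 t : is_derive t 1 sech4 (- (a * sh4 t * sech4 t ^+ 2)).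
Proof.
have := is_derive_inv _ (is_derive_ch4 t).
move=> /(_ (lt0r_neq0 (ch4_gt0 t))).
congr (is_derive _ _ _ _).
by rewrite /sech4 exprVn; ring.
Qed.

(** Found by integrating [cos (tau * t) * sech4 t ^+ m.+1] by parts twice: its
    derivative only involves two powers of [sech4], of the same parity. *)
Definition sech_prim tau m t : R :=
  tau * (sin (tau * t) * sech4 t ^+ m.+1)
  + (- (m.+1%:R * a)) * (cos (tau * t) * (sh4 t * sech4 t ^+ m.+2)).

Definition sech_moment tau m : R := intR (fun t => cos (tau * t) * sech4 t ^+ m).

Lemma is_derive_sech_prim tau m t :
  is_derive t 1 (sech_prim tau m)
   ((tau ^+ 2 + (m.+1%:R * a) ^+ 2) * (cos (tau * t) * sech4 t ^+ m.+1)
    + (- (a ^+ 2 * m.+1%:R * m.+2%:R)) * (cos (tau * t) * sech4 t ^+ m.+3)).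
Proof.
have hs : is_derive t 1 (fun x => sin (tau * x)) (cos (tau * t) * tau).
  by apply: (@is_derive_chain R sin); exact: is_derive_scale.
have hc : is_derive t 1 (fun x => cos (tau * x)) (- sin (tau * t) * tau).
  by apply: (@is_derive_chain R cos); exact: is_derive_scale.
have hq k := is_derive_pow k (is_derive_sech4 t).
have := is_derive_add
  (is_derive_cmul tau (is_derive_mul hs (hq m)))
  (is_derive_cmul (- (m.+1%:R * a))
    (is_derive_mul hc (is_derive_mul (is_derive_sh4 t) (hq m.+1)))).
congr (is_derive _ _ _ _).
have hsh : sh4 t * sh4 t = ch4 t ^+ 2 - 1 by rewrite -expr2 ch4_sh4.
have hch : ch4 t * sech4 t = 1 by rewrite /sech4 mulfV // lt0r_neq0 // ch4_gt0.
rewrite !exprS.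
set q := sech4 t in hch *; set c := ch4 t in hsh hch *; set s := sh4 t in hsh *.
set S := sin _; set C := cos _; set Q := q ^+ m.
have -> : (m.+2)%:R = m%:R + 2 :> R by rewrite -addn2 natrD.
have -> : (m.+1)%:R = m%:R + 1 :> R by rewrite -addn1 natrD.
set M := m%:R.
have hs2 : s * s * (q * q) = 1 - q * q.
  by rewrite hsh expr2 mulrBl mul1r mulrACA hch mulr1.
transitivity (tau * (C * tau) * (q * Q) + (- ((M + 1) * a)) *
   (C * (q * Q) * (a * (c * q)) - C * (M + 2) * a * (q * Q) * (s * s * (q * q)))).
  by ring.
by rewrite hch hs2; ring.
Qed.

Lemma sech4_le t : sech4 t <= 2 * expabs a t.
Proof.
rewrite /sech4 -[X in _ <= X]invrK lef_pV2 ?posrE ?ch4_gt0 ?invr_gt0 ?mulr_gt0 ?expR_gt0 //.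
rewrite invfM /expabs -expRN opprK /ch4 ler_pM2l ?invr_gt0 //.
have [t0|t0] := leP 0 t.
  by rewrite ger0_norm // lerDl expR_ge0.
by rewrite ltr0_norm // mulrN -mulNr lerDr expR_ge0.
Qed.

Lemma sech4_le1 t : sech4 t <= 1.
Proof.
rewrite /sech4 invf_le1 ?ch4_gt0 // -(ler_pXn2r (n := 2)) ?nnegrE ?ch4_ge0 //.
by rewrite expr1n -subr_ge0 -ch4_sh4 sqr_ge0.
Qed.

Lemma sech4X_le m t : sech4 t ^+ m.+1 <= 2 * expabs a t.
Proof.
rewrite exprS (le_trans _ (sech4_le t)) // ler_piMr ?sech4_ge0 //.
by rewrite exprn_ile1 ?sech4_le1 ?sech4_ge0.
Qed.

Lemma norm_sh4_sech4 t : `|sh4 t * sech4 t| <= 1.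
Proof.
have h : ch4 t * sech4 t = 1 by rewrite /sech4 mulfV // lt0r_neq0 // ch4_gt0.
rewrite -(ler_pXn2r (n := 2)) ?nnegrE // real_normK ?num_real //.
by rewrite exprMn ch4_sh4 mulrBl -exprMn h mul1r lerBlDr lerDl sqr_ge0.
Qed.

Lemma continuous_sech4 : continuous sech4.
Proof. exact: is_derive_continuous is_derive_sech4. Qed.

Lemma continuous_cos_scale tau : continuous (fun t => cos (tau * t)).
Proof.
move=> t; apply: (@continuous_comp _ _ _ (fun t : R => tau * t) cos).
  exact: mulrl_continuous.
exact: continuous_cos.
Qed.

Lemma continuous_cos_sech4X tau m : continuous (fun t => cos (tau * t) * sech4 t ^+ m).
Proof.
move=> t; apply: (@continuousM R _ (fun t => cos (tau * t)) (fun t => sech4 t ^+ m)).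
  exact: continuous_cos_scale.
apply: (@continuous_comp _ _ _ sech4 (fun x => x ^+ m)).
  exact: continuous_sech4.
exact: exprn_continuous.
Qed.

Lemma integrableR_cos_sech4X tau m : integrableR (fun t => cos (tau * t) * sech4 t ^+ m.+1).
Proof.
apply: (integrableR_le (g := fun t => 2 * expabs a t)).
- apply: continuous_measurable_fun; exact: continuous_cos_sech4X.
- by apply: integrableRZ; exact: integrableR_expabs.
- move=> t; rewrite normrM [X in _ * X]ger0_norm ?exprn_ge0 ?sech4_ge0 //.
  apply: le_trans (sech4X_le m t).
  by rewrite ler_piMl ?exprn_ge0 ?sech4_ge0 // cos_max.
Qed.

Lemma sech_prim_le tau m t : `|sech_prim tau m t| <=
  (`|tau| + m.+1%:R * a) * (2 * expabs a t).
Proof.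
rewrite mulrDl /sech_prim (le_trans (ler_normD _ _)) // lerD //.
  rewrite normrM ler_wpM2l // normrM.
  rewrite [X in _ * X]ger0_norm ?exprn_ge0 ?sech4_ge0 //.
  apply: le_trans (sech4X_le m t).
  by rewrite ler_piMl ?exprn_ge0 ?sech4_ge0 // sin_max.
have ma : 0 <= m.+1%:R * a by rewrite mulr_ge0 // ltW.
rewrite normrM normrN (ger0_norm ma); apply: ler_wpM2l => //.
rewrite exprS (mulrA (sh4 t)) (mulrA (cos _)) normrM -[X in _ <= X]mul1r; apply: ler_pM => //.
  rewrite normrM -[X in _ <= X]mul1r ler_pM ?norm_sh4_sech4 //.
  by exact: cos_max.
rewrite ger0_norm ?exprn_ge0 ?sech4_ge0 //.
exact: sech4X_le.
Qed.

(** The primitive [sech_prim] vanishes at both ends of the line, so its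
    derivative has integral zero. *)
Lemma sech_moment_rec tau m :
  (tau ^+ 2 + (m.+1%:R * a) ^+ 2) * sech_moment tau m.+1 =
  a ^+ 2 * m.+1%:R * m.+2%:R * sech_moment tau m.+3.
Proof.
have h : intR (fun t => (tau ^+ 2 + (m.+1%:R * a) ^+ 2) * (cos (tau * t) * sech4 t ^+ m.+1)
    + (- (a ^+ 2 * m.+1%:R * m.+2%:R)) * (cos (tau * t) * sech4 t ^+ m.+3)) = 0.
  have ch : (fun n : nat => (`|tau| + m.+1%:R * a) * (2 * expabs a n%:R)) @ \oo --> (0 : R).
    rewrite -[X in _ --> X](mulr0 (`|tau| + m.+1%:R * a)); apply: cvgMr.
    rewrite -[X in _ --> X](mulr0 2); apply: cvgMr.
    exact: expabs_nat_cvg0.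
  refine (@intR_derivative R (sech_prim tau m) _ _ _ _ _ _).
  - exact: is_derive_sech_prim.
  - by move=> t; apply: cvgD; apply: cvgMr; exact: continuous_cos_sech4X.
  - by apply: integrableRD; apply: integrableRZ; exact: integrableR_cos_sech4X.
  - apply/norm_cvg0P; apply: squeeze_cvgr (cvg_cst 0) ch.
    by apply: nearW => n; rewrite normr_ge0 sech_prim_le.
  - apply/norm_cvg0P; apply: squeeze_cvgr (cvg_cst 0) ch.
    apply: nearW => n; rewrite normr_ge0 (le_trans (sech_prim_le _ _ _)) //.
    by rewrite /expabs normrN.
move: h; rewrite intRD; try by apply: integrableRZ; exact: integrableR_cos_sech4X.
rewrite !intRZ; try exact: integrableR_cos_sech4X.
by rewrite mulNr => /eqP; rewrite subr_eq0 => /eqP.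
Qed.

(** Since [|t| <= 8 |sh4 t|], a factor [t ^+ 2] costs two powers of [sech4]:
    this lets the recursion at [tau = 0] bound the second moment in [t]. *)
Lemma sqr_sech4X_le m t :
  t ^+ 2 * sech4 t ^+ m.+2 <= 64 * (sech4 t ^+ m + (-1) * sech4 t ^+ m.+2).
Proof.
have hch : ch4 t * sech4 t = 1 by rewrite /sech4 mulfV // lt0r_neq0 // ch4_gt0.
have -> : sech4 t ^+ m + (-1) * sech4 t ^+ m.+2 = sh4 t ^+ 2 * sech4 t ^+ m.+2.
  rewrite ch4_sh4 !exprSr.
  transitivity (sech4 t ^+ m * ((ch4 t * sech4 t) ^+ 2 - sech4 t ^+ 2)); last by ring.
  by rewrite hch; ring.
rewrite mulrA ler_wpM2r ?exprn_ge0 ?sech4_ge0 //.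
have sN : sh4 t ^+ 2 = sh4 (- t) ^+ 2.
  rewrite /sh4; have -> : a * - t = - a * t by ring.
  have -> : - a * - t = a * t by ring.
  by ring.
wlog t0 : t {hch} sN / 0 <= t => [h|].
  have /orP[|] := le_total 0 t; first exact: h.
  rewrite -oppr_ge0 => /h; rewrite sqrrN sN opprK; exact.
have at0 : 0 <= a * t by rewrite mulr_ge0 // ltW.
have : a * t / 2 <= sh4 t.
  rewrite /sh4 mulrC ler_pM2l ?invr_gt0 //.
  have h1 := expR_ge1Dx (a * t).
  have h2 : expR (- a * t) <= 1 by rewrite -expR0 ler_expR mulNr oppr_le0.
  lra.
move=> h; have h0 : 0 <= a * t / 2 by rewrite divr_ge0.
have : (a * t / 2) ^+ 2 <= sh4 t ^+ 2.
  by rewrite ler_pXn2r // nnegrE // (le_trans h0).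
have -> : (a * t / 2) ^+ 2 = 64^-1 * t ^+ 2 by rewrite /a; field.
by rewrite ler_pdivrMl.
Qed.

Lemma sech_moment0 m : sech_moment 0 m = intR (fun t => sech4 t ^+ m).
Proof. by congr intR; apply/funext => t; rewrite mul0r cos0 mul1r. Qed.

Lemma integrableR_sech4X m : integrableR (fun t => sech4 t ^+ m.+1).
Proof.
have := integrableR_cos_sech4X 0 m.
by congr integrableR; apply/funext => t; rewrite mul0r cos0 mul1r.
Qed.

(** A lower bound by the exponential density on the right half-line avoids any
    discussion of integrals of positive functions. *)
Lemma sech_moment0_gt0 m : 0 < sech_moment 0 m.+1.
Proof.
rewrite sech_moment0.
have c0 : 0 < m.+1%:R * a by rewrite mulr_gt0.
apply: (@lt_le_trans _ _ (intR (fun t => (m.+1%:R * a)^-1 * exponential_pdf (m.+1%:R * a) t))).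
  rewrite intRZ; last exact: integrableR_exponential_pdf.
  by rewrite /intR /Rintegral integral_exponential_pdf //= mulr1 invr_gt0.
apply: intR_le; [by apply: integrableRZ; exact: integrableR_exponential_pdf|exact: integrableR_sech4X|].
move=> t; have [t0|t0] := leP 0 t; last first.
  by rewrite lt0_exponential_pdf // mulr0 exprn_ge0 // sech4_ge0.
rewrite exponential_pdfE // mulKf ?gt_eqF // -mulrN -mulrA expRM_natl.
rewrite ler_pXn2r ?nnegrE ?expR_ge0 ?sech4_ge0 //.
rewrite /sech4 mulNr expRN lef_pV2 ?posrE ?ch4_gt0 ?expR_gt0 // /ch4 mulNr.
have : expR (- (a * t)) <= expR (a * t).
  by rewrite ler_expR ge0_cp // mulr_ge0 // ltW.
lra.
Qed.

(** For large [m] the weight [sech4 t ^+ m] concentrates at the origin, where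
    [cos (tau * t)] is close to 1. Quantitatively, [cos x >= 1 - x ^+ 2 / 2]
    and the recursion at [tau = 0] gives the second moment. *)
Lemma sech_moment_gt0_large tau m : 32 * tau ^+ 2 < m.+1%:R ->
  0 < sech_moment tau m.+3.
Proof.
move=> mtau; have S0 := sech_moment0_gt0 m.+2.
have r0 := sech_moment_rec 0 m.
have h : intR (fun t => (1 + 32 * tau ^+ 2) * sech4 t ^+ m.+3 +
   (- (32 * tau ^+ 2)) * sech4 t ^+ m.+1) <= sech_moment tau m.+3.
  apply: intR_le; [by apply: integrableRD; apply: integrableRZ; exact: integrableR_sech4X|exact: integrableR_cos_sech4X|].
  move=> t; have h1 := cos_ge1Bsqr (tau * t).
  have h2 := sqr_sech4X_le m.+1 t.
  have h3 : 0 <= sech4 t ^+ m.+3 by rewrite exprn_ge0 ?sech4_ge0.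
  have h4 := ler_wpM2r h3 h1.
  apply: le_trans h4.
  have h5 := ler_wpM2l (sqr_ge0 tau) h2.
  rewrite exprMn mulrBl mul1r.
  set q3 := sech4 t ^+ m.+3 in h2 h3 h5 *; set q1 := sech4 t ^+ m.+1 in h2 h5 *.
  have -> : tau ^+ 2 * t ^+ 2 / 2 * q3 = 2^-1 * (tau ^+ 2 * (t ^+ 2 * q3)) by ring.
  have -> : (1 + 32 * tau ^+ 2) * q3 + - (32 * tau ^+ 2) * q1 =
     q3 - 2^-1 * (tau ^+ 2 * (64 * (q1 + -1 * q3))) by field.
  by rewrite lerD2l lerN2 ler_pM2l ?invr_gt0.
apply: lt_le_trans h.
rewrite intRD; try by apply: integrableRZ; exact: integrableR_sech4X.
rewrite !intRZ; try exact: integrableR_sech4X.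
rewrite -!sech_moment0.
move: r0; rewrite expr0n /= add0r.
set S1 := sech_moment 0 m.+1; set S3 := sech_moment 0 m.+3 in S0 *.
have -> : (m.+2)%:R = m.+1%:R + 1 :> R by rewrite -[m.+2]addn1 natrD.
set M := m.+1%:R in mtau *.
have M0 : 0 < M by rewrite ltr0n.
move=> r0.
have -> : S1 = S3 + S3 / M.
  apply: (@mulfI _ ((M * a) ^+ 2)); first by rewrite expf_neq0 // mulf_neq0 ?gt_eqF.
  by rewrite r0; field; rewrite gt_eqF.
have -> : (1 + 32 * tau ^+ 2) * S3 + - (32 * tau ^+ 2) * (S3 + S3 / M) =
  S3 * (1 - 32 * tau ^+ 2 / M) by field; rewrite gt_eqF.
by rewrite mulr_gt0 // subr_gt0 ltr_pdivrMr // mul1r.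
Qed.

(** Both coefficients of the recursion are positive, so positivity descends to
    smaller exponents of the same parity. *)
Lemma sech_moment_gt0_down tau m : 0 < sech_moment tau m.+3 -> 0 < sech_moment tau m.+1.
Proof.
have a2 : 0 < a ^+ 2 by rewrite exprn_gt0.
have c0 : 0 < m.+1%:R * a by rewrite mulr_gt0.
move=> h; have := sech_moment_rec tau m => e.
have : 0 < (tau ^+ 2 + (m.+1%:R * a) ^+ 2) * sech_moment tau m.+1.
  by rewrite e !mulr_gt0.
by rewrite pmulr_rgt0 // ltr_wpDl ?sqr_ge0 // exprn_gt0.
Qed.

Lemma sech_moment2_gt0 tau : 0 < sech_moment tau 2.
Proof.
have H k : 0 < sech_moment tau (k.*2.+2) -> 0 < sech_moment tau 2.
  by elim: k => // k IH h; apply/IH/sech_moment_gt0_down.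
(* the descent starts at an even exponent larger than 32 tau^2 *)
pose k := (Num.truncn (32 * tau ^+ 2)).+1.
apply: (H k.+1); rewrite doubleS; apply: sech_moment_gt0_large.
apply: (lt_le_trans (truncnS_gt _)); rewrite ler_nat /k -addnn.
exact: leq_trans (leq_addr _ _) (leq_trans (leqnSn _) (leqnSn _)).
Qed.

End Sech.

(** * A bump whose Fourier transform does not vanish *)

Section Profile.
Context {R : realType}.
Implicit Types (t tau rho v : R).

(** The contribution of one level to [Bfun] at [v = u * scale j], up to its
    weight. *)
Definition geomS v : R := (1 + v)^-1.

(** The trace of a single level in [kappa], in the variable [t] centred at that
    level and up to the factor [rho / 2]: the first term comes from [tail x]
    and the second one from [tail (rho ^+ 2 * x)], which is [rho] times larger.
    *)
Definition profile rho t : R :=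
  geomS (expR (- (t / 2))) - geomS (rho * expR (- (t / 2))).

Lemma profileE rho t : 0 < rho -> profile rho t = (rho - 1) *
  (expR (- (t / 2)) / ((1 + expR (- (t / 2))) * (1 + rho * expR (- (t / 2))))).
Proof.
move=> r0; have v0 := expR_gt0 (- (t / 2)); rewrite /profile /geomS.
set v := expR _ in v0 *; have rv := mulr_gt0 r0 v0.
by field; rewrite !gt_eqF // addr_gt0.
Qed.

Lemma logistic_density t :
  expR (- (t / 2)) / (1 + expR (- (t / 2))) ^+ 2 = 4^-1 * sech4 t ^+ 2.
Proof.
have -> : - (t / 2) = - 4^-1 * t + - 4^-1 * t by field.
rewrite /sech4 /ch4 expRD.
have h : expR (4^-1 * t) * expR (- 4^-1 * t) = 1 by rewrite -expRD mulNr subrr expR0.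
have x0 := expR_gt0 (4^-1 * t); have y0 := expR_gt0 (- 4^-1 * t).
set x := expR _ in h x0 *; set y := expR _ in h y0 *.
have -> : 1 + y * y = y * (x + y) by rewrite mulrDr -h mulrC.
have xy : 0 < x + y by rewrite addr_gt0.
by field; rewrite !gt_eqF.
Qed.

(** To first order in [rho - 1] the profile is the logistic density; the
    remainder is controlled by the same density, hence is harmless for the
    transform. *)
Lemma profile_near rho t : 1 < rho ->
  `|profile rho t - (rho - 1) * (4^-1 * sech4 t ^+ 2)| <=
  (rho - 1) ^+ 2 * (4^-1 * sech4 t ^+ 2).
Proof.
move=> r1; have r0 : 0 < rho by lra.
have v0 := expR_gt0 (- (t / 2)).
rewrite profileE // -logistic_density; set v := expR _ in v0 *.
have rv := mulr_gt0 r0 v0.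
have -> : (rho - 1) * (v / ((1 + v) * (1 + rho * v))) - (rho - 1) * (v / (1 + v) ^+ 2)
  = - ((rho - 1) ^+ 2 * (v / (1 + v) ^+ 2) * (v / (1 + rho * v))).
  by field; rewrite !gt_eqF // addr_gt0.
have p0 : 0 <= (rho - 1) ^+ 2 * (v / (1 + v) ^+ 2).
  by rewrite mulr_ge0 ?sqr_ge0 // divr_ge0 ?sqr_ge0 // ltW.
rewrite normrN ger0_norm; last first.
  by rewrite mulr_ge0 // divr_ge0 // ltW // addr_gt0.
rewrite ler_piMr // ler_pdivrMr ?addr_gt0 // mul1r.
have := mulr_ge0 (ltW v0) (ltW (_ : 0 < rho - 1)); rewrite subr_gt0 => /(_ r1).
lra.
Qed.

Lemma measurable_geomS rho : 0 < rho ->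
  measurable_fun setT (fun t => geomS (rho * expR (- (t / 2)))).
Proof.
move=> r0; apply: continuous_measurable_fun.
have h (t : R) : is_derive t 1 (fun t => 1 + rho * expR (- 2^-1 * t))
    (0 + rho * (expR (- 2^-1 * t) * - 2^-1)).
  apply: is_derive_add.
  apply: is_derive_cmul; apply: (@is_derive_chain R expR).
  exact: is_derive_scale.
apply: (is_derive_continuous (df := fun t => - (1 + rho * expR (- 2^-1 * t)) ^- 2 *
   (0 + rho * (expR (- 2^-1 * t) * - 2^-1)))) => t.
have -> : (fun t => geomS (rho * expR (- (t / 2)))) =
    (fun t => (1 + rho * expR (- 2^-1 * t))^-1).
  by apply/funext => s; rewrite /geomS; congr (1 + rho * expR _)^-1; field.
apply: is_derive_inv.
by rewrite gt_eqF // addr_gt0 // mulr_gt0 // expR_gt0.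
Qed.

Lemma measurable_profile rho : 0 < rho -> measurable_fun setT (profile rho).
Proof.
move=> r0; apply: measurable_funB; last exact: measurable_geomS.
have := measurable_geomS (@ltr01 R).
by congr (measurable_fun _ _); apply/funext => t; rewrite mul1r.
Qed.

Lemma measurable_cos_profile rho tau : 0 < rho ->
  measurable_fun setT (fun t => cos (tau * t) * profile rho t).
Proof.
move=> r0; apply: measurable_funM; last exact: measurable_profile.
apply: continuous_measurable_fun; exact: continuous_cos_scale.
Qed.

Lemma integrableR_cos_profile rho tau : 1 < rho -> integrableR (fun t => cos (tau * t) * profile rho t).
Proof.
move=> r1.
apply: (integrableR_le (g := fun t => ((rho - 1) + (rho - 1) ^+ 2) * (4^-1 * sech4 t ^+ 2))).
- by apply: measurable_cos_profile; lra.
- by apply: integrableRZ; apply: integrableRZ; exact: integrableR_sech4X.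
move=> t; rewrite normrM.
apply: (@le_trans _ _ `|profile rho t|).
  by rewrite ler_piMl // cos_max.
have := profile_near t r1.
have p0 : 0 <= 4^-1 * sech4 t ^+ 2 by rewrite mulr_ge0 // sqr_ge0.
set p := _ * sech4 t ^+ 2 in p0 *.
move=> h; have -> : profile rho t = (profile rho t - (rho - 1) * p) + (rho - 1) * p by ring.
rewrite (le_trans (ler_normD _ _)) // [X in _ <= X]mulrDl [X in _ <= X]addrC lerD //.
by rewrite ger0_norm // mulr_ge0 //; lra.
Qed.

(** The transform of [sech4 ^+ 2] is positive at every frequency, and the
    correction is of second order in [rho - 1]. *)
Lemma profile_transform_gt0 tau : exists rho, [/\ 1 < rho, rho <= 2 &
  0 < intR (fun t => cos (tau * t) * profile rho t)].
Proof.
pose J := sech_moment tau 2; pose J0 := sech_moment (0 : R) 2.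
have Jp : 0 < J by exact: sech_moment2_gt0.
have J0p : 0 < J0 by exact: sech_moment2_gt0.
have JJ0 : J <= J0.
  rewrite /J0 sech_moment0; apply: intR_le; [exact: integrableR_cos_sech4X|exact: integrableR_sech4X|].
  by move=> t; rewrite ler_piMl ?sqr_ge0 // cos_le1.
pose d := J / (2 * J0).
have d0 : 0 < d by rewrite divr_gt0 // mulr_gt0.
have d1 : d <= 1 by rewrite ler_pdivrMr ?mulr_gt0 // mul1r; lra.
exists (1 + d); split; [lra|lra|].
have r1 : 1 < 1 + d by lra.
apply: (@lt_le_trans _ _ (intR (fun t => d / 4 * (cos (tau * t) * sech4 t ^+ 2) +
   (- (d ^+ 2 / 4)) * sech4 t ^+ 2))).
  rewrite intRD; [|by apply: integrableRZ; exact: integrableR_cos_sech4X|by apply: integrableRZ; exact: integrableR_sech4X].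
  rewrite !intRZ; [|exact: integrableR_sech4X|exact: integrableR_cos_sech4X].
  rewrite -sech_moment0 -/J0 -/(sech_moment tau 2) -/J.
  have -> : d / 4 * J + - (d ^+ 2 / 4) * J0 = d / 4 * (J - d * J0) by field.
  have -> : d * J0 = J / 2 by rewrite /d; field; rewrite gt_eqF.
  by rewrite mulr_gt0 ?divr_gt0 //; lra.
apply: intR_le; [|exact: integrableR_cos_profile|].
  by apply: integrableRD; apply: integrableRZ; [exact: integrableR_cos_sech4X|exact: integrableR_sech4X].
move=> t; have := profile_near t r1.
have -> : 1 + d - 1 = d by ring.
set p := sech4 t ^+ 2; set c := cos _; set q := profile _ _ => h.
have h2 : `|c * (q - d * (4^-1 * p))| <= d ^+ 2 * (4^-1 * p).
  by rewrite normrM; apply: le_trans h; rewrite ler_piMl // cos_max.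
have : - (d ^+ 2 * (4^-1 * p)) <= c * (q - d * (4^-1 * p)).
  by move: h2; rewrite ler_norml => /andP[].
have -> : c * (q - d * (4^-1 * p)) = c * q - d / 4 * (c * p) by field.
lra.
Qed.

End Profile.

(** * Depth-first exploration of a tree *)

Section Exploration.
Variable c : seq nat -> nat.

Definition children (u : seq nat) (k : nat) : seq (seq nat) :=
  [seq rcons u i | i <- iota 0 k].

(** Depth-first exploration with stack [L] that has to end after exactly [n]
    nodes. Each node asks for its number of children only once, which is what
    makes independence usable. *)
Fixpoint explores (n : nat) (L : seq (seq nat)) : bool :=
  match n, L with
  | 0, [::] => true
  | n'.+1, u :: L' => explores n' (children u (c u) ++ L')
  | _, _ => false
  end.

(** Words that are pairwise incomparable root disjoint subtrees. *)
Definition incomparable (u v : seq nat) : bool := ~~ prefix u v && ~~ prefix v u.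

Lemma size_explores n L : explores n L -> (size L <= n)%N.
Proof.
elim: n L => [|n IH] [|u L] //= /IH.
by rewrite size_cat ltnS; apply: leq_trans; exact: leq_addl.
Qed.

Lemma mem_children u k v : reflect (exists2 i, (i < k)%N & v = rcons u i) (v \in children u k).
Proof.
apply: (iffP mapP) => -[j]; first by rewrite mem_iota => ik ->; exists j.
by move=> ik ->; exists j; rewrite // mem_iota.
Qed.

Lemma prefix_children u k v : v \in children u k -> prefix u v.
Proof. by move=> /mem_children[i _ ->]; exact: prefix_rcons. Qed.

Lemma prefix_rconsP (u v : seq nat) i : prefix v (rcons u i) -> prefix v u \/ v = rcons u i.
Proof.
move=> /prefixP[w]; case/lastP: w => [|w j]; first by rewrite cats0 => ->; right.
by rewrite -rcons_cat => /rcons_inj[-> _]; left; exact: prefix_prefix.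
Qed.

Lemma incomparable_children u k L : pairwise incomparable (u :: L) ->
  pairwise incomparable (children u k ++ L).
Proof.
rewrite /= => /andP[/allP uL pL]; rewrite pairwise_cat pL andbT; apply/andP; split.
  apply/allrelP => x y /mem_children[i _ ->] /uL /andP[uy yu]; apply/andP; split.
    by apply: contra uy; exact/prefix_trans/prefix_rcons.
  apply/negP => /prefix_rconsP[h|h]; first by rewrite h in yu.
  by move: uy; rewrite h prefix_rcons.
rewrite /children pairwise_map; apply/(pairwiseP 0%N) => i j; rewrite !inE size_iota => ik jk ij.
rewrite !nth_iota // !add0n /=.
have h (a b : nat) : (a != b) -> ~~ prefix (rcons u a) (rcons u b).
  apply: contra => /prefix_rconsP[/size_prefix|/rcons_inj[->]//].
  by rewrite size_rcons ltnn.
by rewrite /incomparable !h // ?(ltn_eqF ij) // eq_sym (ltn_eqF ij).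
Qed.

(** The forest with roots in [L]; for the single root [[::]] it is the
    Ulam-Harris tree. *)
Definition forest (L : seq (seq nat)) : set (seq nat) :=
  [set v | exists u w, [/\ u \in L, v = u ++ w &
     forall k, (k < size w)%N -> (nth 0%N w k < c (u ++ take k w))%N]].

Lemma forest_prefix L v : forest L v -> exists2 u, u \in L & prefix u v.
Proof. by move=> [u [w [uL -> _]]]; exists u => //; exact: prefix_prefix. Qed.

Lemma forest_cons u L : forest (u :: L) = u |` forest (children u (c u) ++ L).
Proof.
apply/seteqP; split=> v /=.
  move=> [x [w [xL vE H]]]; move: xL; rewrite inE => /orP[/eqP xu|xL]; last first.
    by right; exists x, w; rewrite mem_cat xL orbT.
  subst x; case: w vE H => [|i w] vE H; first by left; rewrite vE cats0.
  right; exists (rcons u i), w; split.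
  - by rewrite mem_cat; apply/orP; left; apply/mem_children; exists i => //; have := H 0%N isT; rewrite /= cats0.
  - by rewrite cat_rcons.
  - by move=> k kw; have := H k.+1 kw; rewrite /= cat_rcons.
move=> [->|[x [w [xL -> H]]]].
  by exists u, [::]; rewrite mem_head cats0.
move: xL; rewrite mem_cat => /orP[/mem_children[i iu xE]|xL]; last first.
  by exists x, w; rewrite inE xL orbT.
exists u, (i :: w); split; [exact: mem_head|by rewrite xE cat_rcons|].
case=> [|k] kw /=; first by rewrite cats0.
by have := H k kw; rewrite xE cat_rcons.
Qed.

Lemma forest_notin u L : pairwise incomparable (u :: L) ->
  ~ forest (children u (c u) ++ L) u.
Proof.
rewrite /= => /andP[/allP uL _] /forest_prefix[x].
rewrite mem_cat => /orP[/mem_children[i _ ->] /size_prefix|/uL/andP[_ /negP]//].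
by rewrite size_rcons ltnn.
Qed.

Lemma card_setU1 (T : Type) (x : T) (A : set T) n : ~ A x ->
  (x |` A #= `I_n.+1)%card = (A #= `I_n)%card.
Proof.
move=> Ax; have AE : (x |` A) `\ x = A
  by apply/seteqP; split=> y /=; [case=> -[]|move=> Ay; split; [right|move=> yx; apply: Ax; rewrite -yx]].
apply/idP/idP => h; last by apply/eq_cardSP; exists x; [left|rewrite AE].
have /finite_setP[m Am] : finite_set A.
  by apply: (@sub_finite_set _ _ (x |` A)); [move=> y; right|apply/finite_setP; exists n.+1].
have h2 : (x |` A #= `I_m.+1)%card by apply/eq_cardSP; exists x; [left|rewrite AE].
have : (`I_m.+1 #= `I_n.+1)%card by apply: card_eq_trans h; rewrite card_eq_sym.
by move/card_eq_II => [<-].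
Qed.

(** One step of the exploration removes one node from the forest. *)
Lemma exploresP n L : pairwise incomparable L ->
  explores n L = (forest L #= `I_n)%card.
Proof.
elim: n L => [|n IH] [|u L] pL.
- by rewrite /= II0 card_eq0; apply/esym/eqP/seteqP; split=> v // [u [w []]].
- rewrite /= II0 card_eq0; apply/esym/eqP => /seteqP[/(_ u) + _]; apply.
  by exists u, [::]; rewrite mem_head cats0.
- rewrite /= (_ : forest [::] = set0); last by apply/seteqP; split=> v // [u [w []]].
  by apply/esym/negP => /eq_cardSP[].
- rewrite /= forest_cons card_setU1; last exact: forest_notin.
  by apply: IH; exact: incomparable_children.
Qed.

Lemma ulam_harris_forest : ulam_harris_tree c = forest [:: [::]].
Proof.
apply/seteqP; split=> v /=; first by move=> h; exists [::], v; rewrite mem_head.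
by move=> [u [w []]]; rewrite inE => /eqP -> -> .
Qed.

Lemma card_ulam_harris n : (ulam_harris_tree c #= `I_n)%card = explores n [:: [::]].
Proof. by rewrite ulam_harris_forest exploresP. Qed.

End Exploration.

(** * The law of the total progeny *)

Section ForestWeight.
Context {R : realType}.
Variable p : nat -> R.

(** The probability that [k] independent trees with offspring weights [p] have
    [n] nodes in total, computed along the exploration: [d] is the number of
    children of the first root. Larger [d] are impossible, as each of the [d]
    children still has to be visited. *)
Fixpoint forest_weight (n k : nat) : R :=
  match n, k with
  | 0, 0 => 1
  | n'.+1, k'.+1 => \sum_(d < n'.+1) p d * forest_weight n' (d + k')
  | _, _ => 0
  end.

Lemma forest_weight_gt n k : (n < k)%N -> forest_weight n k = 0.
Proof.
elim: n k => [|n IH] [|k] //= nk; apply: big1 => d _.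
by rewrite IH ?mulr0 // ltn_addl.
Qed.

End ForestWeight.

Section ExplorationProbability.
Context d (T : measurableType d) (R : realType) (P : probability T R).
Variable X : seq nat -> {RV P >-> nat}.
Variable p : nat -> R.
Hypothesis Xindep : mutually_independent X.
Hypothesis Xlaw : forall u k, P (X u @^-1` [set k]) = (p k)%:E.

Let ev n L : set T := [set w | explores (fun u => X u w) n L].

Lemma measurable_RV u (A : set nat) : measurable (X u @^-1` A).
Proof. by rewrite -[X in measurable X]setTI; apply: measurable_funPT. Qed.

Lemma event_cons n u L : ev n.+1 (u :: L) =
  \big[setU/set0]_(k < n.+1) (X u @^-1` [set (k : nat)] `&` ev n (children u k ++ L)).
Proof.
rewrite -(bigcup_mkord n.+1
  (fun k => X u @^-1` [set k] `&` ev n (children u k ++ L))).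
apply/seteqP; split=> w /= => [h|[k _ [/= e]]]; last by rewrite /ev /= e.
exists (X u w); last by split.
have : (size (children u (X u w) ++ L) <= n)%N
  by apply: (@size_explores (fun v => X v w)); exact: h.
rewrite size_cat size_map size_iota /= ltnS.
by apply: leq_trans; exact: leq_addr.
Qed.

Lemma measurable_event n L : measurable (ev n L).
Proof.
elim: n L => [|n IH] [|u L].
- by rewrite (_ : ev _ _ = setT) //; apply/seteqP; split.
- by rewrite (_ : ev _ _ = set0) //; apply/seteqP; split.
- by rewrite (_ : ev _ _ = set0) //; apply/seteqP; split.
- rewrite event_cons; apply: bigsetU_measurable => k _; apply: measurableI => //.
  exact: measurable_RV.
Qed.

(** The events on the nodes [s] explored before are carried along in the
    induction, so that mutual independence is only used at its end, on a finite
    family of nodes. *)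
Lemma explores_prob n L (s : seq (seq nat)) (A : seq nat -> set nat) :
  uniq s -> pairwise incomparable L ->
  (forall u v, u \in L -> v \in s -> ~~ prefix u v) ->
  P (\bigcap_(u in [set` s]) (X u @^-1` A u) `&` ev n L) =
  ((\prod_(u <- s) P (X u @^-1` A u)) * (forest_weight p n (size L))%:E)%E.
Proof.
have mA (s' : seq (seq nat)) B : measurable (\bigcap_(u in [set` s']) (X u @^-1` B u)).
  apply: fin_bigcap_measurable => [|u _]; first exact: finite_seq.
  exact: measurable_RV.
elim: n L s A => [|n IH] [|u L] s A us pL sL.
- rewrite (_ : ev _ _ = setT); last by apply/seteqP; split.
  by rewrite setIT /= mule1 Xindep.
- by rewrite (_ : ev _ _ = set0) /= ?mule0 ?setI0 ?measure0 //; apply/seteqP; split.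
- by rewrite (_ : ev _ _ = set0) /= ?mule0 ?setI0 ?measure0 //; apply/seteqP; split.
rewrite event_cons big_distrr /= measure_bigsetU_ord //; last 2 first.
- move=> k; apply: measurableI => //; apply: measurableI; first exact: measurable_RV.
  exact: measurable_event.
- apply/trivIsetP => i j _ _ ij; apply/seteqP; split=> // w [[_ [/= ei _]] [_ [/= ej _]]].
  by move/eqP: ij; apply; apply/val_inj; rewrite /= -ei -ej.
have uNs : u \notin s.
  by apply/negP => h; have := sL u u (mem_head _ _) h; rewrite prefix_refl.
transitivity (\sum_(k < n.+1) ((\prod_(v <- s) P (X v @^-1` A v)) *
   (p k * forest_weight p n (k + size L))%:E))%E; last first.
  have fin : (\prod_(v <- s) P (X v @^-1` A v))%E \is a fin_num.
    elim/big_ind : _ => //; first by move=> x y; exact: fin_numM.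
    by move=> v _; exact: fin_num_measure (measurable_RV _ _).
  rewrite -(fineK fin); set x := fine _.
  by rewrite /= -EFinM mulr_sumr -sumEFin; apply: eq_bigr => k _; rewrite EFinM.
apply: eq_bigr => k _.
pose A' v := if v == u then [set (k : nat)] else A v.
have sE : \bigcap_(v in [set` u :: s]) (X v @^-1` A' v) =
  \bigcap_(v in [set` s]) (X v @^-1` A v) `&` X u @^-1` [set (k : nat)].
  apply/seteqP; split=> w /= h.
    split; last by have := h u (mem_head _ _); rewrite /A' /= eqxx.
    move=> v vs; have := h v; rewrite /= inE vs orbT => /(_ isT); rewrite /A'.
    by case: eqP => // vu; rewrite -vu vs in uNs.
  move=> v; rewrite /= inE /A'; case: eqP => [-> _|_ /= vs]; first exact: h.2.
  exact: h.1.
rewrite setIA -sE; apply: etrans (IH (children u k ++ L) (u :: s) A' _ _ _) _.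
- by rewrite /= uNs.
- exact: incomparable_children.
- move=> x v; rewrite mem_cat inE => /orP[xc|xL] /orP[/eqP ->|vs].
  + by move/mem_children: xc => [i _ ->]; apply/negP => /size_prefix; rewrite size_rcons ltnn.
  + by apply: contra (sL u v (mem_head _ _) vs); apply: prefix_trans; exact: prefix_children xc.
  + by move: pL => /= /andP[/allP /(_ x xL) /andP[]].
  + by apply: sL => //; rewrite inE xL orbT.
rewrite big_cons {1}/A' eqxx Xlaw /= size_cat size_map size_iota.
rewrite -muleA muleC -muleA; congr (_ * _)%E; last by rewrite muleC EFinM.
rewrite big_seq [RHS]big_seq; apply: eq_bigr => v vs; rewrite /A'.
by case: eqP => // vu; rewrite -vu vs in uNs.
Qed.

Lemma gw_size_prob_forest n : gw_size_prob X n = forest_weight p n 1.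
Proof.
rewrite /gw_size_prob.
have -> : [set w | (gw_tree X w #= `I_n)%card] = ev n [:: [::]].
  by apply/seteqP; split=> w; rewrite /ev /= card_ulam_harris.
have := @explores_prob n [:: [::]] [::] (fun=> setT) isT isT.
by rewrite big_nil mul1e set_nil bigcap_set0 setTI => ->.
Qed.

End ExplorationProbability.

(** * Series of real numbers *)

Section RealSeries.
Context {R : realType}.
Implicit Types (a b f g : nat -> R) (l m : R).

Definition has_sum a l := (series a @ \oo --> l).

Lemma has_sumD a b l m : has_sum a l -> has_sum b m -> has_sum (fun n => a n + b n) (l + m).
Proof.
move=> ha hb; rewrite /has_sum (_ : series _ = series a + series b); first exact: cvgD.
by apply/funext => N; rewrite /series /= big_split.
Qed.

Lemma has_sumZ (c : R) a l : has_sum a l -> has_sum (fun n => c * a n) (c * l).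
Proof.
move=> ha; rewrite /has_sum (_ : series _ = (fun N => c * series a N)); first exact: cvgMr.
by apply/funext => N; rewrite /series /= mulr_sumr.
Qed.

Lemma has_sumB a b l m : has_sum a l -> has_sum b m -> has_sum (fun n => a n - b n) (l - m).
Proof.
move=> ha hb; have := has_sumD ha (has_sumZ (c := -1) hb); rewrite mulN1r.
by rewrite (_ : (fun n => a n + -1 * b n) = (fun n => a n - b n)) //; apply/funext => n; rewrite mulN1r.
Qed.

Lemma has_sum_shift a l : has_sum (fun n => a n.+1) l -> has_sum a (a 0%N + l).
Proof.
move=> h; rewrite /has_sum -cvg_shiftS.
rewrite (_ : (fun N => series a N.+1) = (fun N => a 0%N + series (fun n => a n.+1) N)).
  by apply: cvgD => //; exact: cvg_cst.
by apply/funext => N; rewrite /series /= big_nat_recl // big_mkord.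
Qed.

Lemma has_sum_telescope g : g @ \oo --> (0 : R) -> has_sum (fun n => g n - g n.+1) (g 0%N).
Proof.
move=> g0; rewrite /has_sum (_ : series _ = (fun N => g 0%N - g N)).
  by rewrite -[X in _ --> X]subr0; apply: cvgB => //; exact: cvg_cst.
apply/funext => N; rewrite /series /=; elim: N => [|N IH]; first by rewrite big_geq // subrr.
by rewrite big_nat_recr //= IH; ring.
Qed.

Lemma has_sum_geometric (r : R) : 0 <= r < 1 -> has_sum (fun n => r ^+ n) (1 - r)^-1.
Proof.
move=> /andP[r0 r1]; have := @cvg_geometric_series R 1 r; rewrite ger0_norm // => /(_ r1).
by rewrite div1r (_ : geometric 1 r = (fun n => r ^+ n)) //; apply/funext => n; rewrite /= mul1r.
Qed.

Lemma psum_le a l N : (forall n, 0 <= a n) -> has_sum a l -> series a N <= l.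
Proof.
move=> a0 ha; have <- : limn (series a) = l by apply/cvg_lim.
apply: nondecreasing_cvgn_le; last by apply/cvg_ex; exists l.
by apply/nondecreasing_seqP => n; rewrite /series /= big_nat_recr //= lerDl.
Qed.

Lemma has_sum_ge0 a l : (forall n, 0 <= a n) -> has_sum a l -> 0 <= l.
Proof. by move=> a0 /(psum_le 0 a0); rewrite /series /= big_geq. Qed.

Lemma term_le a l n : (forall n, 0 <= a n) -> has_sum a l -> a n <= l.
Proof.
move=> a0 /(psum_le n.+1 a0); apply: le_trans.
by rewrite /series /= big_nat_recr //= lerDr sumr_ge0.
Qed.

Lemma has_sum_le a b l m : has_sum a l -> has_sum b m -> (forall n, a n <= b n) -> l <= m.
Proof.
move=> ha hb ab; rewrite -subr_ge0; apply: (has_sum_ge0 (a := fun n => b n - a n)).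
  by move=> n; rewrite subr_ge0.
exact: has_sumB.
Qed.

Lemma bounded_has_sum a C : (forall n, 0 <= a n) -> (forall N, series a N <= C) ->
  exists2 l, has_sum a l & l <= C.
Proof.
move=> a0 aC.
have nd : nondecreasing_seq (series a).
  by apply/nondecreasing_seqP => n; rewrite /series /= big_nat_recr //= lerDl.
have cv : cvgn (series a).
  by apply: nondecreasing_is_cvgn => //; exists C => _ [N _ <-].
by exists (limn (series a)) => //; apply: limr_le => //; apply: nearW.
Qed.

Lemma dominated_has_sum a b m : (forall n, 0 <= a n <= b n) -> has_sum b m ->
  exists2 l, has_sum a l & l <= m.
Proof.
move=> ab hb; apply: bounded_has_sum => [n|N]; first by case/andP: (ab n).
have b0 n : 0 <= b n by case/andP: (ab n) => h /(le_trans h).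
apply: le_trans (psum_le N b0 hb); rewrite /series /=.
by apply: ler_sum => n _; case/andP: (ab n).
Qed.

Lemma has_sum_EFin a l : (forall n, 0 <= a n) -> has_sum a l <->
  (\sum_(0 <= n <oo) (a n)%:E = l%:E)%E.
Proof.
move=> a0.
have e N : (\sum_(0 <= n < N) (a n)%:E = (series a N)%:E)%E.
  by rewrite /series /= sumEFin.
have cv : cvgn (fun N => \sum_(0 <= n < N) (a n)%:E)%E.
  by apply: is_cvg_nneseries => n _ _; rewrite lee_fin.
split=> h.
  apply/cvg_lim => //; rewrite (funext e).
  by apply: cvg_EFin; [exact: nearW|exact: h].
move: cv; rewrite -/(cvgn _) => /cvg_ex[/= x hx].
have xl : x = l%:E by rewrite -h; apply/esym/cvg_lim.
by move: hx; rewrite xl (funext e) => /fine_cvg.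
Qed.

Lemma double_sum (A : nat -> nat -> R) r l : (forall j n, 0 <= A j n) ->
  (forall j, has_sum (A j) (r j)) -> has_sum r l ->
  (forall n, has_sum (A ^~ n) (limn (series (A ^~ n)))) /\
  has_sum (fun n => limn (series (A ^~ n))) l.
Proof.
move=> A0 hA hr.
have r0 j : 0 <= r j by exact: has_sum_ge0 (hA j).
have cols n : has_sum (A ^~ n) (limn (series (A ^~ n))).
  have [m hm _] : exists2 m, has_sum (A ^~ n) m & m <= l.
    apply: (dominated_has_sum _ hr) => j; rewrite A0 /=; exact: term_le.
  by have -> : limn (series (A ^~ n)) = m by apply/cvg_lim.
split=> //; apply/has_sum_EFin.
  by move=> n; apply: has_sum_ge0 (cols n).
transitivity (\sum_(0 <= n <oo) \sum_(0 <= j <oo) (A j n)%:E)%E.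
  by apply: eq_eseriesr => n _; apply/esym/has_sum_EFin.
rewrite nneseries_interchange; last by move=> i j; rewrite lee_fin.
transitivity (\sum_(0 <= j <oo) (r j)%:E)%E; last exact/has_sum_EFin.
by apply: eq_eseriesr => j _; apply/has_sum_EFin.
Qed.

End RealSeries.

(** * Laws with a geometric tail *)

Section GeometricLaw.
Context {R : realType}.
Implicit Types (r d M s u : R).

Lemma sqr_geometric_cvg0 r : 0 < r < 1 ->
  (fun n : nat => n%:R ^+ 2 * r ^+ n) @ \oo --> 0.
Proof.
move=> /andP[r0 r1]; pose c := - ln r.
have c0 : 0 < c by rewrite oppr_gt0 ln_lt0 // r0.
have rE n : r ^+ n = expR (- (n%:R * c)).
  by rewrite /c mulrN opprK expRM_natl lnK // posrE.
have hb (n : nat) : 0 <= n.+1%:R ^+ 2 * r ^+ n.+1 <= 6 / c ^+ 3 * harmonic n.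
  have n0 : 0 < n.+1%:R :> R by rewrite ltr0n.
  apply/andP; split; first by rewrite mulr_ge0 ?sqr_ge0 // exprn_ge0 // ltW.
  have nc : 0 < n.+1%:R * c by rewrite mulr_gt0.
  have := @expR_ge1Dxn R (n.+1%:R * c) 2 (ltW nc).
  rewrite rE expRN /harmonic /=.
  have -> : 3`!%:R = 6 :> R by [].
  move=> h; have h6 : (n.+1%:R * c) ^+ 3 / 6 <= expR (n.+1%:R * c) by lra.
  rewrite ler_pdivrMr ?expR_gt0 //.
  have := ler_wpM2l (_ : 0 <= 6 / c ^+ 3 / n.+1%:R) h6 => h7.
  apply: le_trans (h7 _); last by rewrite !divr_ge0 ?exprn_ge0 // ltW.
  rewrite le_eqVlt; apply/orP; left; apply/eqP; field.
  by rewrite !gt_eqF.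
rewrite -(cvg_shiftS (fun n : nat => n%:R ^+ 2 * r ^+ n)).
have lim0 : (fun n => 6 / c ^+ 3 * harmonic n) @ \oo --> (0 : R).
  by rewrite -[X in _ --> X](mulr0 (6 / c ^+ 3)); apply: cvgMr; exact: cvg_harmonic.
apply: (squeeze_cvgr _ (cvg_cst 0) lim0).
by apply: nearW => n; exact: hb.
Qed.

Lemma poly_geometric_cvg0 (A B C r : R) : 0 < r < 1 ->
  (fun n : nat => (A * n%:R ^+ 2 + B * n%:R + C) * r ^+ n) @ \oo --> 0.
Proof.
move=> r01; have h2 := sqr_geometric_cvg0 r01.
have r0 : 0 <= r by case/andP: r01 => /ltW.
have h0 : (fun n : nat => r ^+ n) @ \oo --> (0 : R).
  by apply: cvg_expr; rewrite ger0_norm //; case/andP: r01.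
have h1 : (fun n : nat => n%:R * r ^+ n) @ \oo --> (0 : R).
  apply: (squeeze_cvgr _ (cvg_cst 0) h2).
  apply: nearW => n; rewrite mulr_ge0 ?exprn_ge0 //= ler_wpM2r ?exprn_ge0 //.
  by rewrite -natrX ler_nat; case: n => // n; rewrite expnS leq_pmulr // expn_gt0.
have -> : (fun n : nat => (A * n%:R ^+ 2 + B * n%:R + C) * r ^+ n) =
  (fun n : nat => A * (n%:R ^+ 2 * r ^+ n) + B * (n%:R * r ^+ n) + C * r ^+ n).
  by apply/funext => n; ring.
rewrite (_ : 0 = A * 0 + B * 0 + C * 0); last by ring.
apply: cvgD; last exact: cvgMr.
by apply: cvgD; exact: cvgMr.
Qed.

(** The law whose generating function is [s + (1 - s) ^+ 2 / (1 + (1 - s) *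
    M)], see [geom_law_gen]. *)
Definition geom_law M (n : nat) : R :=
  match n with
  | 0 => (1 + M)^-1
  | 1 => 1 - (1 + M)^-1 - (1 + M) ^- 2
  | n'.+2 => (M / (1 + M)) ^+ n' * (1 + M) ^- 3
  end.

Lemma geom_law_ge0 M n : 1 <= M -> 0 <= geom_law M n.
Proof.
move=> M1; have h : 0 < 1 + M by lra.
have h2 : (1 + M)^-1 <= 2^-1 by rewrite lef_pV2 ?posrE //; lra.
have h0 : 0 <= (1 + M)^-1 by rewrite invr_ge0 ltW.
case: n => [|[|n]] //=.
  have : (1 + M)^-1 * (1 + M)^-1 <= 2^-1 * 2^-1 by rewrite ler_pM.
  rewrite -exprVn expr2; lra.
rewrite mulr_ge0 ?exprn_ge0 // ?invr_ge0 ?exprn_ge0 ?divr_ge0 //; lra.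
Qed.

Lemma has_sum_shift2 (a : nat -> R) l : has_sum (fun n => a n.+2) l ->
  has_sum a (a 0%N + (a 1%N + l)).
Proof. by move=> h; do 2!apply: has_sum_shift. Qed.

Lemma geom_law_gen M s : 1 <= M -> 0 <= s <= 1 ->
  has_sum (fun n => geom_law M n * s ^+ n)
    (s + (1 - s) ^+ 2 / (1 + (1 - s) * M)).
Proof.
move=> M1 /andP[s0 s1].
have h : 0 < 1 + M by lra.
have r0 : 0 <= M / (1 + M) * s < 1.
  rewrite mulr_ge0 ?divr_ge0 //=; try lra.
  apply: (@le_lt_trans _ _ (M / (1 + M))).
    by rewrite ler_piMr // divr_ge0; lra.
  by rewrite ltr_pdivrMr // mul1r; lra.
have hg := has_sumZ (c := (1 + M) ^- 3 * s ^+ 2) (has_sum_geometric r0).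
have := @has_sum_shift2 (fun n => geom_law M n * s ^+ n) ((1 + M) ^- 3 * s ^+ 2 * (1 - M / (1 + M) * s)^-1).
have e : (fun n => geom_law M n.+2 * s ^+ n.+2) =
   (fun n => (1 + M) ^- 3 * s ^+ 2 * (M / (1 + M) * s) ^+ n).
  apply/funext => n; rewrite /= [(_ * s) ^+ n]exprMn [s ^+ n.+2]exprS [s ^+ n.+1]exprS.
  by set r := _ ^+ n; set q := _ ^- 3; ring.
rewrite e => /(_ hg); rewrite /= expr0 mulr1 expr1.
have h3 : 0 < 1 + (1 - s) * M.
  have : 0 <= (1 - s) * M by rewrite mulr_ge0; lra.
  lra.
have -> : 1 - M / (1 + M) * s = (1 + (1 - s) * M) / (1 + M) by field; rewrite gt_eqF.
congr (has_sum _ _); field.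
by rewrite !gt_eqF.
Qed.

Let delta_bounds M : 1 <= M -> 0 < M / (1 + M) < 1.
Proof.
move=> M1; have h : 0 < 1 + M by lra.
by rewrite divr_gt0 /= ?ltr_pdivrMr ?mul1r; lra.
Qed.

(** The general term is the difference of consecutive values of a polynomial
    times a power, so the series telescopes. *)
Lemma geom_law_mean M : 1 <= M -> has_sum (fun n => geom_law M n * n%:R) 1.
Proof.
move=> M1; have h : 0 < 1 + M by lra.
set d := (1 + M)^-1.
(* a quadratic polynomial with leading coefficient zero, so that
   [poly_geometric_cvg0] serves both moments *)
pose g (n : nat) : R := (0 * n%:R ^+ 2 + d ^+ 2 * n%:R + (d ^+ 2 + d)) * (M / (1 + M)) ^+ n.
have hg : has_sum (fun n => g n - g n.+1) (g 0%N).
  by apply: has_sum_telescope; apply: poly_geometric_cvg0; exact: delta_bounds.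
have e : (fun n => g n - g n.+1) = (fun n => geom_law M n.+2 * (n.+2%:R)).
  apply/funext => n; rewrite /g /d /= [_ ^+ n.+1]exprS.
  have -> : n.+2%:R = n%:R + 2 :> R by rewrite -addn2 natrD.
  have -> : n.+1%:R = n%:R + 1 :> R by rewrite -addn1 natrD.
  by set rn := _ ^+ n; field; rewrite gt_eqF.
rewrite e in hg.
have := @has_sum_shift2 (fun n => geom_law M n * n%:R) _ hg.
congr has_sum; rewrite /g /d /= expr0; field.
by rewrite gt_eqF.
Qed.

Lemma geom_law_sqr M : 1 <= M -> has_sum (fun n => geom_law M n * n%:R ^+ 2) 3.
Proof.
move=> M1; have h : 0 < 1 + M by lra.
set d := (1 + M)^-1.
pose g (n : nat) : R := (d ^+ 2 * n%:R ^+ 2 + (2 * d ^+ 2 + 2 * d) * n%:R + (d ^+ 2 + d + 2)) * (M / (1 + M)) ^+ n.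
have hg : has_sum (fun n => g n - g n.+1) (g 0%N).
  by apply: has_sum_telescope; apply: poly_geometric_cvg0; exact: delta_bounds.
have e : (fun n => g n - g n.+1) = (fun n => geom_law M n.+2 * n.+2%:R ^+ 2).
  apply/funext => n; rewrite /g /d /= [_ ^+ n.+1]exprS.
  have -> : n.+2%:R = n%:R + 2 :> R by rewrite -addn2 natrD.
  have -> : n.+1%:R = n%:R + 1 :> R by rewrite -addn1 natrD.
  by set rn := _ ^+ n; field; rewrite gt_eqF.
rewrite e in hg.
have := @has_sum_shift2 (fun n => geom_law M n * n%:R ^+ 2) _ hg.
congr has_sum; rewrite /g /d /= expr0; field.
by rewrite gt_eqF.
Qed.

End GeometricLaw.

(** * The offspring law *)

Section OffspringLaw.
Context {R : realType}.
Implicit Types (s u : R) (j n : nat).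

(** The growth has to make [ln (scale j.+1)] much larger than [scale j]: the
    levels up to [j] are felt with the factor [scale j], and they are compared
    at two frequencies at distance of the order of [1 / ln (scale j.+1)]. *)
Fixpoint scale j : R := if j is j'.+1 then expR (scale j' ^+ 2) else 4.

Definition weight j : R := 2^-1 ^+ j.+1.

Lemma scale_ge4 j : 4 <= scale j.
Proof.
elim: j => [|j IH] //=; have := expR_ge1Dx (scale j ^+ 2).
have h : 4 * 4 <= scale j * scale j by apply: ler_pM.
move=> h2; lra.
Qed.

Lemma scale_gt0 j : 0 < scale j.
Proof. by have := scale_ge4 j; lra. Qed.

Lemma scaleS_ge j : scale j ^+ 2 <= scale j.+1.
Proof. by have := expR_ge1Dx (scale j ^+ 2); rewrite /=; lra. Qed.

Lemma scaleS_ge4 j : 4 * scale j <= scale j.+1.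
Proof.
apply: le_trans (scaleS_ge j); rewrite expr2 ler_pM2r ?scale_gt0 //.
exact: scale_ge4.
Qed.

Lemma scale_geX j : 4 ^+ j.+1 <= scale j.
Proof.
elim: j => [|j IH]; first by rewrite expr1.
by apply: le_trans (scaleS_ge4 j); rewrite exprS ler_pM2l.
Qed.

Lemma scale_mono i j : (i <= j)%N -> scale i <= scale j.
Proof.
elim: j => [|j IH]; first by rewrite leqn0 => /eqP ->.
rewrite leq_eqVlt => /orP[/eqP ->//|]; rewrite ltnS => /IH h.
by apply: le_trans h _; have := scaleS_ge4 j; have := scale_gt0 j; lra.
Qed.

Lemma weight_gt0 j : 0 < weight j.
Proof. by rewrite exprn_gt0 // invr_gt0. Qed.

Lemma weight_ge0 j : 0 <= weight j. Proof. exact/ltW/weight_gt0. Qed.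

Lemma has_sum_weight : has_sum weight 1.
Proof.
have h : 0 <= (2^-1 : R) < 1 by apply/andP; split; lra.
have := has_sumZ (c := 2^-1) (has_sum_geometric h).
have -> : (2^-1 * (1 - 2^-1)^-1 : R) = 1 by field.
congr has_sum; apply/funext => n; by rewrite /weight exprS.
Qed.

Definition offspring_pmf n : R := limn (series (fun j => weight j * geom_law (scale j) n)).

Lemma has_sum_pmf n :
  has_sum (fun j => weight j * geom_law (scale j) n) (offspring_pmf n).
Proof.
have M1 j : 1 <= scale j by have := scale_ge4 j; lra.
have g0 j : 0 <= weight j * geom_law (scale j) n.
  by rewrite mulr_ge0 ?weight_ge0 // geom_law_ge0.
have [m hm _] : exists2 m, has_sum (fun j => weight j * geom_law (scale j) n) m & m <= 1.
  apply: (dominated_has_sum _ has_sum_weight) => j; rewrite g0 /= ler_piMr ?weight_ge0 //.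
  have h01 : 0 <= (1 : R) <= 1 by rewrite ler01 lexx.
  have := geom_law_gen (M1 j) h01.
  rewrite subrr expr0n mul0r addr0 => hg.
  have := term_le n _ hg; rewrite expr1n mulr1; apply=> k.
  by rewrite expr1n mulr1 geom_law_ge0.
by have -> : offspring_pmf n = m by apply/cvg_lim.
Qed.

(** Expectations for the mixture are mixtures of expectations, by interchanging
    nonnegative sums. *)
Lemma has_sum_offspring (f : nat -> R) (r : nat -> R) l :
  (forall n, 0 <= f n) ->
  (forall j, has_sum (fun n => geom_law (scale j) n * f n) (r j)) ->
  has_sum (fun j => weight j * r j) l ->
  has_sum (fun n => offspring_pmf n * f n) l.
Proof.
move=> f0 hr hl.
have M1 j : 1 <= scale j by have := scale_ge4 j; lra.
have [_] := @double_sum R (fun j n => weight j * (geom_law (scale j) n * f n))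
  (fun j => weight j * r j) l
  (fun j n => mulr_ge0 (weight_ge0 j) (mulr_ge0 (geom_law_ge0 n (M1 j)) (f0 n)))
  (fun j => has_sumZ (hr j)) hl.
rewrite (_ : (fun n => limn _) = (fun n => offspring_pmf n * f n)) //.
apply/funext => n; apply/cvg_lim => //.
have := has_sumZ (c := f n) (@has_sum_pmf n); rewrite [f n * _]mulrC.
by rewrite (_ : (fun j => f n * _) = (fun j => weight j * (geom_law (scale j) n * f n))) //; apply/funext => j; ring.
Qed.

Lemma offspring_pmf_ge0 n : 0 <= offspring_pmf n.
Proof.
apply: has_sum_ge0 (@has_sum_pmf n) => j.
by rewrite mulr_ge0 ?weight_ge0 // geom_law_ge0 //; have := scale_ge4 j; lra.
Qed.

Lemma offspring_pmf0_gt0 : 0 < offspring_pmf 0.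
Proof.
have h j : 0 <= weight j * geom_law (scale j) 0.
  by rewrite mulr_ge0 ?weight_ge0 // geom_law_ge0 //; have := scale_ge4 j; lra.
apply: lt_le_trans (term_le 0 h (@has_sum_pmf 0)).
by rewrite mulr_gt0 ?weight_gt0 //= invr_gt0; lra.
Qed.

Lemma offspring_mean : has_sum (fun n => offspring_pmf n * n%:R) 1.
Proof.
apply: (@has_sum_offspring _ (fun=> 1)) => //.
  by move=> j; apply: geom_law_mean; have := scale_ge4 j; lra.
have -> : (fun j => weight j * 1) = weight by apply/funext => j; rewrite mulr1.
exact: has_sum_weight.
Qed.

Lemma offspring_sqr : has_sum (fun n => offspring_pmf n * n%:R ^+ 2) 3.
Proof.
apply: (@has_sum_offspring _ (fun=> 3)) => //.
- by move=> j; apply: geom_law_sqr; have := scale_ge4 j; lra.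
- rewrite -[X in has_sum _ X]mulr1.
  have -> : (fun j => weight j * 3) = (fun j => 3 * weight j) by apply/funext => j; rewrite mulrC.
  exact: has_sumZ has_sum_weight.
Qed.

(** [Bfun (1 - s)] is the factor of [(1 - s) ^+ 2] in the offspring generating
    function; it increases to 1 as its argument decreases to 0. *)
Definition Bfun u : R := limn (series (fun j => weight j / (1 + u * scale j))).

Lemma Bden_gt0 u j : 0 <= u -> 0 < 1 + u * scale j.
Proof. by move=> u0; rewrite ltr_pwDl // mulr_ge0 // ltW // scale_gt0. Qed.

Lemma Bterm_bounds u j : 0 <= u -> 0 <= weight j / (1 + u * scale j) <= weight j.
Proof.
move=> u0; have h := Bden_gt0 j u0; rewrite divr_ge0 ?weight_ge0 ?(ltW h) //=.
by rewrite ler_pdivrMr // ler_peMr ?weight_ge0 // lerDl mulr_ge0 // ltW // scale_gt0.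
Qed.

Lemma has_sum_B u : 0 <= u -> has_sum (fun j => weight j / (1 + u * scale j)) (Bfun u).
Proof.
move=> u0.
have [m hm _] := dominated_has_sum (fun j => Bterm_bounds j u0) has_sum_weight.
by have -> : Bfun u = m by apply/cvg_lim.
Qed.

Lemma Bfun_le1 u : 0 <= u -> Bfun u <= 1.
Proof.
move=> u0; apply: has_sum_le (has_sum_B u0) has_sum_weight _ => j.
by case/andP: (Bterm_bounds j u0).
Qed.

Lemma Bfun_ge u : 0 <= u <= 1 -> 10^-1 <= Bfun u.
Proof.
move=> /andP[u0 u1].
have := term_le 0 _ (has_sum_B u0) => /(_ (fun j => proj1 (andP (Bterm_bounds j u0)))).
apply: le_trans; rewrite /weight expr1 /= ler_pdivlMr; lra.
Qed.

Lemma offspring_gen s : 0 <= s <= 1 ->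
  has_sum (fun n => offspring_pmf n * s ^+ n) (s + (1 - s) ^+ 2 * Bfun (1 - s)).
Proof.
move=> s01; have M1 j : 1 <= scale j by have := scale_ge4 j; lra.
case/andP: (s01) => s0 s1.
apply: has_sum_offspring; [by move=> n; rewrite exprn_ge0| |].
  by move=> j; exact: geom_law_gen.
have s1' : 0 <= 1 - s by lra.
have := has_sumD (has_sumZ (c := s) has_sum_weight) (has_sumZ (c := (1 - s) ^+ 2) (has_sum_B s1')).
rewrite mulr1 (_ : (fun j => s * weight j + _) = (fun j => weight j * (s + (1 - s) ^+ 2 / (1 + (1 - s) * scale j)))) //.
apply/funext => j; ring.
Qed.

Lemma offspring_total : has_sum offspring_pmf 1.
Proof.
have h01 : 0 <= (1 : R) <= 1 by rewrite ler01 lexx.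
have := offspring_gen h01; rewrite subrr expr0n mul0r addr0.
by rewrite (_ : (fun n => offspring_pmf n * 1 ^+ n) = offspring_pmf) //; apply/funext => n; rewrite expr1n mulr1.
Qed.

End OffspringLaw.

(** * Laplace transform of the total progeny *)

Section TotalProgeny.
Context {R : realType}.
Implicit Types (x y z u Y s : R) (n k : nat).

Lemma has_sum_finite (a : nat -> R) K : (forall n, (K <= n)%N -> a n = 0) ->
  has_sum a (series a K).
Proof.
move=> aK; rewrite /has_sum -(cvg_shiftn K) /=.
rewrite (_ : (fun n => series a (n + K)%N) = (fun=> series a K)); first exact: cvg_cst.
apply/funext => n; rewrite /series /= addnC (big_cat_nat (n := K)) //= ?leq_addr //.
rewrite [X in _ + X]big_nat_cond [X in _ + X]big1 ?addr0 // => i /andP[/andP[Ki _] _].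
exact: aK.
Qed.

Lemma has_sum_norm_le (a b : nat -> R) l m : has_sum a l -> has_sum b m ->
  (forall n, `|a n| <= b n) -> `|l| <= m.
Proof.
move=> ha hb ab; rewrite ler_norml; apply/andP; split; last first.
  by apply: has_sum_le ha hb _ => n; exact: le_trans (ler_norm _) (ab n).
rewrite lerNl -mulN1r; apply: has_sum_le (has_sumZ (c := -1) ha) hb _ => n.
by rewrite mulN1r; apply: le_trans (ab n); rewrite -normrN ler_norm.
Qed.

Section Forest.
Variables (p : nat -> R) (z Y : R).
Hypothesis p0 : forall n, 0 <= p n.
Hypothesis z01 : 0 <= z <= 1.
Hypothesis Y01 : 0 <= Y <= 1.
Hypothesis psum : has_sum p 1.
Hypothesis Yfix : has_sum (fun d => z * (p d * Y ^+ d)) Y.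

Let G N k := \sum_(n < N.+1) forest_weight p n k * z ^+ n.

Let G0 N : G N 0 = 1.
Proof.
rewrite /G big_ord_recl /= expr0 mulr1 big1 ?addr0 // => i _.
by rewrite mul0r.
Qed.

Let G_gt N k : (N < k)%N -> G N k = 0.
Proof.
move=> Nk; apply: big1 => i _; rewrite forest_weight_gt ?mul0r //.
by apply: leq_ltn_trans Nk; rewrite -ltnS.
Qed.

Let GS N k : G N.+1 k.+1 = series (fun d => z * (p d * G N (d + k))) N.+1.
Proof.
rewrite /G big_ord_recl /= mul0r add0r /series /= big_mkord.
transitivity (\sum_(i < N.+1) \sum_(d < N.+1) z * (p d * (forest_weight p i (d + k) * z ^+ i))).
  apply: eq_bigr => i _; rewrite /bump /= add1n mulr_suml.
  rewrite -(big_mkord xpredT (fun d => p d * forest_weight p i (d + k) * z ^+ i.+1)).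
  rewrite -(big_mkord xpredT (fun d => z * (p d * (forest_weight p i (d + k) * z ^+ i)))).
  rewrite [RHS](big_cat_nat (n := i.+1)) //= [X in _ = _ + X]big_nat_cond.
  rewrite [X in _ = _ + X]big1 ?addr0; last first.
    move=> d /andP[/andP[id _] _]; rewrite forest_weight_gt; last by rewrite ltn_addr.
    by rewrite mul0r !mulr0.
  by apply: eq_bigr => d _; rewrite exprS; ring.
rewrite exchange_big /=; apply: eq_bigr => d _.
by rewrite !mulr_sumr.
Qed.

(** The truncated generating function [G N k] of the size of [k] trees and its
    limit [Y ^+ k] satisfy the same recursion over the first node; the error is
    averaged over the offspring and multiplied by [z] at each step. *)
Lemma forest_gen_bounds N k : 0 <= Y ^+ k - G N k <= z ^+ N.+1.
Proof.
case/andP: (z01) => z0 z1; case/andP: (Y01) => Y0 Y1.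
elim: N k => [|N IH] k.
  case: k => [|k]; first by rewrite G0 expr0 subrr lexx exprn_ge0.
  rewrite G_gt // subr0 exprn_ge0 //= expr1.
  apply: (@le_trans _ _ Y); first by rewrite exprS ler_piMr // exprn_ile1.
  rewrite -[X in _ <= X]mulr1; apply: has_sum_le Yfix (has_sumZ (c := z) psum) _.
  by move=> d; rewrite ler_wpM2l // ler_piMr // exprn_ile1.
case: k => [|k]; first by rewrite G0 expr0 subrr lexx exprn_ge0.
have hG : has_sum (fun d => z * (p d * G N (d + k))) (G N.+1 k.+1).
  rewrite GS; apply: has_sum_finite => d Nd; rewrite G_gt ?mulr0 //.
  by rewrite ltn_addr.
have hY := has_sumZ (c := Y ^+ k) Yfix.
have hD := has_sumB hY hG.
have e : Y ^+ k * Y = Y ^+ k.+1 by rewrite exprSr.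
rewrite e in hD; apply/andP; split.
  apply: has_sum_ge0 hD => d.
  have -> : Y ^+ k * (z * (p d * Y ^+ d)) - z * (p d * G N (d + k)) =
     z * (p d * (Y ^+ (d + k) - G N (d + k))) by rewrite exprD; ring.
  by rewrite mulr_ge0 // mulr_ge0 //; case/andP: (IH (d + k)%N).
rewrite -[X in _ <= X]mulr1 [X in _ <= X * _]exprS.
apply: has_sum_le hD (has_sumZ (c := z * z ^+ N.+1) psum) _ => d.
have -> : Y ^+ k * (z * (p d * Y ^+ d)) - z * (p d * G N (d + k)) =
   z * (p d * (Y ^+ (d + k) - G N (d + k))) by rewrite exprD; ring.
rewrite -mulrA ler_wpM2l // mulrC ler_wpM2r //; by case/andP: (IH (d + k)%N).
Qed.

End Forest.

Definition progeny n : R := forest_weight (@offspring_pmf R) n 1.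

Definition offspring_pgf s : R := s + (1 - s) ^+ 2 * Bfun (1 - s).

Lemma forest_weight_ge0 n k : 0 <= forest_weight (@offspring_pmf R) n k.
Proof.
elim: n k => [|n IH] [|k] //=; rewrite ?ler01 //.
by apply: sumr_ge0 => d _; rewrite mulr_ge0 // offspring_pmf_ge0.
Qed.

Lemma progeny_ge0 n : 0 <= progeny n.
Proof. exact: forest_weight_ge0. Qed.

Lemma pow_lip n s s' : 0 <= s <= 1 -> 0 <= s' <= 1 ->
  `|s ^+ n - s' ^+ n| <= n%:R * `|s - s'|.
Proof.
move=> /andP[s0 s1] /andP[t0 t1]; elim: n => [|n IH]; first by rewrite !expr0 subrr normr0 mul0r.
have -> : s ^+ n.+1 - s' ^+ n.+1 = s * (s ^+ n - s' ^+ n) + (s - s') * s' ^+ n.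
  by rewrite !exprS; ring.
apply: le_trans (ler_normD _ _) _.
rewrite -natr1 [X in _ <= X]mulrDl mul1r; apply: lerD.
  rewrite normrM ger0_norm //; apply: le_trans IH; by rewrite ler_piMl.
by rewrite normrM ler_piMr // ger0_norm ?exprn_ge0 // exprn_ile1.
Qed.

(** The Lipschitz constant is the mean of the offspring law. *)
Lemma offspring_pgf_lip s s' : 0 <= s <= 1 -> 0 <= s' <= 1 -> `|offspring_pgf s - offspring_pgf s'| <= `|s - s'|.
Proof.
move=> hs hs'.
have hD := has_sumB (offspring_gen hs) (offspring_gen hs').
have hm := has_sumZ (c := `|s - s'|) (@offspring_mean R).
have b n : `|offspring_pmf n * s ^+ n - offspring_pmf n * s' ^+ n| <= `|s - s'| * (offspring_pmf n * n%:R).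
  rewrite -mulrBr normrM (ger0_norm (offspring_pmf_ge0 n)) mulrCA ler_wpM2l ?offspring_pmf_ge0 //.
  by rewrite mulrC pow_lip.
by rewrite -[X in _ <= X]mulr1; exact: has_sum_norm_le hD hm b.
Qed.

Lemma offspring_pgf_le1 s : 0 <= s <= 1 -> offspring_pgf s <= 1.
Proof.
move=> hs; apply: has_sum_le (offspring_gen hs) (@offspring_total R) _ => n.
by case/andP: hs => s0 s1; rewrite ler_piMr ?offspring_pmf_ge0 // exprn_ile1.
Qed.

Lemma offspring_pgf_ge s : 0 <= s <= 1 -> offspring_pmf 0 <= offspring_pgf s.
Proof.
move=> hs; case/andP: (hs) => s0 s1; have h := offspring_gen hs.
rewrite -[X in X <= _]mulr1 -(expr0 s); apply: (term_le 0 _ h) => n.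
by rewrite mulr_ge0 ?offspring_pmf_ge0 // exprn_ge0.
Qed.

Lemma lip_continuous (f : R -> R) (C : R) : (forall x y, `|f x - f y| <= C * `|x - y|) ->
  continuous f.
Proof.
move=> hf x; apply/cvgrPdist_le => e e0.
have C0 : 0 <= C.
  by have := hf 1 0; rewrite subr0 normr1 mulr1 => h; exact: le_trans (normr_ge0 _) h.
have C1 : 0 < C + 1 by lra.
have d0 := divr_gt0 e0 C1.
near=> t; apply: (le_trans (hf x t)).
apply: (@le_trans _ _ ((C + 1) * `|x - t|)); first by rewrite ler_wpM2r // lerDl.
rewrite mulrC -ler_pdivlMr //; near: t.
Unshelve. all: by end_near.
Qed.

(** Extends the generating function continuously from [[0, 1]] to the line,
    where the intermediate value theorem is applied. *)
Definition clamp s : R := Num.max 0 (Num.min s 1).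

Lemma clamp01 s : 0 <= clamp s <= 1.
Proof. by rewrite /clamp le_max lexx /= ge_max ler01 /= ge_min lexx orbT. Qed.

Lemma clampE s : 0 <= s <= 1 -> clamp s = s.
Proof. by move=> /andP[s0 s1]; rewrite /clamp min_l // max_r. Qed.

Lemma clamp_lip s s' : `|clamp s - clamp s'| <= `|s - s'|.
Proof.
wlog ss : s s' / s' <= s => [h|].
  by have /orP[/h //|/h] := le_total s' s; rewrite distrC [`|s' - s|]distrC.
rewrite [X in _ <= X]ger0_norm ?subr_ge0 // /clamp.
have l01 := @ler01 R.
case: (leP s 1) => h1; case: (leP s' 1) => h2; rewrite ?(max_r l01);
  try case: (leP 0 s) => h3; try case: (leP 0 s') => h4; rewrite ger0_norm; lra.
Qed.

(** Intermediate value theorem for [s - z * offspring_pgf s] between 0 and 1.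
    *)
Lemma fixpoint_exists z : 0 < z < 1 -> exists Y, [/\ 0 < Y, Y < 1 & Y = z * offspring_pgf Y].
Proof.
move=> /andP[z0 z1].
pose f s := s - z * offspring_pgf (clamp s).
have cf : continuous f.
  apply: (@lip_continuous _ 2) => x y; rewrite /f.
  have -> : x - z * offspring_pgf (clamp x) - (y - z * offspring_pgf (clamp y)) =
    (x - y) - z * (offspring_pgf (clamp x) - offspring_pgf (clamp y)) by ring.
  rewrite (le_trans (ler_normB _ _)) // mulrDl mul1r lerD2l normrM (ger0_norm (ltW z0)).
  apply: (@le_trans _ _ `|offspring_pgf (clamp x) - offspring_pgf (clamp y)|).
    by rewrite ler_piMl // ltW.
  by apply: le_trans (offspring_pgf_lip (clamp01 _) (clamp01 _)) (clamp_lip _ _).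
have b0 : 0 <= (0 : R) <= 1 by rewrite lexx ler01.
have b1 : 0 <= (1 : R) <= 1 by rewrite lexx ler01.
have f0 : f 0 < 0.
  rewrite /f clampE // sub0r oppr_lt0 mulr_gt0 //.
  by apply: lt_le_trans (offspring_pgf_ge b0); exact: offspring_pmf0_gt0.
have f1 : 0 < f 1.
  rewrite /f clampE // subr_gt0; apply: le_lt_trans z1.
  by rewrite ler_piMr ?(ltW z0) // offspring_pgf_le1.
have [||Y] := @IVT R f 0 1 0 ler01.
- exact: continuous_subspaceT.
- by rewrite min_l ?max_r ?(ltW f0) ?(ltW f1) // (le_trans (ltW f0) (ltW f1)).
rewrite in_itv /= => Y01 /eqP; rewrite /f clampE // subr_eq0 => /eqP e.
exists Y; split=> //.
  rewrite e mulr_gt0 //; apply: lt_le_trans (offspring_pgf_ge Y01); exact: offspring_pmf0_gt0.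
by rewrite e; apply: le_lt_trans z1; rewrite ler_piMr ?(ltW z0) // offspring_pgf_le1.
Qed.

(** The generating function of the total progeny is the fixed point: the
    truncation error of [forest_gen_bounds] tends to 0. *)
Lemma progeny_gen z Y : 0 <= z < 1 -> 0 <= Y <= 1 -> Y = z * offspring_pgf Y ->
  has_sum (fun n => progeny n * z ^+ n) Y.
Proof.
move=> /andP[z0 z1] hY e.
have z01 : 0 <= z <= 1 by rewrite z0 ltW.
have hfix := has_sumZ (c := z) (offspring_gen hY).
rewrite -/(offspring_pgf Y) -e in hfix.
have h N := forest_gen_bounds (@offspring_pmf_ge0 R) z01 hY (@offspring_total R) hfix N 1.
rewrite /has_sum -cvg_shiftS.
have hz : (fun N : nat => z ^+ N.+1) @ \oo --> (0 : R).
  rewrite (cvg_shiftS (fun N : nat => z ^+ N)); apply: cvg_expr.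
  by rewrite ger0_norm.
have : (fun N => Y - series (fun n => progeny n * z ^+ n) N.+1) @ \oo --> (0 : R).
  apply: (squeeze_cvgr _ (cvg_cst 0) hz); apply: nearW => N.
  by have := h N; rewrite expr1 /series /= big_mkord.
move=> h0; pose S N := series (fun n => progeny n * z ^+ n) N.+1.
have h1 : (fun N => Y - (Y - S N)) @ \oo --> Y.
  by rewrite -[X in _ --> X]subr0; apply: cvgB => //; exact: cvg_cst.
have e1 : (fun N => Y - (Y - S N)) = S.
  by apply/funext => N; rewrite opprB addrC subrK.
by rewrite e1 in h1.
Qed.

(** One minus the Laplace transform of the total progeny. *)
Definition tail x : R := 1 - limn (series (fun n => progeny n * expR (- (n%:R * x)))).

(** The fixed point equation at [z = expR (- x)], written in terms of [1 - Y].
    *)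
Lemma tail_eq x : 0 < x ->
  [/\ has_sum (fun n => progeny n * expR (- (n%:R * x))) (1 - tail x),
     0 < tail x, tail x < 1 & tail x ^+ 2 * Bfun (tail x) = (1 - tail x) * (expR x - 1)].
Proof.
move=> x0; pose z := expR (- x).
have z01 : 0 < z < 1 by rewrite expR_gt0 expR_lt1 oppr_lt0.
have [Y [Y0 Y1 e]] := fixpoint_exists z01.
have z01' : 0 <= z < 1 by case/andP: z01 => /ltW -> ->.
have Y01 : 0 <= Y <= 1 by rewrite !ltW.
have h := progeny_gen z01' Y01 e.
have eq1 : (fun n => progeny n * z ^+ n) = (fun n => progeny n * expR (- (n%:R * x))).
  by apply/funext => n; rewrite /z -expRM_natl mulrN.
rewrite eq1 in h.
have tE : tail x = 1 - Y by rewrite /tail; congr (_ - _); apply/cvg_lim.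
rewrite tE opprB addrC subrK; split => //; [lra|lra|].
have hz : z * expR x = 1 by rewrite /z -expRD addNr expR0.
have : Y * expR x = offspring_pgf Y by rewrite {1}e mulrAC hz mul1r.
rewrite /offspring_pgf => h2; have : (1 - Y) ^+ 2 * Bfun (1 - Y) = Y * expR x - Y by rewrite h2; ring.
by move=> ->; ring.
Qed.

Lemma tail_gt0 x : 0 < x -> 0 < tail x. Proof. by case/tail_eq. Qed.
Lemma tail_lt1 x : 0 < x -> tail x < 1. Proof. by case/tail_eq. Qed.

Lemma expRB1_le x : 0 <= x <= 2^-1 -> expR x - 1 <= x + 2 * x ^+ 2.
Proof.
move=> /andP[x0 x1]; have h := expR_ge1Dx (- x).
have h2 : expR x * expR (- x) = 1 by rewrite -expRD subrr expR0.
have h3 : expR x * (1 + - x) <= 1.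
  by rewrite -[X in _ <= X]h2 ler_wpM2l // expR_ge0.
have h4 : expR x <= (1 - x)^-1 by rewrite -[(1 - x)^-1]mul1r ler_pdivlMr; lra.
have h5 : (1 - x)^-1 <= 1 + x + 2 * x ^+ 2.
  rewrite -[(1 - x)^-1]mul1r ler_pdivrMr; last lra.
  have : 0 <= x ^+ 2 * (1 - 2 * x) by rewrite mulr_ge0 ?sqr_ge0; lra.
  have -> : (1 + x + 2 * x ^+ 2) * (1 - x) = 1 + x ^+ 2 * (1 - 2 * x) by ring.
  lra.
lra.
Qed.

(** The functional equation and [Bfun >= 1 / 10] give [tail x ^+ 2 <= 25 * x];
    the case of large [x] is trivial as [tail x < 1]. *)
Lemma tail_upper y : 0 < y -> tail (y ^+ 2) <= 5 * y.
Proof.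
move=> y0; have x0 : 0 < y ^+ 2 by rewrite exprn_gt0.
have [_ u0 u1 e] := tail_eq x0; set u := tail _ in u0 u1 e *.
have [yh|yh] := leP (y ^+ 2) (2^-1); last first.
  have : 2^-1 < y.
    rewrite ltNge; apply/negP => h.
    have : y ^+ 2 <= 2^-1 * 2^-1 by rewrite expr2 ler_pM // ltW.
    lra.
  lra.
have hB : 10^-1 <= Bfun u by apply: Bfun_ge; rewrite !ltW.
have hx := expRB1_le (_ : 0 <= y ^+ 2 <= 2^-1); rewrite ltW // yh in hx.
have {}hx := hx isT.
have : u ^+ 2 <= 25 * y ^+ 2.
  have h1 : u ^+ 2 * 10^-1 <= u ^+ 2 * Bfun u by rewrite ler_wpM2l // sqr_ge0.
  have h2 : (1 - u) * (expR (y ^+ 2) - 1) <= 2 * y ^+ 2.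
    apply: (@le_trans _ _ (expR (y ^+ 2) - 1)).
      rewrite ler_piMl //; last lra.
      by rewrite subr_ge0 -expR0 ler_expR ltW.
    have : y ^+ 2 * y ^+ 2 <= y ^+ 2 * 2^-1 by rewrite ler_wpM2l // ltW.
    rewrite -expr2 in hx *; lra.
  lra.
have -> : 25 * y ^+ 2 = (5 * y) ^+ 2 by ring.
by rewrite ler_pXn2r // nnegrE ltW // mulr_gt0.
Qed.

(** The functional equation and [Bfun <= 1]. *)
Lemma tail_lower y : 0 < y <= 1 -> y / 2 <= tail (y ^+ 2).
Proof.
move=> /andP[y0 y1]; have x0 : 0 < y ^+ 2 by rewrite exprn_gt0.
have [_ u0 u1 e] := tail_eq x0; set u := tail _ in u0 u1 e *.
have [uh|uh] := leP u (2^-1); last by lra.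
have hB := Bfun_le1 (ltW u0).
have hx := expR_ge1Dx (y ^+ 2).
have h1 : u ^+ 2 * Bfun u <= u ^+ 2 by rewrite ler_piMr // sqr_ge0.
have h2 : 2^-1 * y ^+ 2 <= (1 - u) * (expR (y ^+ 2) - 1).
  by rewrite ler_pM //; lra.
have : (y / 2) ^+ 2 <= u ^+ 2.
  have -> : (y / 2) ^+ 2 = 4^-1 * y ^+ 2 by field.
  lra.
by rewrite ler_pXn2r // nnegrE ltW // divr_gt0.
Qed.

Lemma progeny_psum_le1 N : series progeny N <= 1.
Proof.
case: N => [|N]; first by rewrite /series /= big_geq.
have b1 : 0 <= (1 : R) <= 1 by rewrite lexx ler01.
have hfix := has_sumZ (c := 1) (offspring_gen b1).
rewrite subrr expr0n mul0r addr0 mul1r in hfix.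
have := forest_gen_bounds (@offspring_pmf_ge0 R) b1 b1 (@offspring_total R) hfix N 1.
rewrite expr1 subr_ge0 => /andP[+ _]; apply: le_trans.
rewrite /series /= big_mkord le_eqVlt; apply/orP; left; apply/eqP.
by apply: eq_bigr => i _; rewrite expr1n mulr1.
Qed.

(** The tree is almost surely finite: let [x] tend to 0 in the Laplace
    transform and use [tail_upper]. *)
Lemma progeny_total : has_sum progeny 1.
Proof.
have [Q hQ Q1] := bounded_has_sum progeny_ge0 progeny_psum_le1.
suff h : 1 <= Q by have -> : 1 = Q by apply/eqP; rewrite eq_le h Q1.
apply/ler_addgt0Pr => e e0.
(* then [tail (y ^+ 2) <= e] by [tail_upper] *)
pose y := e / 5; have y0 : 0 < y by rewrite divr_gt0.
have x0 : 0 < y ^+ 2 by rewrite exprn_gt0.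
have [hs _ _ _] := tail_eq x0.
have : 1 - tail (y ^+ 2) <= Q.
  apply: has_sum_le hs hQ _ => n; rewrite ler_piMr ?progeny_ge0 //.
  by rewrite -expR0 ler_expR oppr_le0 mulr_ge0 // ltW.
by have := tail_upper y0; rewrite /y; lra.
Qed.

Lemma tail_sum x : 0 < x -> has_sum (fun n => progeny n * (1 - expR (- (n%:R * x)))) (tail x).
Proof.
move=> /tail_eq [h _ _ _]; have := has_sumB progeny_total h.
rewrite opprB addrC subrK.
by rewrite (_ : (fun n => progeny n - _) = (fun n => progeny n * (1 - expR (- (n%:R * x))))) //; apply/funext => n; ring.
Qed.

Lemma tail_mono x x' : 0 < x -> x <= x' -> tail x <= tail x'.
Proof.
move=> x0 xx; have x0' : 0 < x' by exact: lt_le_trans xx.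
apply: has_sum_le (tail_sum x0) (tail_sum x0') _ => n.
rewrite ler_wpM2l ?progeny_ge0 // lerD2l lerN2 ler_expR lerN2.
by rewrite ler_wpM2l.
Qed.

End TotalProgeny.

(** * The Laplace transform near zero *)

Section TailAsymptotics.
Context {R : realType}.
Implicit Types (y : nat -> R) (u : R).

Lemma psum_weight J : series (@weight R) J = 1 - 2^-1 ^+ J.
Proof.
rewrite /series /=; elim: J => [|J IH]; first by rewrite big_geq // expr0 subrr.
by rewrite big_nat_recr //= IH /weight !exprS; field.
Qed.

(** The first [J] levels have total weight [1 - 2^-1 ^+ J], and each of them
    loses at most the proportion [u * scale J]. *)
Lemma Bfun_ge_1B u J : 0 <= u -> 1 - u * scale J - 2^-1 ^+ J <= Bfun u.
Proof.
move=> u0.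
have h := psum_le J (fun j => proj1 (andP (Bterm_bounds j u0))) (has_sum_B u0).
apply: le_trans h; apply: (@le_trans _ _ ((1 - u * scale J) * series (@weight R) J)).
  rewrite psum_weight; have : 0 <= u * scale J * 2^-1 ^+ J.
    by rewrite !mulr_ge0 ?exprn_ge0 ?invr_ge0 // ltW // scale_gt0.
  have -> : (1 - u * scale J) * (1 - 2^-1 ^+ J) = 1 - u * scale J - 2^-1 ^+ J +
    u * scale J * 2^-1 ^+ J by ring.
  lra.
rewrite /series /= mulr_sumr !big_mkord; apply: ler_sum => j _.
rewrite mulrC ler_wpM2l ?weight_ge0 //.
have h1 := Bden_gt0 j u0.
rewrite -[(1 + _)^-1]mul1r ler_pdivlMr //.
have h2 : u * scale j <= u * scale J by rewrite ler_wpM2l // scale_mono // ltnW.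
have h3 : 0 <= u * scale j by rewrite mulr_ge0 // ltW // scale_gt0.
have h4 : 0 <= u * scale J * (u * scale j) by rewrite mulr_ge0 //; lra.
have -> : (1 - u * scale J) * (1 + u * scale j) = 1 - u * scale J + u * scale j -
  u * scale J * (u * scale j) by ring.
lra.
Qed.

Lemma Bfun_cvg1 (u : nat -> R) : (forall k, 0 <= u k) -> u @ \oo --> (0 : R) ->
  (fun k => Bfun (u k)) @ \oo --> (1 : R).
Proof.
move=> u0 hu; apply/cvgrPdist_le => e e0.
have hJ : (fun J : nat => 2^-1 ^+ J) @ \oo --> (0 : R).
  by apply: cvg_expr; rewrite ger0_norm ?invr_ge0 // invf_lt1 // ltr1n.
have e2 : 0 < e / 2 by rewrite divr_gt0.
have [J _ /(_ J (leqnn J)) /= HJ] := @cvgr_dist_le _ _ _ _ _ _ _ hJ _ e2.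
have sJ := @scale_gt0 R J.
have d0 : 0 < e / 2 / scale J by rewrite divr_gt0.
near=> k.
rewrite ger0_norm ?subr_ge0 ?Bfun_le1 //.
have h := Bfun_ge_1B J (u0 k).
have h1 : 2^-1 ^+ J <= e / 2.
  by move: HJ; rewrite sub0r normrN ger0_norm // exprn_ge0.
have h2 : u k * scale J <= e / 2.
  rewrite -ler_pdivlMr //.
  have : `|0 - u k| <= e / 2 / scale J by near: k; exact: (@cvgr_dist_le _ _ _ _ _ _ _ hu _ d0).
  by rewrite sub0r normrN ger0_norm.
lra.
Unshelve. all: by end_near.
Qed.

Lemma tail_cvg0 y : (forall k, 0 < y k) -> y @ \oo --> (0 : R) ->
  (fun k => tail (y k ^+ 2)) @ \oo --> (0 : R).
Proof.
move=> y0 hy.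
have h5 : (fun k => 5 * y k) @ \oo --> (0 : R).
  by rewrite -[X in _ --> X](mulr0 5); exact: cvgMr.
apply: (squeeze_cvgr _ (cvg_cst 0) h5); apply: nearW => k.
by rewrite tail_upper // ltW // tail_gt0 // exprn_gt0.
Qed.

(** The functional equation becomes [u ^+ 2 = x] in the limit, because both
    [Bfun u] and [(expR x - 1) / x] tend to 1; the square root is then taken by
    [|v - 1| <= |v ^+ 2 - 1|] for [v > 0]. *)
Lemma tail_equiv y : (forall k, 0 < y k) -> y @ \oo --> (0 : R) ->
  (fun k => tail (y k ^+ 2) / y k) @ \oo --> (1 : R).
Proof.
move=> y0 hy; have hu := tail_cvg0 y0 hy.
have u0 k : 0 < tail (y k ^+ 2) by rewrite tail_gt0 // exprn_gt0.
have hB := Bfun_cvg1 (fun k => ltW (u0 k)) hu.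
pose r k := (1 - tail (y k ^+ 2)) * ((expR (y k ^+ 2) - 1) / y k ^+ 2) / Bfun (tail (y k ^+ 2)).
have hq : (fun k => (expR (y k ^+ 2) - 1) / y k ^+ 2) @ \oo --> (1 : R).
  have hy2 : (fun k => y k ^+ 2) @ \oo --> (0 : R).
    by rewrite -[X in _ --> X](mulr0 0); under eq_fun do rewrite expr2; exact: cvgM.
  have h2 : (fun k => 1 + 2 * y k ^+ 2) @ \oo --> (1 : R).
    rewrite -[X in _ --> X]addr0; apply: cvgD; first exact: cvg_cst.
    by rewrite -[X in _ --> X](mulr0 2); exact: cvgMr.
  apply: (squeeze_cvgr _ (cvg_cst (1 : R)) h2).
  have half0 : 0 < (2^-1 : R) by rewrite invr_gt0.
  near=> k.
  have x0 : 0 < y k ^+ 2 by rewrite exprn_gt0.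
  have x1 : y k ^+ 2 <= 2^-1.
    have : `|0 - y k ^+ 2| <= 2^-1 by near: k; exact: (@cvgr_dist_le _ _ _ _ _ _ _ hy2 _ half0).
    by rewrite sub0r normrN ger0_norm // ltW.
  have hx : 0 <= y k ^+ 2 <= 2^-1 by rewrite ltW.
  have h3 := expRB1_le hx; have h4 := expR_ge1Dx (y k ^+ 2).
  rewrite ler_pdivlMr // ler_pdivrMr // mul1r.
  have -> : (1 + 2 * y k ^+ 2) * y k ^+ 2 = y k ^+ 2 + 2 * (y k ^+ 2) ^+ 2 by ring.
  apply/andP; split; lra.
have hr : r @ \oo --> (1 : R).
  have -> : (1 : R) = (1 - 0) * 1 / 1 by field.
  apply: cvgM; last by apply: cvgV => //; exact: oner_neq0.
  by apply: cvgM => //; apply: cvgB => //; exact: cvg_cst.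
have rE k : r k = (tail (y k ^+ 2) / y k) ^+ 2.
  have x0 : 0 < y k ^+ 2 by rewrite exprn_gt0.
  have [_ _ u1 e] := tail_eq x0.
  have B0 : 0 < Bfun (tail (y k ^+ 2)).
    apply: (@lt_le_trans _ _ 10^-1); first by rewrite invr_gt0.
    by apply: Bfun_ge; rewrite !ltW.
  rewrite /r mulrA -e; field.
  by rewrite !gt_eqF.
have hd : (fun k => `|r k - 1|) @ \oo --> (0 : R).
  apply/norm_cvg0P; rewrite -[X in _ --> X](subrr 1).
  by apply: cvgB => //; exact: cvg_cst.
have hd2 : (fun k => tail (y k ^+ 2) / y k - 1) @ \oo --> (0 : R).
  apply/norm_cvg0P; apply: (squeeze_cvgr _ (cvg_cst 0) hd); apply: nearW => k.
  rewrite normr_ge0 /= rE.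
  set v := tail _ / y k; have v0 : 0 < v by rewrite divr_gt0.
  have -> : v ^+ 2 - 1 = (v - 1) * (v + 1) by ring.
  by rewrite normrM ler_peMr // ger0_norm; lra.
have h1 : (fun k => (tail (y k ^+ 2) / y k - 1) + 1) @ \oo --> (1 : R).
  by rewrite -[X in _ --> X]add0r; apply: cvgD => //; exact: cvg_cst.
suff e : (fun k => (tail (y k ^+ 2) / y k - 1) + 1) = (fun k => tail (y k ^+ 2) / y k) by rewrite e in h1.
by apply/funext => k; rewrite subrK.
Unshelve. all: by end_near.
Qed.

End TailAsymptotics.

(** * Complex numbers and complex series *)

Local Open Scope complex_scope.
Local Open Scope ring_scope.

Section ComplexBasics.
Context {R : realType}.
Local Notation Re := complex.Re.
Local Notation Im := complex.Im.
Local Notation normc := (@Normc.normc R).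
Implicit Types (z w : CC R) (f : nat -> CC R).

Lemma ReCD z w : Re (z + w) = Re z + Re w. Proof. by case: z; case: w. Qed.
Lemma ImCD z w : Im (z + w) = Im z + Im w. Proof. by case: z; case: w. Qed.
Lemma ReCN z : Re (- z) = - Re z. Proof. by case: z. Qed.
Lemma ImCN z : Im (- z) = - Im z. Proof. by case: z. Qed.
Lemma ReCM z w : Re (z * w) = Re z * Re w - Im z * Im w.
Proof. by case: z; case: w. Qed.
Lemma ImCM z w : Im (z * w) = Re z * Im w + Im z * Re w.
Proof. by case: z; case: w. Qed.

Lemma complex_eq z w : Re z = Re w -> Im z = Im w -> z = w.
Proof. by case: z; case: w => a b c d /= -> ->. Qed.

Lemma normc_sqrt z : normc z = Num.sqrt (Re z ^+ 2 + Im z ^+ 2).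
Proof. by case: z. Qed.

Lemma normc_ge0 z : 0 <= normc z. Proof. by rewrite normc_sqrt sqrtr_ge0. Qed.

Lemma normcD z w : normc (z + w) <= normc z + normc w.
Proof. exact: le_normcD. Qed.

Lemma normcM z w : normc (z * w) = normc z * normc w.
Proof. exact: Normc.normcM. Qed.

Lemma normcN z : normc (- z) = normc z. Proof. exact: normcN. Qed.

Lemma normcX z n : normc (z ^+ n) = normc z ^+ n.
Proof.
elim: n => [|n IH]; first by rewrite !expr0 Normc.normc1.
by rewrite !exprS normcM IH.
Qed.

Lemma normcB z w : normc (z - w) = normc (w - z).
Proof. by rewrite -normcN opprB. Qed.

Lemma normc_real (x : R) : normc x%:C = `|x|.
Proof. by rewrite normc_sqrt /= expr0n /= addr0 sqrtr_sqr. Qed.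

Lemma Re_le_normc z : `|Re z| <= normc z.
Proof. by rewrite normc_sqrt -sqrtr_sqr ler_wsqrtr // lerDl sqr_ge0. Qed.

Lemma Im_le_normc z : `|Im z| <= normc z.
Proof. by rewrite normc_sqrt -sqrtr_sqr ler_wsqrtr // lerDr sqr_ge0. Qed.

Lemma normc_le_ReIm z : normc z <= `|Re z| + `|Im z|.
Proof.
rewrite normc_sqrt -[X in _ <= X]ger0_norm ?addr_ge0 // -sqrtr_sqr ler_wsqrtr //.
rewrite sqrrD !real_normK ?num_real // -addrA lerD2l lerDr.
by rewrite mulrn_wge0 // mulr_ge0.
Qed.

Lemma normcE_norm z : `|z| = (normc z)%:C. Proof. by []. Qed.

Lemma normc_eq0 z : normc z = 0 -> z = 0.
Proof. exact: Normc.eq0_normc. Qed.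

Lemma ler_normc_sum (I : Type) (r : seq I) (P : pred I) (F : I -> CC R) :
  normc (\sum_(i <- r | P i) F i) <= \sum_(i <- r | P i) normc (F i).
Proof.
elim/big_ind2 : _ => //; first by rewrite Normc.normc0.
by move=> x1 x2 y1 y2 h1 h2; apply: le_trans (normcD _ _) _; exact: lerD.
Qed.

(** Reduces limits in the complex numbers to limits of real norms. *)
Lemma ccvgP f (l : CC R) : f @ \oo --> l <-> (fun n => normc (f n - l)) @ \oo --> (0 : R).
Proof.
split=> h.
  apply/cvgrPdist_lt => e e0.
  have e0' : 0 < e%:C :> CC R by rewrite ltcR.
  near=> n; rewrite sub0r normrN ger0_norm ?normc_ge0 // normcB.
  rewrite -ltcR -normcE_norm; near: n.
  exact: (@cvgr_dist_lt _ _ _ _ _ _ _ h _ e0').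
apply/cvgrPdist_lt => e; rewrite ltcE /= => /andP[/eqP ei er].
have eE : e = (Re e)%:C by apply: complex_eq.
near=> n; rewrite normcE_norm eE ltcR normcB.
have : `|0 - normc (f n - l)| < Re e.
  by near: n; exact: (@cvgr_dist_lt _ _ _ _ _ _ _ h _ er).
by rewrite sub0r normrN ger0_norm ?normc_ge0.
Unshelve. all: by end_near.
Qed.

Lemma ccvg_ReIm f (l : CC R) : (fun n => Re (f n)) @ \oo --> Re l ->
  (fun n => Im (f n)) @ \oo --> Im l -> f @ \oo --> l.
Proof.
move=> hr hi; apply/ccvgP.
have h : (fun n => `|Re (f n) - Re l| + `|Im (f n) - Im l|) @ \oo --> (0 : R).
  rewrite -[X in _ --> X](addr0 0); apply: cvgD.
    apply/norm_cvg0P; rewrite -[X in _ --> X](subrr (Re l)).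
    by apply: cvgB => //; exact: cvg_cst.
  apply/norm_cvg0P; rewrite -[X in _ --> X](subrr (Im l)).
  by apply: cvgB => //; exact: cvg_cst.
apply: (squeeze_cvgr _ (cvg_cst (0 : R)) h); apply: nearW => n.
by rewrite normc_ge0 /= -!ReCN -!ImCN -ReCD -ImCD normc_le_ReIm.
Qed.

Lemma ccvg_normc_le f (l : CC R) (b : R) : f @ \oo --> l ->
  (\forall n \near \oo, normc (f n) <= b) -> normc l <= b.
Proof.
move=> /ccvgP h hb; apply/ler_addgt0Pr => e e0.
near \oo => n.
have h3 : normc (f n) <= b by near: n.
have h4 : normc (f n - l) <= e.
  apply: ltW; have : `|0 - normc (f n - l)| < e.
    by near: n; exact: (@cvgr_dist_lt _ _ _ _ _ _ _ h _ e0).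
  by rewrite sub0r normrN ger0_norm ?normc_ge0.
have -> : l = f n - (f n - l) by rewrite opprB addrC subrK.
by apply: le_trans (normcD _ _) _; rewrite normcN lerD.
Unshelve. all: by end_near.
Qed.

Definition csum f (l : CC R) := (fun N => \sum_(0 <= n < N) f n) @ \oo --> l.

Lemma csumD f g (l m : CC R) : csum f l -> csum g m -> csum (fun n => f n + g n) (l + m).
Proof.
move=> hf hg; rewrite /csum.
have -> : (fun N => \sum_(0 <= n < N) (f n + g n)) =
  (fun N => \sum_(0 <= n < N) f n + \sum_(0 <= n < N) g n).
  by apply/funext => N; rewrite big_split.
exact: (cvgD hf hg).
Qed.

Lemma csumZ (c : CC R) f (l : CC R) : csum f l -> csum (fun n => c * f n) (c * l).
Proof.
move=> /ccvgP hf; apply/ccvgP.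
have h : (fun N => normc c * normc (\sum_(0 <= n < N) f n - l)) @ \oo --> (0 : R).
  by rewrite -[X in _ --> X](mulr0 (normc c)); exact: cvgMr.
apply: cvg_trans h; apply: near_eq_cvg; apply: nearW => N.
by rewrite -normcM mulrBr mulr_sumr.
Qed.

Lemma csum_unique f (l m : CC R) : csum f l -> csum f m -> l = m.
Proof. by move=> h1 h2; exact: (cvg_unique _ h1 h2). Qed.

Lemma csum_norm_le f (l : CC R) (b : nat -> R) (m : R) : csum f l -> has_sum b m ->
  (forall n, normc (f n) <= b n) -> normc l <= m.
Proof.
move=> hf hb fb; apply: (ccvg_normc_le hf); apply: nearW => N.
apply: le_trans (ler_normc_sum _ _ _) _.
have b0 n : 0 <= b n by apply: le_trans (fb n); exact: normc_ge0.
apply: le_trans (psum_le N b0 hb); rewrite /series /=.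
exact: ler_sum.
Qed.

(** Absolute convergence, applied to real and imaginary parts. *)
Lemma csum_exists f (b : nat -> R) (m : R) : has_sum b m ->
  (forall n, normc (f n) <= b n) -> exists l, csum f l.
Proof.
move=> hb fb.
have H (g : nat -> R) : (forall n, `|g n| <= b n) -> exists l, has_sum g l.
  move=> gb; suff /cvg_ex[l hl] : cvgn (series g) by exists l.
  apply: normed_cvg.
  have [l hl _] : exists2 l, has_sum (fun n => `|g n|) l & l <= m.
    by apply: (dominated_has_sum _ hb) => n; rewrite normr_ge0 gb.
  by apply/cvg_ex; exists l.
have [lr hr] := H (fun n => Re (f n)) (fun n => le_trans (Re_le_normc _) (fb n)).
have [li hi] := H (fun n => Im (f n)) (fun n => le_trans (Im_le_normc _) (fb n)).
exists (Complex lr li); apply: ccvg_ReIm => /=.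
  rewrite (_ : (fun n => Re _) = series (fun n => Re (f n))) //.
  by apply/funext => N; rewrite /series /=; elim/big_ind2 : _ => // x1 x2 y1 y2 <- <-; rewrite ReCD.
rewrite (_ : (fun n => Im _) = series (fun n => Im (f n))) //.
by apply/funext => N; rewrite /series /=; elim/big_ind2 : _ => // x1 x2 y1 y2 <- <-; rewrite ImCD.
Qed.

End ComplexBasics.

(** * Taylor expansion of the complex exponential *)

Section ComplexExp.
Context {R : realType}.
Local Notation Re := complex.Re.
Local Notation Im := complex.Im.
Local Notation normc := (@Normc.normc R).
Implicit Types (z w v : CC R).

Lemma Re_Cexp z : Re (Cexp z) = expR (Re z) * cos (Im z).
Proof. by rewrite /Cexp /= !mul0r subr0. Qed.

Lemma Im_Cexp z : Im (Cexp z) = expR (Re z) * sin (Im z).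
Proof. by rewrite /Cexp /= mul0r addr0. Qed.

Lemma CexpD z w : Cexp (z + w) = Cexp z * Cexp w.
Proof.
by apply: complex_eq; rewrite !(ReCM, ImCM, Re_Cexp, Im_Cexp) ReCD ImCD expRD ?cosD ?sinD; ring.
Qed.

Lemma normc_Cexp z : normc (Cexp z) = expR (Re z).
Proof.
rewrite normc_sqrt Re_Cexp Im_Cexp !exprMn -mulrDr cos2Dsin2 mulr1 sqrtr_sqr.
by rewrite ger0_norm // expR_ge0.
Qed.

Definition exp_sum w N : CC R := \sum_(0 <= k < N) ((k`!%:R : R)^-1)%:C * w ^+ k.

Let lin v w s : R := Re (v * Cexp (s%:C * w)).

Let is_derive_lin v w (s : R) : is_derive s 1 (lin v w) (lin (v * w) w s).
Proof.
have he : is_derive s 1 (fun s => expR (Re w * s)) (expR (Re w * s) * Re w).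
  by apply: (@is_derive_chain R expR); exact: is_derive_scale.
have hc : is_derive s 1 (fun s => cos (Im w * s)) (- sin (Im w * s) * Im w).
  by apply: (@is_derive_chain R cos); exact: is_derive_scale.
have hs : is_derive s 1 (fun s => sin (Im w * s)) (cos (Im w * s) * Im w).
  by apply: (@is_derive_chain R sin); exact: is_derive_scale.
have linE v' : lin v' w = (fun s => expR (Re w * s) *
   (Re v' * cos (Im w * s) + - Im v' * sin (Im w * s))).
  apply/funext => t; rewrite /lin ReCM Re_Cexp Im_Cexp ReCM ImCM /= !mul0r subr0 addr0.
  by rewrite [t * Re w]mulrC [t * Im w]mulrC; ring.
have := is_derive_mul he (is_derive_add (is_derive_cmul (Re v) hc) (is_derive_cmul (- Im v) hs)).
rewrite !linE; congr (is_derive _ _ _ _).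
by rewrite ReCM ImCM; ring.
Qed.

Let poly_part v w N (s : R) : R := \sum_(0 <= k < N) (k`!%:R^-1 * s ^+ k) * Re (v * w ^+ k).

Let is_derive_poly v w N (s : R) :
  is_derive s 1 (poly_part v w N.+1) (poly_part (v * w) w N s).
Proof.
elim: N => [|N IH].
  rewrite /poly_part [X in is_derive _ _ _ X]big_geq //.
  rewrite (_ : (fun s => _) = (fun=> Re (v * 1))); first exact: is_derive_const.
  by apply/funext => t; rewrite big_nat1 fact0 expr0 invr1 !mul1r.
have h : is_derive s 1 (fun s => poly_part v w N.+1 s +
    (N.+1`!%:R^-1 * Re (v * w ^+ N.+1)) * s ^+ N.+1)
   (poly_part (v * w) w N s + (N.+1`!%:R^-1 * Re (v * w ^+ N.+1)) * (N.+1%:R * s ^+ N * 1)).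
  apply: is_derive_add; apply: is_derive_cmul.
  exact: (@is_derive_pow R id s 1 N).
move: h; rewrite /poly_part (_ : (fun s => _ + _) = (fun s => \sum_(0 <= k < N.+2) (k`!%:R^-1 * s ^+ k) * Re (v * w ^+ k))).
  congr (is_derive _ _ _ _); rewrite [RHS]big_nat_recr //=; congr (_ + _).
  rewrite exprS mulrA factS natrM invfM mulr1.
  have : N.+1%:R != 0 :> R by rewrite pnatr_eq0.
  by set a := N`!%:R^-1; set c := Re _; set M := N.+1%:R => M0; field.
by apply/funext => t; rewrite [RHS]big_nat_recr //=; congr (_ + _); ring.
Qed.

Let remainder N v w (s : R) : R := lin v w s + -1 * poly_part v w N s.

Let remainder_le N v w (s : R) : 0 <= s <= 1 ->
  remainder N v w s <= normc v * expR (normc w) * (normc w ^+ N * (N`!%:R^-1 * s ^+ N)).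
Proof.
elim: N v s => [|N IH] v s /andP[s0 s1].
  rewrite /remainder /poly_part big_geq // mulr0 addr0 !expr0 fact0 invr1 !mulr1.
  apply: le_trans (ler_norm _) _; apply: le_trans (Re_le_normc _) _.
  rewrite normcM ler_wpM2l ?normc_ge0 // normc_Cexp ler_expR ReCM /= mul0r subr0.
  apply: (@le_trans _ _ (s * normc w)).
    by rewrite ler_wpM2l // (le_trans (ler_norm _)) // Re_le_normc.
  by rewrite ler_piMl // normc_ge0.
pose C := normc v * expR (normc w) * normc w ^+ N.+1.
have r0 : remainder N.+1 v w 0 = 0.
  rewrite /remainder /lin /poly_part big_nat_recl // big1 ?addr0; last first.
    by move=> k _; rewrite expr0n /= mulr0 mul0r.
  rewrite fact0 invr1 !expr0 !mulr1 mul1r mulN1r.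
  rewrite [_ * w](_ : _ = 0) ?mul0r // /Cexp /= expR0 cos0 sin0.
  by case: (v) => a b /=; ring.
have := @le_of_derive R (remainder N.+1 v w) (fun s => C * (N.+1`!%:R^-1 * s ^+ N.+1))
  (fun s => lin (v * w) w s + -1 * poly_part (v * w) w N s)
  (fun s => C * (N.+1`!%:R^-1 * (N.+1%:R * s ^+ N * 1))) 0 s s0 _ _ _.
rewrite r0 expr0n /= !mulr0 !subr0 /C -!mulrA; apply.
- move=> t; apply: is_derive_add; first exact: is_derive_lin.
  apply: is_derive_cmul; exact: is_derive_poly.
- move=> t; apply: is_derive_cmul; apply: is_derive_cmul.
  exact: (@is_derive_pow R id t 1 N).
- move=> t /andP[t0 ts]; have t01 : 0 <= t <= 1 by rewrite t0 (le_trans ts).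
  apply: le_trans (IH (v * w) t t01) _; rewrite le_eqVlt; apply/orP; left; apply/eqP.
  rewrite normcM factS natrM invfM exprS; have : N.+1%:R != 0 :> R by rewrite pnatr_eq0.
  by set a := N`!%:R^-1; set M := N.+1%:R => M0; field.
Qed.

(** The real functions [s |-> Re (v * Cexp (s w))] have derivatives of the same
    form with [v] replaced by [v * w], so the bound of the remainder follows by
    induction from the mean value theorem. The choices [v = 1, -1, i, -i] then
    bound both coordinates. *)
Lemma exp_taylor w N : normc (Cexp w - exp_sum w N) <=
  2 * (expR (normc w) * (normc w ^+ N / N`!%:R)).
Proof.
have key v : normc v = 1 -> Re (v * (Cexp w - exp_sum w N)) <=
   expR (normc w) * (normc w ^+ N / N`!%:R).
  move=> v1; have one : 0 <= (1 : R) <= 1 by rewrite ler01 lexx.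
  have := @remainder_le N v w 1 one; rewrite v1 mul1r expr1n mulr1; apply: le_trans.
  rewrite /remainder /lin /poly_part mul1r mulN1r mulrBr ReCD ReCN; apply: lerD => //.
  rewrite lerN2 le_eqVlt; apply/orP; left; apply/eqP.
  rewrite /exp_sum mulr_sumr.
  elim/big_ind2 : _ => // [x1 x2 y1 y2 -> ->|k _]; first by rewrite ReCD.
  rewrite expr1n mulr1 mulrCA [RHS]ReCM /= mul0r subr0.
  by [].
apply: le_trans (normc_le_ReIm _) _; rewrite mulr2n mulrDl !mul1r; set X := _ - _.
have i1 : normc (0 +i* 1) = 1 by rewrite normc_sqrt /= expr0n /= add0r expr1n sqrtr1.
have iN1 : normc (- (0 +i* 1)) = 1 by rewrite normcN.
have o1 : normc 1 = 1 by exact: Normc.normc1.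
have oN1 : normc (-1) = 1 by rewrite normcN.
apply: lerD; rewrite ler_norml; apply/andP; split.
- by rewrite lerNl -ReCN -mulN1r; exact: key.
- by rewrite -[X in Re X]mul1r; exact: key.
- by have := key _ i1; rewrite ReCM /= mul0r mul1r sub0r lerNl.
- by have := key _ iN1; rewrite ReCM /= oppr0 mul0r sub0r mulN1r opprK.
Qed.

End ComplexExp.

(** * Dirichlet series *)

Section DirichletSeries.
Context {R : realType}.
Local Notation Re := complex.Re.
Local Notation Im := complex.Im.
Local Notation normc := (@Normc.normc R).
Implicit Types (z w a h : CC R).

Lemma ln_nat_ge0 n : 0 <= ln (n%:R : R).
Proof.
case: n => [|n]; first by rewrite ln0.
by rewrite ln_ge0 // ler1n.
Qed.

Lemma expr_fact_le (x : R) k : 0 <= x -> x ^+ k / k`!%:R <= expR x.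
Proof.
case: k => [|k] x0; first by rewrite expr0 fact0 divr1 -expR0 ler_expR.
by have := expR_ge1Dxn k x0; apply: le_trans; rewrite lerDr.
Qed.

Lemma natpowCD n z w : natpowC n (z + w) = natpowC n z * natpowC n w.
Proof. by rewrite /natpowC mulrDl CexpD. Qed.

Lemma normc_natpowC n z : normc (natpowC n z) = expR (Re z * ln n%:R).
Proof. by rewrite normc_Cexp ReCM /= mulr0 subr0. Qed.

Variable q : nat -> R.
Hypothesis q00 : q 0 = 0.
Hypothesis q_ge0 : forall n, 0 <= q n.
Hypothesis q_sum : forall s : R, s < 2^-1 ->
  exists S, has_sum (fun n => q n * expR (s * ln n%:R)) S.

Definition dterm n a : CC R := natpowC n a * (q n)%:C.

(** The Dirichlet series with nonnegative coefficients [q], in the variable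
    [a]; the sum starts at 1 as [natpowC] has no meaning at 0. *)
Definition dsum a : CC R := limn (fun N => \sum_(1 <= n < N) dterm n a).

Lemma normc_dterm n a : normc (dterm n a) = q n * expR (Re a * ln n%:R).
Proof. by rewrite normcM normc_natpowC normc_real ger0_norm // mulrC. Qed.

Lemma csum_dsum a : Re a < 2^-1 -> csum (dterm ^~ a) (dsum a).
Proof.
move=> /q_sum[S hS].
have [l hl] : exists l, csum (dterm ^~ a) l.
  by apply: (csum_exists hS) => n; rewrite normc_dterm.
suff -> : dsum a = l by [].
apply/cvg_lim => //.
have -> // : (fun N => \sum_(1 <= n < N) dterm n a) = (fun N => \sum_(0 <= n < N) dterm n a).
apply/funext => -[|N]; first by rewrite !big_geq.
by rewrite [RHS]big_ltn // /dterm q00 mulr0 add0r.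
Qed.

Definition dcoef_term a k n : CC R := dterm n a * ((k`!%:R : R)^-1 * ln n%:R ^+ k)%:C.

(** The Taylor coefficients of [dsum q] at [a], obtained by differentiating
    term by term; [dcoef a 1] is the derivative. *)
Definition dcoef a k : CC R := limn (fun N => \sum_(0 <= n < N) dcoef_term a k n).

Lemma csum_dcoef a k : Re a < 2^-1 -> csum (dcoef_term a k) (dcoef a k).
Proof.
move=> ha; pose d := (2^-1 - Re a) / 2.
have d0 : 0 < d by rewrite divr_gt0 // subr_gt0.
have hd : Re a + d < 2^-1 by rewrite /d; lra.
have [S hS] := q_sum hd.
have [l hl] : exists l, csum (dcoef_term a k) l.
  apply: (csum_exists (has_sumZ (c := d ^- k) hS)) => n.
  rewrite normcM normc_dterm normc_real.
  have L0 := ln_nat_ge0 n; set L := ln _ in L0 *.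
  rewrite ger0_norm ?mulr_ge0 ?invr_ge0 ?exprn_ge0 //.
  have h := expr_fact_le k (mulr_ge0 (ltW d0) L0).
  have -> : k`!%:R^-1 * L ^+ k = d ^- k * ((d * L) ^+ k / k`!%:R).
    have : d ^+ k != 0 by rewrite expf_neq0 // gt_eqF.
    have : k`!%:R != 0 :> R by rewrite pnatr_eq0 -lt0n fact_gt0.
    by rewrite [(d * L) ^+ k]exprMn; set D := d ^+ k; set K := _%:R; set E := L ^+ k => K0 D0; field; apply/andP.
  rewrite mulrCA ler_wpM2l ?invr_ge0 ?exprn_ge0 ?(ltW d0) //.
  by rewrite -mulrA ler_wpM2l // mulrDl expRD ler_wpM2l // expR_ge0.
by suff -> : dcoef a k = l by []; apply/cvg_lim.
Qed.

Lemma dcoef0 a : Re a < 2^-1 -> dcoef a 0 = dsum a.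
Proof.
move=> ha; apply: csum_unique (@csum_dcoef a 0 ha) _.
have := csum_dsum ha; congr csum; apply/funext => n.
by rewrite /dcoef_term fact0 expr0 invr1 mulr1 mulr1.
Qed.

Lemma csum_big (f : nat -> nat -> CC R) (l : nat -> CC R) K :
  (forall k, csum (f k) (l k)) ->
  csum (fun n => \sum_(0 <= k < K) f k n) (\sum_(0 <= k < K) l k).
Proof.
move=> hf; elim: K => [|K IH].
  rewrite big_geq // (_ : (fun n => _) = (fun=> 0)); last by apply/funext => n; rewrite big_geq.
  rewrite /csum (_ : (fun N => _) = (fun=> 0)); first exact: cvg_cst.
  by apply/funext => N; rewrite big1.
have -> : (fun n => \sum_(0 <= k < K.+1) f k n) = (fun n => \sum_(0 <= k < K) f k n + f K n).
  by apply/funext => n; rewrite big_nat_recr.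
rewrite (@big_nat_recr _ _ _ K 0); last exact: leq0n.
exact: (csumD IH (hf K)).
Qed.

(** The Taylor expansion of each power of [n] turns the remainder of the
    Dirichlet series into a series of remainders of the exponential. *)
Lemma csum_remainder a h N : Re a < 2^-1 -> Re (a + h) < 2^-1 ->
  csum (fun n => dterm n a * (Cexp (h * (ln n%:R)%:C) - exp_sum (h * (ln n%:R)%:C) N))
    (dsum (a + h) - \sum_(0 <= k < N) dcoef a k * h ^+ k).
Proof.
move=> ha hh.
have h1 := @csum_big _ _ N (fun k => csumZ (c := h ^+ k) (@csum_dcoef a k ha)).
have := csumD (csum_dsum hh) (csumZ (c := -1) h1).
rewrite mulN1r (_ : \sum_(0 <= k < N) h ^+ k * dcoef a k = \sum_(0 <= k < N) dcoef a k * h ^+ k); last first.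
  by apply: eq_bigr => k _; rewrite mulrC.
congr csum; apply/funext => n; rewrite mulN1r mulrBr; congr (_ - _).
  by rewrite /dterm natpowCD /natpowC mulrAC.
rewrite /exp_sum mulr_sumr; apply: eq_bigr => k _.
rewrite /dcoef_term exprMn rmorphM rmorphXn /=; ring.
Qed.

(** Two of the three multiples of [normc h] turn the factorial into a power of
    1/2: [t ^+ N / N! <= 2^-1 ^+ N * expR (2 t)] with [t = normc h * ln n].
    This is a geometric remainder, so the Taylor series converges. *)
Lemma dsum_taylor a h N (s S : R) : Re a + 3 * normc h <= s -> s < 2^-1 ->
  has_sum (fun n => q n * expR (s * ln n%:R)) S ->
  normc (dsum (a + h) - \sum_(0 <= k < N) dcoef a k * h ^+ k) <= 2^-1 ^+ N * (2 * S).
Proof.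
move=> hs s2 hS; have nh := normc_ge0 h.
have Rh : Re h <= normc h by exact: le_trans (ler_norm _) (Re_le_normc _).
have ha : Re a < 2^-1 by lra.
have hh : Re (a + h) < 2^-1 by rewrite ReCD; lra.
have hS2 := has_sumZ (c := 2^-1 ^+ N) (has_sumZ (c := 2) hS).
apply: (csum_norm_le (@csum_remainder a h N ha hh) hS2) => n.
have L0 := ln_nat_ge0 n; rewrite normcM normc_dterm; set L := ln _ in L0 *.
have h1 := exp_taylor (h * L%:C) N.
have nhL : normc (h * L%:C) = normc h * L by rewrite normcM normc_real ger0_norm.
rewrite nhL in h1; set t := normc h * L in h1 nhL.
have t0 : 0 <= t by rewrite mulr_ge0.
have h2 : t ^+ N / N`!%:R <= 2^-1 ^+ N * expR (2 * t).
  have := @expr_fact_le (2 * t) N; rewrite exprMn => /(_ _) h3.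
  rewrite -ler_pdivrMl ?exprn_gt0 ?invr_gt0 // -exprVn invrK mulrA.
  by apply: h3; rewrite mulr_ge0.
have eA0 := expR_ge0 (Re a * L).
apply: (@le_trans _ _ (q n * expR (Re a * L) * (2 * (expR t * (2^-1 ^+ N * expR (2 * t)))))).
  rewrite ler_wpM2l ?mulr_ge0 //; apply: le_trans h1 _.
  by rewrite ler_pM2l // ler_wpM2l // expR_ge0.
have -> : q n * expR (Re a * L) * (2 * (expR t * (2^-1 ^+ N * expR (2 * t)))) =
  2^-1 ^+ N * (2 * (q n * (expR (Re a * L) * expR t * expR (2 * t)))) by ring.
rewrite ler_wpM2l ?exprn_ge0 ?invr_ge0 // ler_wpM2l // ler_wpM2l // -!expRD ler_expR.
have -> : Re a * L + t + 2 * t = (Re a + 3 * normc h) * L by rewrite /t; ring.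
by rewrite ler_wpM2r.
Qed.

(** The remainder of order two, uniform in [a] as long as [Re a + 2 * d <= s]:
    the factor [ln n ^+ 2] is absorbed by [n ^ d]. *)
Lemma dsum_quadratic a h (s S d : R) : 0 < d -> normc h <= d -> Re a + 2 * d <= s ->
  s < 2^-1 -> has_sum (fun n => q n * expR (s * ln n%:R)) S ->
  normc (dsum (a + h) - dsum a - h * dcoef a 1) <= normc h ^+ 2 * (2 / d ^+ 2 * S).
Proof.
move=> d0 hd hs s2 hS; have nh := normc_ge0 h.
have Rh : Re h <= normc h by exact: le_trans (ler_norm _) (Re_le_normc _).
have ha : Re a < 2^-1 by lra.
have hh : Re (a + h) < 2^-1 by rewrite ReCD; lra.
have hS2 := has_sumZ (c := normc h ^+ 2) (has_sumZ (c := 2 / d ^+ 2) hS).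
have := @csum_remainder a h 2 ha hh.
rewrite big_nat_recr //= big_nat1 expr0 mulr1 expr1 dcoef0 // opprD addrA [dcoef a 1 * h]mulrC.
move=> hr; apply: (csum_norm_le hr hS2) => n.
have L0 := ln_nat_ge0 n; rewrite normcM normc_dterm; set L := ln _ in L0 *.
have h1 := exp_taylor (h * L%:C) 2.
have nhL : normc (h * L%:C) = normc h * L by rewrite normcM normc_real ger0_norm.
rewrite nhL in h1.
have dL0 : 0 <= d * L by rewrite mulr_ge0 // ltW.
have h2 : L ^+ 2 <= 2 / d ^+ 2 * expR (d * L).
  have := expr_fact_le 2 dL0; rewrite exprMn.
  have -> : 2`!%:R = 2 :> R by [].
  rewrite ler_pdivrMr // => h3.
  by rewrite mulrAC ler_pdivlMr ?exprn_gt0 // mulrC [2 * _]mulrC.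
have eA0 := expR_ge0 (Re a * L).
apply: (@le_trans _ _ (q n * expR (Re a * L) * (normc h ^+ 2 * (expR (d * L) * (2 / d ^+ 2 * expR (d * L)))))).
  rewrite ler_wpM2l ?mulr_ge0 //; apply: le_trans h1 _.
  have -> : 2 * (expR (normc h * L) * ((normc h * L) ^+ 2 / 2`!%:R)) =
     normc h ^+ 2 * (expR (normc h * L) * L ^+ 2).
    by have -> : 2`!%:R = 2 :> R by []; field.
  rewrite ler_wpM2l ?sqr_ge0 // ler_pM ?expR_ge0 ?sqr_ge0 //.
  by rewrite ler_expR ler_wpM2r.
have -> : q n * expR (Re a * L) * (normc h ^+ 2 * (expR (d * L) * (2 / d ^+ 2 * expR (d * L)))) =
  normc h ^+ 2 * (2 / d ^+ 2 * (q n * (expR (Re a * L) * expR (d * L) * expR (d * L)))) by ring.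
rewrite ler_wpM2l ?sqr_ge0 // ler_wpM2l ?divr_ge0 ?sqr_ge0 // ler_wpM2l // -!expRD ler_expR.
have -> : Re a * L + d * L + d * L = (Re a + 2 * d) * L by ring.
by rewrite ler_wpM2r.
Qed.

End DirichletSeries.

(** * Complex derivatives *)

Section ComplexDerivative.
Context {R : realType}.
Local Notation Re := complex.Re.
Local Notation Im := complex.Im.
Local Notation normc := (@Normc.normc R).
Implicit Types (z w a h : CC R) (f : CC R -> CC R).

Lemma cc_nbhsP a (V : set (CC R)) :
  nbhs a V <-> exists2 r : R, 0 < r & forall z, normc (z - a) < r -> V z.
Proof.
split.
  move=> /nbhs_ballP [e /=]; rewrite ltcE /= => /andP[/eqP ei er] h.
  have eE : e = (Re e)%:C by apply: complex_eq.
  exists (Re e) => // z hz; apply: h; rewrite /ball /= normcE_norm normcB eE.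
  by rewrite ltcR.
move=> [r r0 h]; apply/nbhs_ballP; exists r%:C; first by rewrite /= ltcR.
by move=> z; rewrite /ball /= normcE_norm normcB ltcR; exact: h.
Qed.

Lemma derive1_quadratic f a l (C d : R) : 0 < d ->
  (forall h, normc h <= d -> normc (f (a + h) - f a - h * l) <= normc h ^+ 2 * C) ->
  derive1 f a = l.
Proof.
move=> d0 H; rewrite /derive1; apply/cvg_lim => //.
apply/cvgrPdist_lt => e; rewrite ltcE /= => /andP[/eqP ei er].
have eE : e = (Re e)%:C by apply: complex_eq.
have C0 : 0 <= C.
  have := H d%:C; rewrite normc_real ger0_norm ?(ltW d0) // => /(_ (lexx _)) h.
  have := le_trans (normc_ge0 _) h; by rewrite pmulr_rge0 // exprn_gt0.
have C1 : 0 < C + 1 by lra.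
apply/cc_nbhsP; exists (Num.min d (Re e / (C + 1))).
  by rewrite lt_min d0 divr_gt0.
move=> h; rewrite subr0 lt_min => /andP[hd he] /= h0.
rewrite normcE_norm eE ltcR.
have nh : 0 < normc h.
  rewrite lt_neqAle normc_ge0 andbT eq_sym; apply/eqP => /normc_eq0 h00.
  by move/eqP: h0.
have := H h (ltW hd); rewrite [a + h]addrC => hq.
have -> : l - h^-1 *: (f (h + a) - f a) = - (h^-1 * (f (h + a) - f a - h * l)).
  rewrite /GRing.scale /= [in RHS]mulrBr mulKf; last by move/eqP: h0 => /eqP.
  by rewrite opprB.
rewrite normcN normcM Normc.normcV.
apply: (@le_lt_trans _ _ (normc h * C)).
  by rewrite ler_pdivrMl // mulrA -expr2.
apply: (@le_lt_trans _ _ (normc h * (C + 1))); first by rewrite ler_wpM2l ?ltW // ltrDl.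
by rewrite -ltr_pdivlMr.
Qed.

(** A substitute for integrating [f'] along the segment: the segment is cut
    into many pieces, on each of which the remainder is quadratic, uniformly.
    *)
Lemma segment_lipschitz f (f' : CC R -> CC R) a h (A C d : R) : 0 < d ->
  (forall t : R, 0 <= t <= 1 -> normc (f' (a + t%:C * h)) <= A) ->
  (forall (t : R) k, 0 <= t <= 1 -> normc k <= d ->
    normc (f (a + t%:C * h + k) - f (a + t%:C * h) - k * f' (a + t%:C * h)) <= normc k ^+ 2 * C) ->
  normc (f (a + h) - f a) <= A * normc h.
Proof.
move=> d0 hA hC.
have C0 : 0 <= C.
  have t0 : 0 <= (0 : R) <= 1 by rewrite lexx ler01.
  have := hC 0 d%:C t0; rewrite normc_real ger0_norm ?(ltW d0) // => /(_ (lexx _)) hh.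
  have := le_trans (normc_ge0 _) hh; by rewrite pmulr_rge0 // exprn_gt0.
have nh := normc_ge0 h.
have step (n : nat) : normc h / n.+1%:R <= d ->
  normc (f (a + h) - f a) <= A * normc h + C * normc h ^+ 2 / n.+1%:R.
  move=> hn; have N0 : 0 < n.+1%:R :> R by rewrite ltr0n.
  pose F (i : nat) := f (a + (i%:R / n.+1%:R : R)%:C * h).
  have eF : f (a + h) - f a = \sum_(0 <= i < n.+1) (F i.+1 - F i).
    rewrite telescope_sumr // /F divff ?gt_eqF // mul0r mul1r.
    by rewrite mul0r addr0.
  rewrite eF; apply: le_trans (ler_normc_sum _ _ _) _.
  apply: (@le_trans _ _ (\sum_(0 <= i < n.+1) (A * (normc h / n.+1%:R) + (normc h / n.+1%:R) ^+ 2 * C))).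
    rewrite big_nat_cond [X in _ <= X]big_nat_cond; apply: ler_sum => i /andP[/andP[_ iN] _].
    pose t : R := i%:R / n.+1%:R.
    have t01 : 0 <= t <= 1.
      by rewrite /t divr_ge0 //= ler_pdivrMr // mul1r ler_nat ltnW.
    pose k : CC R := (n.+1%:R^-1 : R)%:C * h.
    have nk : normc k = normc h / n.+1%:R.
      by rewrite normcM normc_real ger0_norm ?invr_ge0 ?(ltW N0) // mulrC.
    have eS : F i.+1 = f (a + t%:C * h + k).
      rewrite /F /k -addrA -mulrDl -rmorphD /= /t; congr (f (a + _%:C * h)).
      by rewrite -natr1; field; rewrite gt_eqF.
    have := hC t k t01; rewrite nk => /(_ hn) h1; have h2 := hA t t01.
    have -> : F i.+1 - F i = (f (a + t%:C * h + k) - f (a + t%:C * h) - k * f' (a + t%:C * h)) + k * f' (a + t%:C * h).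
      by rewrite eS subrK.
    apply: le_trans (normcD _ _) _; rewrite addrC; apply: lerD => //.
    by rewrite normcM nk mulrC ler_wpM2r // divr_ge0 // ltW.
  rewrite sumr_const_nat subn0 -mulr_natr le_eqVlt; apply/orP; left; apply/eqP.
  by field; rewrite gt_eqF.
apply/ler_addgt0Pr => e e0.
(* pieces of length at most [d], and a total error of at most [e] *)
pose n := (Num.truncn (normc h / d) + Num.truncn (C * normc h ^+ 2 / e)).+1.
have N0 : 0 < n.+1%:R :> R by rewrite ltr0n.
have n1 : normc h / d <= n.+1%:R.
  apply/ltW/(lt_le_trans (truncnS_gt _)); rewrite ler_nat /n.
  by rewrite ltnS; exact: leq_trans (leq_addr _ _) (leqnSn _).
have n2 : C * normc h ^+ 2 / e <= n.+1%:R.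
  apply/ltW/(lt_le_trans (truncnS_gt _)); rewrite ler_nat /n.
  by rewrite ltnS; exact: leq_trans (leq_addl _ _) (leqnSn _).
apply: le_trans (step n _) _.
  by rewrite ler_pdivrMr // [d * _]mulrC -ler_pdivrMr.
by rewrite lerD2l ler_pdivrMr // [e * _]mulrC -ler_pdivrMr.
Qed.

(** The coefficients of a power series converging at distance [s] are [O (s ^-
    k)], and [normc (u ^+ k - v ^+ k) <= k * (s / 4) ^+ k.-1 * normc (u - v)]
    on the smaller disc; the bounds sum up geometrically. *)
Lemma analytic_lipschitz f a : analytic_at f a ->
  exists r L : R, 0 < r /\ forall z w, normc (z - a) < r -> normc (w - a) < r ->
    normc (f z - f w) <= L * normc (z - w).
Proof.
move=> [c [r [r0 hc]]].
pose s := r / 2; have s0 : 0 < s by rewrite divr_gt0.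
have [C hC] : exists C : R, forall k, normc (c k) * s ^+ k <= C.
  have : normc (a + s%:C - a) < r.
    by rewrite addrAC subrr add0r normc_real ger0_norm ?(ltW s0) // /s; lra.
  move=> /hc; rewrite addrAC subrr add0r => hs.
  have hd : (fun N => c N * s%:C ^+ N) @ \oo --> (0 : CC R).
    have h1 : (fun N => \sum_(0 <= k < N.+1) c k * s%:C ^+ k) @ \oo --> f (a + s%:C).
      by have := hs; rewrite -cvg_shiftS.
    have e : (fun N => c N * s%:C ^+ N) = (fun N =>
        \sum_(0 <= k < N.+1) c k * s%:C ^+ k - \sum_(0 <= k < N) c k * s%:C ^+ k).
      by apply/funext => N; rewrite big_nat_recr //= addrAC subrr add0r.
    rewrite e -[X in _ --> X](subrr (f (a + s%:C))); exact: (cvgB h1 hs).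
  move/ccvgP: hd => hd.
  have hb : (fun N => normc (c N) * s ^+ N) @ \oo --> (0 : R).
    apply: cvg_trans hd; apply: near_eq_cvg; apply: nearW => N.
    by rewrite subr0 normcM normcX normc_real (ger0_norm (ltW s0)).
  have [M hM] : bounded_fun (fun N => normc (c N) * s ^+ N : R) by apply: cvg_seq_bounded; apply/cvg_ex; exists 0.
  exists (`|M| + 1) => k.
  have := hM.2 (`|M| + 1); rewrite ltr_pwDr //; last exact: ler_norm.
  move=> /(_ isT k I) /=; apply: le_trans; exact: ler_norm.
have C0 : 0 <= C by apply: le_trans (hC 0%N); rewrite mulr_ge0 ?normc_ge0 ?exprn_ge0 // ltW.
(* with a quarter of [s] the factors [k.+1 / 4 ^ k] are summable *)
pose rho := s / 4; have rho0 : 0 < rho by rewrite divr_gt0.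
exists rho, (4 * C / s); split=> // z w hz hw.
set u := z - a; set v := w - a; rewrite -/u in hz; rewrite -/v in hw.
have uv : z - w = u - v by rewrite /u /v opprB addrA subrK.
have zr : normc (z - a) < r by apply: lt_trans hz _; rewrite /rho /s; lra.
have wr : normc (w - a) < r by apply: lt_trans hw _; rewrite /rho /s; lra.
have hzw : (fun N => \sum_(0 <= k < N) c k * u ^+ k - \sum_(0 <= k < N) c k * v ^+ k)
    @ \oo --> f z - f w.
  by apply: cvgB; exact: hc.
have pow k : normc (u ^+ k.+1 - v ^+ k.+1) <= k.+1%:R * rho ^+ k * normc (u - v).
  elim: k => [|k IH]; first by rewrite !expr1 mul1r expr0 mul1r.
  have -> : u ^+ k.+2 - v ^+ k.+2 = u * (u ^+ k.+1 - v ^+ k.+1) + (u - v) * v ^+ k.+1.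
    by rewrite !exprS; ring.
  apply: le_trans (normcD _ _) _; rewrite !normcM normcX.
  have -> : k.+2%:R * rho ^+ k.+1 * normc (u - v) =
     rho * (k.+1%:R * rho ^+ k * normc (u - v)) + normc (u - v) * rho ^+ k.+1.
    by rewrite -natr1 [rho ^+ k.+1]exprS; ring.
  apply: lerD; first by rewrite ler_pM ?normc_ge0 // ltW.
  by rewrite ler_wpM2l ?normc_ge0 // lerXn2r ?nnegrE ?normc_ge0 ?(ltW rho0) // ltW.
rewrite uv; apply: (ccvg_normc_le hzw); apply: nearW => N /=.
have -> : (\sum_(0 <= k < N) c k * u ^+ k - \sum_(0 <= k < N) c k * v ^+ k) =
  \sum_(0 <= k < N) c k * (u ^+ k - v ^+ k).
  by rewrite -sumrB; apply: eq_bigr => k _; rewrite mulrBr.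
apply: le_trans (ler_normc_sum _ _ _) _.
apply: (@le_trans _ _ (\sum_(0 <= k < N) 2 * C / s * normc (u - v) * (2^-1 ^+ k))).
  apply: ler_sum => -[|k] _.
    rewrite subrr mulr0 Normc.normc0 !mulr_ge0 ?invr_ge0 ?normc_ge0 ?(ltW s0) //.
  rewrite normcM; apply: le_trans (ler_wpM2l (normc_ge0 _) (pow k)) _.
  have h1 := hC k.+1.
  have k2 : k.+1%:R <= 2 ^+ k :> R.
    by rewrite -natrX ler_nat; exact: ltn_expl.
  have e1 : normc (c k.+1) * (k.+1%:R * rho ^+ k * normc (u - v)) =
     (normc (c k.+1) * s ^+ k.+1) * (k.+1%:R / 4 ^+ k) / s * normc (u - v).
    rewrite /rho expr_div_n exprS; have s4 : (4 : R) ^+ k != 0 by rewrite expf_neq0.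
    have sk : s != 0 by rewrite gt_eqF.
    move: s4; set S := s ^+ k; set F := 4 ^+ k; move=> s4; field; rewrite s4; exact/andP.
  rewrite e1.
  have -> : 2 * C / s * normc (u - v) * 2^-1 ^+ k.+1 = C * 2^-1 ^+ k / s * normc (u - v).
    by rewrite exprS; field; rewrite gt_eqF.
  rewrite ler_wpM2r ?normc_ge0 // ler_wpM2r ?invr_ge0 ?(ltW s0) //.
  apply: ler_pM => //.
  - by rewrite mulr_ge0 ?normc_ge0 ?exprn_ge0 // ltW.
  - rewrite ler_pdivrMr ?exprn_gt0 //; apply: le_trans k2 _.
    rewrite -exprMn (_ : 2^-1 * 4 = 2) //; by field.
rewrite -mulr_sumr.
have g1 : \sum_(0 <= k < N) (2^-1 : R) ^+ k <= 2.
  have h01 : 0 <= (2^-1 : R) < 1 by apply/andP; split; lra.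
  have := psum_le N (fun k => _) (has_sum_geometric h01).
  have -> : (1 - 2^-1)^-1 = 2 :> R by field.
  by apply=> k; rewrite exprn_ge0 // invr_ge0.
have -> : 4 * C / s * normc (u - v) = 2 * C / s * normc (u - v) * 2 by ring.
rewrite ler_wpM2l // mulr_ge0 ?normc_ge0 // divr_ge0 ?(ltW s0) // mulr_ge0 //.
Qed.

End ComplexDerivative.

(** * From unbounded derivatives to a natural boundary *)

Section NaturalBoundary.
Context {R : realType}.
Local Notation Re := complex.Re.
Local Notation Im := complex.Im.
Local Notation normc := (@Normc.normc R).
Implicit Types (z w a h : CC R).

Variable q : nat -> R.
Hypothesis q00 : q 0 = 0.
Hypothesis q_ge0 : forall n, 0 <= q n.
Hypothesis q_sum : forall s : R, s < 2^-1 ->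
  exists S, has_sum (fun n => q n * expR (s * ln n%:R)) S.

Lemma dsum_derive1 a : Re a < 2^-1 -> derive1 (dsum q) a = dcoef q a 1.
Proof.
move=> ha; pose d := (2^-1 - Re a) / 4.
have d0 : 0 < d by rewrite divr_gt0 // subr_gt0.
have s2 : Re a + 2 * d < 2^-1 by rewrite /d; lra.
have [S hS] := q_sum s2.
apply: (derive1_quadratic d0) => h hd.
exact: (dsum_quadratic q00 q_ge0 q_sum d0 hd (lexx _) s2 hS).
Qed.

Lemma dsum_analytic a : Re a < 2^-1 -> analytic_at (dsum q) a.
Proof.
move=> ha; pose d := (2^-1 - Re a) / 4.
have d0 : 0 < d by rewrite divr_gt0 // subr_gt0.
have s2 : Re a + 3 * d < 2^-1 by rewrite /d; lra.
have [S hS] := q_sum s2.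
exists (dcoef q a), d; split=> // z hz; apply/ccvgP.
have hs : Re a + 3 * normc (z - a) <= Re a + 3 * d by rewrite lerD2l ler_pM2l // ltW.
have h0 : (fun N : nat => 2^-1 ^+ N * (2 * S)) @ \oo --> (0 : R).
  rewrite -[X in _ --> X](mul0r (2 * S)); apply: cvgMl.
  by apply: cvg_expr; rewrite ger0_norm ?invr_ge0 // invf_lt1 // ltr1n.
apply: (squeeze_cvgr _ (cvg_cst (0 : R)) h0); apply: nearW => N.
rewrite normc_ge0 /= normcB.
have := dsum_taylor q00 q_ge0 q_sum N hs s2 hS.
by rewrite [a + _]addrC subrK.
Qed.

(** A bound on the derivative on the part of a disc that lies in the
    half-plane, a convex set, bounds the increments. *)
Lemma dsum_lipschitz a0 (r A : R) :
  (forall a, Re a < 2^-1 -> normc (a - a0) < r -> normc (dcoef q a 1) <= A) ->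
  forall z w, Re z < 2^-1 -> Re w < 2^-1 -> normc (z - a0) < r -> normc (w - a0) < r ->
  normc (dsum q w - dsum q z) <= A * normc (w - z).
Proof.
move=> hA z w hz hw nz nw.
pose m := Num.max (Re z) (Re w).
have m2 : m < 2^-1 by rewrite gt_max hz hw.
pose d := (2^-1 - m) / 4.
have d0 : 0 < d by rewrite divr_gt0 // subr_gt0.
have s2 : m + 2 * d < 2^-1 by rewrite /d; lra.
have [S hS] := q_sum s2.
have zm : Re z <= m by rewrite le_max lexx.
have wm : Re w <= m by rewrite le_max lexx orbT.
have wE : w = z + (w - z) by rewrite addrC subrK.
have Re_seg (t : R) : 0 <= t <= 1 -> Re (z + t%:C * (w - z)) <= m.
  move=> /andP[t0 t1]; rewrite ReCD ReCM /= mul0r subr0 ReCD ReCN.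
  have -> : Re z + t * (Re w - Re z) = (1 - t) * Re z + t * Re w by ring.
  have -> : m = (1 - t) * m + t * m by ring.
  by rewrite lerD // ler_wpM2l // subr_ge0.
rewrite [in X in X <= _]wE; apply: (segment_lipschitz (f' := fun a => dcoef q a 1) d0).
  move=> t t01; apply: hA; first by apply: le_lt_trans m2; exact: Re_seg.
  case/andP: t01 => t0 t1.
  have -> : z + t%:C * (w - z) - a0 = (1 - t)%:C * (z - a0) + t%:C * (w - a0).
    by rewrite rmorphB rmorph1; ring.
  apply: le_lt_trans (normcD _ _) _; rewrite !normcM !normc_real !ger0_norm ?subr_ge0 //.
  have -> : r = (1 - t) * r + t * r by ring.
  have [t10|t10] := ltP t (2^-1).
    apply: ltr_leD; first by rewrite ltr_pM2l // subr_gt0; lra.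
    by rewrite ler_wpM2l // ltW.
  apply: ler_ltD; first by rewrite ler_wpM2l ?subr_ge0 // ltW.
  by rewrite ltr_pM2l //; lra.
move=> t k t01 hk.
apply: (dsum_quadratic q00 q_ge0 q_sum d0 hk _ s2 hS).
by rewrite lerD2r; exact: Re_seg.
Qed.

Hypothesis blowup : forall a0 (r A : R), Re a0 = 2^-1 -> 0 < r ->
  exists a, [/\ Re a < 2^-1, normc (a - a0) < r & A < normc (dcoef q a 1)].

(** Neighbourhoods of [a0] contain discs, and the derivative is unbounded in
    each of them. *)
Lemma dsum_limf_esup a0 : Re a0 = 2^-1 ->
  limf_esup (fun a : CC R => (normc (derive1 (dsum q) a))%:E)
    (within (@left_half_plane R) (nbhs a0)) = +oo%E.
Proof.
move=> ha0; rewrite /limf_esup.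
suff h V : within (@left_half_plane R) (nbhs a0) V ->
    ereal_sup [set (normc (derive1 (dsum q) x))%:E | x in V] = +oo%E.
  apply/eqP; rewrite eq_le leey /=; apply: le_ereal_inf_tmp => _ [V hV <-].
  by rewrite h.
move=> /cc_nbhsP[r r0 hr]; apply: eq_infty => A.
have [a [ha na hA]] := blowup A ha0 r0.
apply: le_ereal_sup_tmp; exists (normc (derive1 (dsum q) a))%:E.
  by exists a => //; exact: hr.
by rewrite lee_fin dsum_derive1 // ltW.
Qed.

(** An extension would be Lipschitz near [a0], and then the derivative of the
    series would be bounded by the Lipschitz constant at all points near [a0]
    in the half-plane. *)
Lemma dsum_not_extendable a0 : Re a0 = 2^-1 ->
  ~ has_analytic_extension_near (@left_half_plane R) (dsum q) a0.
Proof.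
move=> ha0 [U [g [[oU Ua0] gU gE]]].
have [r1 [L [r10 hL]]] := analytic_lipschitz (gU _ Ua0).
have /cc_nbhsP[r2 r20 hr2] : nbhs a0 U by apply: open_nbhs_nbhs; split.
pose r := Num.min r1 r2 / 2.
have m0 : 0 < Num.min r1 r2 by rewrite lt_min r10.
have r0 : 0 < r by rewrite divr_gt0.
have [a [ha na hA]] := blowup (L + 1) ha0 r0.
pose d := Num.min r ((2^-1 - Re a) / 4).
have d0 : 0 < d by rewrite lt_min r0 divr_gt0 // subr_gt0.
have dd : d <= (2^-1 - Re a) / 4 by rewrite ge_min lexx orbT.
have dr : d <= r by rewrite ge_min lexx.
have s2 : Re a + 2 * d < 2^-1 by lra.
have [S hS] := q_sum s2.
have near (h : CC R) : normc h < d -> [/\ normc (a + h - a0) < r1, U (a + h) & Re (a + h) < 2^-1].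
  move=> hd; have Rh : Re h <= normc h by exact: le_trans (ler_norm _) (Re_le_normc _).
  have nn : normc (a + h - a0) < Num.min r1 r2.
    rewrite addrAC; apply: le_lt_trans (normcD _ _) _.
    have -> : Num.min r1 r2 = r + r by rewrite /r; field.
    by rewrite ltrD // (lt_le_trans hd).
  move: nn; rewrite lt_min => /andP[n1 n2]; split=> //; first exact: hr2.
  by rewrite ReCD; lra.
have S0 : 0 <= S by apply: has_sum_ge0 hS => n; rewrite mulr_ge0 // expR_ge0.
pose C := 2 / d ^+ 2 * S.
have C0 : 0 <= C by rewrite mulr_ge0 // divr_ge0 // exprn_ge0 // ltW.
(* an increment for which the quadratic remainder changes the slope by less
   than 1 *)
pose e := Num.min (d / 2) (1 / (2 * (C + 1))).
have C1 : 0 < C + 1 by lra.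
have e0 : 0 < e by rewrite lt_min !divr_gt0 // mulr_gt0.
have ed : e < d by apply: (@le_lt_trans _ _ (d / 2)); [rewrite ge_min lexx|lra].
have eC : e * C < 1.
  apply: (@le_lt_trans _ _ (1 / (2 * (C + 1)) * C)).
    by rewrite ler_wpM2r // ge_min lexx orbT.
  by rewrite div1r mulrC ltr_pdivrMr ?mulr_gt0 //; lra.
have ne : normc e%:C = e by rewrite normc_real ger0_norm // ltW.
have ned : normc e%:C < d by rewrite ne.
have [n1 u1 l1] := near e%:C ned.
have n0 : normc (0 : CC R) < d by rewrite Normc.normc0.
have [n2 u2 l2] := near 0 n0; rewrite addr0 in n2 u2 l2.
have hq := dsum_quadratic q00 q_ge0 q_sum d0 (ltW ned) (lexx _) s2 hS.
rewrite ne -/C -(gE _ u1 l1) -(gE _ u2 l2) in hq.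
have hl := hL _ _ n1 n2; rewrite addrAC subrr add0r ne in hl.
have : normc (e%:C * dcoef q a 1) <= L * e + e ^+ 2 * C.
  have -> : e%:C * dcoef q a 1 = (g (a + e%:C) - g a) - (g (a + e%:C) - g a - e%:C * dcoef q a 1).
    by rewrite opprB addrC subrK.
  by apply: le_trans (normcD _ _) _; rewrite normcN; exact: lerD.
rewrite normcM ne expr2 -mulrA [L * e]mulrC -mulrDr ler_pM2l // => hfin.
lra.
Qed.

End NaturalBoundary.

(** * Moments of the total progeny *)

Section ProgenyMoments.
Context {R : realType}.
Implicit Types (s : R).

Lemma progeny0 : @progeny R 0 = 0. Proof. by []. Qed.

Let half_lt1 s : s < 2^-1 -> 0 <= expR ((2 * s - 1) * ln 2) < 1.
Proof.
move=> s2; rewrite expR_ge0 /= expR_lt1 nmulr_rlt0; last lra.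
by rewrite ln_gt0 // ltr1n.
Qed.

(** If [4 ^ k <= n < 4 ^ k.+1], then [n ^ s] is at most twice [4 ^ (k s)] and
    [1 - expR (- n / 4 ^ k) >= 1 / 2]. Summing over all [k], the moment is
    bounded by the sum of [4 ^ (k s) * tail (4 ^ - k)], which converges
    geometrically since [tail (4 ^ - k) <= 5 / 2 ^ k]. *)
Lemma progeny_moment_pos s : 0 <= s < 2^-1 ->
  exists S, has_sum (fun n => @progeny R n * expR (s * ln n%:R)) S.
Proof.
move=> /andP[s0 s2]; have hr := half_lt1 s2.
pose w k := expR (s * (k%:R * ln 4)).
pose y k : R := 2^-1 ^+ k.
have y0 k : 0 < y k by rewrite exprn_gt0 // invr_gt0.
have x0 k : 0 < y k ^+ 2 by rewrite exprn_gt0.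
have ln42 : ln 4 = 2 * ln 2 :> R.
  have -> : 4 = 2 * 2 :> R by ring.
  by rewrite lnM ?posrE //; ring.
have wy k : w k * y k = expR ((2 * s - 1) * ln 2) ^+ k.
  rewrite /w /y -expRM_natl ln42.
  have -> : 2^-1 ^+ k = expR (k%:R * (- ln 2)) :> R.
    by rewrite expRM_natl expRN lnK ?posrE.
  by rewrite -expRD; congr expR; ring.
have rows k : has_sum (fun n => w k * (progeny n * (1 - expR (- (n%:R * y k ^+ 2))))) (w k * tail (y k ^+ 2)).
  by apply: has_sumZ; exact: tail_sum.
have A0 k n : 0 <= w k * (progeny n * (1 - expR (- (n%:R * y k ^+ 2)))).
  rewrite mulr_ge0 ?expR_ge0 // mulr_ge0 ?progeny_ge0 // subr_ge0 -expR0 ler_expR oppr_le0.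
  by rewrite mulr_ge0 // ltW.
have [l hl _] : exists2 l, has_sum (fun k => w k * tail (y k ^+ 2)) l & l <= 5 * (1 - expR ((2 * s - 1) * ln 2))^-1.
  apply: (dominated_has_sum _ (has_sumZ (c := 5) (has_sum_geometric hr))) => k.
  rewrite mulr_ge0 ?expR_ge0 ?(ltW (tail_gt0 _)) //= -wy.
  by rewrite mulrCA ler_wpM2l ?expR_ge0 // tail_upper.
have [hcol hsum] := double_sum A0 rows hl.
suff hle n : 0 <= progeny n * expR (s * ln n%:R) <=
    4 * limn (series (fun k => w k * (progeny n * (1 - expR (- (n%:R * y k ^+ 2)))))).
  have [S hS _] := dominated_has_sum hle (has_sumZ (c := 4) hsum).
  by exists S.
rewrite mulr_ge0 ?progeny_ge0 ?expR_ge0 //=.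
case: n => [|n]; first by rewrite progeny0 mul0r mulr_ge0 // (has_sum_ge0 _ (hcol 0%N)).
(* a single term of the series over [k] controls the power of [n.+1] *)
pose k := trunc_log 4 n.+1.
have /andP[k1 k2] : (4 ^ k <= n.+1 < 4 ^ k.+1)%N by apply: trunc_log_bounds.
have ht := term_le k (fun k => A0 k n.+1) (hcol n.+1).
apply: le_trans (ler_wpM2l (_ : 0 <= 4) ht) => //.
have h1 : 1 <= n.+1%:R * y k ^+ 2.
  rewrite /y -exprM mulnC exprM.
  have -> : (2^-1 ^+ 2) ^+ k = (4 ^+ k)^-1 :> R.
    by rewrite -exprVn; congr (_ ^+ k); field.
  by rewrite ler_pdivlMr ?exprn_gt0 // mul1r -natrX ler_nat.
have h2 : 2^-1 <= 1 - expR (- (n.+1%:R * y k ^+ 2)).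
  have e1 : expR (- (n.+1%:R * y k ^+ 2)) <= expR (-1) by rewrite ler_expR lerN2.
  have e2 := expR_ge1Dx (1 : R).
  have e3 : expR (-1) <= 2^-1 :> R by rewrite expRN lef_pV2 ?posrE ?expR_gt0 //; lra.
  lra.
have h3 : expR (s * ln n.+1%:R) <= 2 * w k.
  have ln4 : 0 <= ln 4 :> R by rewrite ln_ge0 // ler1n.
  have : ln n.+1%:R <= k%:R * ln 4 + ln 4 :> R.
    rewrite -[X in _ <= _ + X]mul1r -mulrDl natr1 -ler_expR lnK ?posrE // expRM_natl lnK ?posrE //.
    by rewrite -natrX ler_nat ltnW.
  move=> h; apply: (@le_trans _ _ (expR (s * (k%:R * ln 4 + ln 4)))).
    by rewrite ler_expR ler_wpM2l.
  rewrite mulrDr expRD mulrC ler_wpM2r ?expR_ge0 //.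
  rewrite -[X in _ <= X](@lnK _ 2) ?posrE // ler_expR ln42 mulrCA mulrA.
  by rewrite ler_piMl ?ln_ge0 ?ler1n //; lra.
have p0 := @progeny_ge0 R n.+1.
have -> : 4 * (w k * (progeny n.+1 * (1 - expR (- (n.+1%:R * y k ^+ 2))))) =
  progeny n.+1 * (w k * 4 * (1 - expR (- (n.+1%:R * y k ^+ 2)))) by ring.
rewrite ler_wpM2l //; apply: le_trans h3 _.
have -> : 2 * w k = w k * 4 * 2^-1 by field.
by rewrite ler_wpM2l // mulr_ge0 // expR_ge0.
Qed.

Lemma progeny_moment s : s < 2^-1 ->
  exists S, has_sum (fun n => @progeny R n * expR (s * ln n%:R)) S.
Proof.
move=> s2; have h : 0 <= Num.max 0 s < 2^-1.
  by rewrite le_max lexx /= gt_max s2 andbT invr_gt0.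
have [S hS] := progeny_moment_pos h.
suff hle n : 0 <= @progeny R n * expR (s * ln n%:R) <= progeny n * expR (Num.max 0 s * ln n%:R).
  by have [S' hS' _] := dominated_has_sum hle hS; exists S'.
rewrite mulr_ge0 ?progeny_ge0 ?expR_ge0 //= ler_wpM2l ?progeny_ge0 // ler_expR.
by rewrite ler_wpM2r ?ln_nat_ge0 // le_max lexx orbT.
Qed.

End ProgenyMoments.

(** * Fourier transforms *)

Section FourierTransform.
Context {R : realType}.
Local Notation Re := complex.Re.
Local Notation Im := complex.Im.
Local Notation normc := (@Normc.normc R).
Implicit Types (f g b : R -> R) (s t c : R).

(** Fourier transform with kernel [expR (i s t)], given by its two coordinates.
    *)
Definition FT g s : CC R :=
  intR (fun t => cos (s * t) * g t) +i* intR (fun t => sin (s * t) * g t).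

Lemma continuous_sin_scale s : continuous (fun t : R => sin (s * t)).
Proof.
move=> t; apply: (@continuous_comp _ _ _ (fun t : R => s * t) sin).
  exact: mulrl_continuous.
exact: continuous_sin.
Qed.

Lemma measurable_cos_scale s : measurable_fun setT (fun t : R => cos (s * t)).
Proof. apply: continuous_measurable_fun; exact: continuous_cos_scale. Qed.

Lemma measurable_sin_scale s : measurable_fun setT (fun t : R => sin (s * t)).
Proof. apply: continuous_measurable_fun; exact: continuous_sin_scale. Qed.

Lemma measurable_cosM g s : measurable_fun setT g -> measurable_fun setT (fun t => cos (s * t) * g t).
Proof. by move=> mg; apply: measurable_funM => //; exact: measurable_cos_scale. Qed.

Lemma measurable_sinM g s : measurable_fun setT g -> measurable_fun setT (fun t => sin (s * t) * g t).
Proof. by move=> mg; apply: measurable_funM => //; exact: measurable_sin_scale. Qed.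

Lemma cosM_le s t (x : R) : `|cos (s * t) * x| <= `|x|.
Proof. by rewrite normrM ler_piMl // cos_max. Qed.

Lemma sinM_le s t (x : R) : `|sin (s * t) * x| <= `|x|.
Proof. by rewrite normrM ler_piMl // sin_max. Qed.

Lemma integrableR_cosM g s : integrableR g -> integrableR (fun t => cos (s * t) * g t).
Proof.
move=> hg; apply: (integrableR_le (g := fun t => `|g t|)).
- by apply: measurable_cosM; exact: (integrableR_measurable hg).
- exact: (integrable_norm hg).
- by move=> t; exact: cosM_le.
Qed.

Lemma integrableR_sinM g s : integrableR g -> integrableR (fun t => sin (s * t) * g t).
Proof.
move=> hg; apply: (integrableR_le (g := fun t => `|g t|)).
- by apply: measurable_sinM; exact: (integrableR_measurable hg).
- exact: (integrable_norm hg).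
- by move=> t; exact: sinM_le.
Qed.

Lemma FTD f g s : integrableR f -> integrableR g -> FT (fun t => f t + g t) s = FT f s + FT g s.
Proof.
move=> hf hg; apply: complex_eq; rewrite ?ReCD ?ImCD /=.
  rewrite -intRD; [|exact: integrableR_cosM|exact: integrableR_cosM].
  by congr intR; apply/funext => t; rewrite mulrDr.
rewrite -intRD; [|exact: integrableR_sinM|exact: integrableR_sinM].
by congr intR; apply/funext => t; rewrite mulrDr.
Qed.

Lemma FTZ c g s : integrableR g -> FT (fun t => c * g t) s = c%:C * FT g s.
Proof.
move=> hg; apply: complex_eq; rewrite ?ReCM ?ImCM /= mul0r ?subr0 ?addr0.
  rewrite -intRZ; last exact: integrableR_cosM.
  by congr intR; apply/funext => t; rewrite mulrCA.
rewrite -intRZ; last exact: integrableR_sinM.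
by congr intR; apply/funext => t; rewrite mulrCA.
Qed.

Lemma FT_norm_le g b s : measurable_fun setT g -> integrableR b -> (forall t, `|g t| <= b t) ->
  normc (FT g s) <= 2 * intR b.
Proof.
move=> mg hb gb; apply: le_trans (normc_le_ReIm _) _; rewrite mulr2n mulrDl !mul1r /=.
apply: lerD; apply: intR_norm_le => //; try by [exact: measurable_cosM|exact: measurable_sinM].
  by move=> t; exact: le_trans (cosM_le _ _ _) (gb t).
by move=> t; exact: le_trans (sinM_le _ _ _) (gb t).
Qed.

(** Differentiating the kernel in [s] costs a factor [t]. *)
Lemma FT_lip g b s s' : integrableR g -> integrableR b -> (forall t, `|t * g t| <= b t) ->
  normc (FT g s - FT g s') <= 2 * (`|s - s'| * intR b).
Proof.
move=> hg hb gb.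
have mg := integrableR_measurable hg.
have hbs := integrableRZ `|s - s'| hb.
have dom t (x y : R) : `|x - y| <= `|s * t - s' * t| -> `|x * g t - y * g t| <= `|s - s'| * b t.
  move=> xy; rewrite -mulrBl normrM.
  apply: le_trans (ler_wpM2r (normr_ge0 _) xy) _.
  by rewrite -mulrBl normrM -mulrA -normrM ler_wpM2l.
apply: le_trans (normc_le_ReIm _) _; rewrite mulr2n mulrDl !mul1r -intRZ //.
rewrite ReCD ImCD ReCN ImCN /=; apply: lerD.
  have -> : intR (fun t => cos (s * t) * g t) - intR (fun t => cos (s' * t) * g t) =
     intR (fun t => cos (s * t) * g t + -1 * (cos (s' * t) * g t)).
    rewrite intRD ?intRZ ?mulN1r //; try exact: integrableR_cosM.
    by apply: integrableRZ; exact: integrableR_cosM.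
  apply: intR_norm_le => //; last first.
    by move=> t; rewrite mulN1r; apply: dom; exact: cos_lip.
  apply: integrableR_measurable; apply: integrableRD; first exact: integrableR_cosM.
  by apply: integrableRZ; exact: integrableR_cosM.
have -> : intR (fun t => sin (s * t) * g t) - intR (fun t => sin (s' * t) * g t) =
   intR (fun t => sin (s * t) * g t + -1 * (sin (s' * t) * g t)).
  rewrite intRD ?intRZ ?mulN1r //; try exact: integrableR_sinM.
  by apply: integrableRZ; exact: integrableR_sinM.
apply: intR_norm_le => //; last first.
  by move=> t; rewrite mulN1r; apply: dom; exact: sin_lip.
apply: integrableR_measurable; apply: integrableRD; first exact: integrableR_sinM.
by apply: integrableRZ; exact: integrableR_sinM.
Qed.

Lemma FT_shift g c s : integrableR g ->
  FT (fun t => g (t - c)) s = Cexp (0 +i* (s * c)) * FT g s.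
Proof.
move=> hg.
have rE : Re (Cexp (0 +i* (s * c))) = cos (s * c) by rewrite Re_Cexp /= expR0 mul1r.
have iE : Im (Cexp (0 +i* (s * c))) = sin (s * c) by rewrite Im_Cexp /= expR0 mul1r.
apply: complex_eq.
  rewrite ReCM rE iE /=; rewrite -(intR_shift c); last by apply: integrableR_cosM; exact: (integrableR_shift (- c) hg).
  have e : (fun t => cos (s * (t + c)) * g (t + c - c)) =
      (fun t => cos (s * c) * (cos (s * t) * g t) + (- sin (s * c)) * (sin (s * t) * g t)).
    by apply/funext => t; rewrite addrK mulrDr cosD; ring.
  rewrite e intRD; [|by apply: integrableRZ; exact: integrableR_cosM|by apply: integrableRZ; exact: integrableR_sinM].
  by rewrite !intRZ ?mulNr //; [exact: integrableR_sinM|exact: integrableR_cosM].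
rewrite ImCM rE iE /= -(intR_shift c); last by apply: integrableR_sinM; exact: (integrableR_shift (- c) hg).
have e : (fun t => sin (s * (t + c)) * g (t + c - c)) =
    (fun t => cos (s * c) * (sin (s * t) * g t) + sin (s * c) * (cos (s * t) * g t)).
  by apply/funext => t; rewrite addrK mulrDr sinD; ring.
rewrite e intRD; [|by apply: integrableRZ; exact: integrableR_sinM|by apply: integrableRZ; exact: integrableR_cosM].
by rewrite !intRZ //; [exact: integrableR_cosM|exact: integrableR_sinM].
Qed.

Lemma cos_cvg (sn : nat -> R) s t : sn @ \oo --> s -> (fun n => cos (sn n * t)) @ \oo --> cos (s * t).
Proof.
move=> hs; have h : (fun n => sn n * t) @ \oo --> s * t by exact: cvgMl.
exact: (cvg_comp _ _ h (@continuous_cos R (s * t))).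
Qed.

(** The frequency is allowed to move with [n], as needed for the two
    frequencies compared below. *)
Lemma cos_transform_cvg (fn : nat -> R -> R) f b (sn : nat -> R) s :
  (forall n, measurable_fun setT (fn n)) -> integrableR b -> (forall n t, `|fn n t| <= b t) ->
  (forall t, fn ^~ t @ \oo --> f t) -> sn @ \oo --> s ->
  (fun n => intR (fun t => cos (sn n * t) * fn n t)) @ \oo --> intR (fun t => cos (s * t) * f t).
Proof.
move=> mfn hb fb fnf hs.
have [|||_ h] := @intR_dct R (fun n t => cos (sn n * t) * fn n t) (fun t => cos (s * t) * f t) b _ hb.
- by move=> n; exact: measurable_cosM.
- by move=> n t; exact: le_trans (cosM_le _ _ _) (fb n t).
- by move=> t; apply: cvgM => //; exact: cos_cvg.
exact: h.
Qed.

Lemma FT_cvg (fn : nat -> R -> R) f b s :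
  (forall n, measurable_fun setT (fn n)) -> integrableR b -> (forall n t, `|fn n t| <= b t) ->
  (forall t, fn ^~ t @ \oo --> f t) -> (fun n => FT (fn n) s) @ \oo --> FT f s.
Proof.
move=> mfn hb fb fnf; apply: ccvg_ReIm => /=.
  have [|||_ h] := @intR_dct R (fun n t => cos (s * t) * fn n t) (fun t => cos (s * t) * f t) b _ hb.
  - by move=> n; exact: measurable_cosM.
  - by move=> n t; exact: le_trans (cosM_le _ _ _) (fb n t).
  - by move=> t; apply: cvgMr.
  exact: h.
have [|||_ h] := @intR_dct R (fun n t => sin (s * t) * fn n t) (fun t => sin (s * t) * f t) b _ hb.
- by move=> n; exact: measurable_sinM.
- by move=> n t; exact: le_trans (sinM_le _ _ _) (fb n t).
- by move=> t; apply: cvgMr.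
exact: h.
Qed.

Lemma FT_sum (I : Type) (r : seq I) (F : I -> R -> R) s : (forall i, integrableR (F i)) ->
  integrableR (fun t => \sum_(i <- r) F i t) /\
  FT (fun t => \sum_(i <- r) F i t) s = \sum_(i <- r) FT (F i) s.
Proof.
move=> hF; elim: r => [|i r [IH1 IH2]].
  have -> : (fun t => \sum_(i <- [::]) F i t) = (fun=> 0) by apply/funext => t; rewrite big_nil.
  have h0 : integrableR (fun=> 0 : R).
    apply: (integrableR_le (g := expabs 1)) => //; first exact: integrableR_expabs.
    by move=> t; rewrite normr0 expR_ge0.
  split=> //; rewrite big_nil.
  have := FTD s h0 h0; rewrite (_ : (fun t => 0 + 0) = (fun=> 0)); last by apply/funext => t; rewrite addr0.
  by move=> /eqP; rewrite -subr_eq0 opprD addrA subrr add0r oppr_eq0 => /eqP.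
have e : (fun t => \sum_(j <- i :: r) F j t) = (fun t => F i t + \sum_(j <- r) F j t).
  by apply/funext => t; rewrite big_cons.
rewrite e; split; first exact: integrableRD.
by rewrite FTD // big_cons IH2.
Qed.

End FourierTransform.

(** * Decomposition into levels *)

Section ExpansionBound.
Context {R : realType}.

Lemma four_thirteenths : 4 * 13^-1 <= 2^-1 :> R.
Proof. by rewrite ler_pdivrMr ?ltr0n //; lra. Qed.

(** Solving the two functional equations for [a ^+ 2] and [b ^+ 2] gives [(rho
    a) ^+ 2 - b ^+ 2] up to the difference of the two values of [Bfun];
    division by [rho a + b] yields the main term. What remains has size [x ^
    (3/2)] before this division, and [rho a + b] is of the order of [y], the
    square root of [x]. *)
Lemma expansion_bound (rho a b Ba Bb x P P' y : R) :
  1 < rho -> rho <= 2 -> 0 < a -> a < 1 -> 0 < b -> b < 1 -> 0 < x -> x <= 13^-1 ->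
  0 < y -> y <= 3^-1 -> x = y ^+ 2 ->
  x <= P <= x + 2 * x ^+ 2 ->
  rho ^+ 2 * x <= P' <= rho ^+ 2 * x + 2 * (rho ^+ 2 * x) ^+ 2 ->
  a ^+ 2 * Ba = (1 - a) * P -> b ^+ 2 * Bb = (1 - b) * P' ->
  y / 2 <= a -> a <= 5 * y -> y / 2 <= b -> b <= 10 * y -> 10^-1 <= Ba ->
  `|(rho * a - b) + b ^+ 2 / (Ba * (rho * a + b)) * (Ba - Bb)| <= 1600 * x.
Proof.
move=> r1 r2 a0 a1 b0 b1 x0 xs y0 y1 xE /andP[gP hP] /andP[gP' hP'] ea eb h1 ua5 h2 ub5 hBa.
have r0 : 0 < rho by lra.
have Ba0 : 0 < Ba by lra.
have r4 : rho ^+ 2 <= 4.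
  by have -> : 4 = 2 ^+ 2 :> R; [ring|rewrite lerXn2r ?nnegrE ?(ltW r0)].
pose x' := rho ^+ 2 * x; rewrite -/x' in gP' hP'.
have x'0 : 0 < x' by rewrite mulr_gt0 // exprn_gt0.
have x'4 : x' <= 4 * x by rewrite /x' ler_wpM2r // ltW.
pose Rm := rho ^+ 2 * (1 - a) * P - (1 - b) * P'.
have d0 : 0 < rho * a + b by rewrite addr_gt0 // mulr_gt0.
have kE : (rho * a - b) + b ^+ 2 / (Ba * (rho * a + b)) * (Ba - Bb) = Rm / (Ba * (rho * a + b)).
  apply: (@mulIf _ (Ba * (rho * a + b))); first by rewrite mulf_neq0 // gt_eqF.
  rewrite divfK ?mulf_neq0 ?gt_eqF // mulrDl.
  have -> : b ^+ 2 / (Ba * (rho * a + b)) * (Ba - Bb) * (Ba * (rho * a + b)) = b ^+ 2 * (Ba - Bb).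
    by field; rewrite !gt_eqF.
  have -> : (rho * a - b) * (Ba * (rho * a + b)) = rho ^+ 2 * (a ^+ 2 * Ba) - b ^+ 2 * Ba.
    by ring.
  by rewrite ea /Rm -eb; ring.
rewrite kE normrM [`|_^-1|]ger0_norm; last by rewrite invr_ge0 mulr_ge0 // ltW.
rewrite ler_pdivrMr ?mulr_gt0 //.
have xx : 0 <= x ^+ 2 by rewrite sqr_ge0.
have x'x' : x' ^+ 2 <= 16 * x ^+ 2.
  have -> : 16 * x ^+ 2 = (4 * x) ^+ 2 by ring.
  by rewrite lerXn2r // nnegrE ?mulr_ge0 // ltW.
have yx : x ^+ 2 <= y * x.
  rewrite expr2 ler_wpM2r ?(ltW x0) // xE expr2 ler_piMr ?(ltW y0) //; lra.
have P2 : P <= 2 * x.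
  have : x * x <= x * 13^-1 by rewrite ler_wpM2l ?(ltW x0).
  by rewrite -expr2 => h; lra.
have P'2 : P' <= 8 * x.
  have : x * x <= x * 13^-1 by rewrite ler_wpM2l ?(ltW x0).
  by rewrite -expr2 => h; lra.
have P0 : 0 <= P by lra.
have P'0 : 0 <= P' by lra.
have aP : a * P <= 10 * (y * x).
  have -> : 10 * (y * x) = (5 * y) * (2 * x) by ring.
  by apply: ler_pM => //; exact: ltW.
have bP : b * P' <= 80 * (y * x).
  have -> : 80 * (y * x) = (10 * y) * (8 * x) by ring.
  by apply: ler_pM => //; exact: ltW.
have aP0 : 0 <= a * P by rewrite mulr_ge0 // ltW.
have bP0 : 0 <= b * P' by rewrite mulr_ge0 // ltW.
have raP : rho ^+ 2 * (a * P) <= 4 * (a * P) by rewrite ler_wpM2r.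
have raP0 : 0 <= rho ^+ 2 * (a * P) by rewrite mulr_ge0 // sqr_ge0.
have rP : rho ^+ 2 * P <= x' + 2 * (rho ^+ 2 * x ^+ 2).
  have := ler_wpM2l (sqr_ge0 rho) hP.
  by rewrite /x'; have -> : rho ^+ 2 * (x + 2 * x ^+ 2) = rho ^+ 2 * x + 2 * (rho ^+ 2 * x ^+ 2) by ring.
have rP0 : x' <= rho ^+ 2 * P by rewrite /x' ler_wpM2l // sqr_ge0.
have rx : rho ^+ 2 * x ^+ 2 <= 4 * x ^+ 2 by rewrite ler_wpM2r.
have RmE : Rm = (rho ^+ 2 * P - P') - rho ^+ 2 * (a * P) + b * P' by rewrite /Rm; ring.
have hR : `|Rm| <= 160 * (y * x).
  rewrite ler_norml RmE; clear - xx x'x' yx aP bP aP0 bP0 raP raP0 rP rP0 rx gP' hP'.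
  by apply/andP; split; lra.
apply: le_trans hR _.
have hd : 10^-1 * y <= Ba * (rho * a + b).
  apply: ler_pM => //; first exact: ltW.
  have : 1 * a <= rho * a by rewrite ler_wpM2r ?(ltW a0) // ltW.
  by move=> h; lra.
have h3 := ler_wpM2l (ltW x0) hd.
have -> : 160 * (y * x) = 1600 * (x * (10^-1 * y)) by field.
by rewrite -mulrA; exact: (ler_wpM2l (ler0n _ 1600)).
Qed.

Lemma add_bound_2600 (A B C D : R) : A <= 1600 * D -> B <= 1000 * C -> D <= C ->
  A + B <= 2600 * C.
Proof. by move=> h1 h2 h4; lra. Qed.

Lemma regroup_level (k g d a s : R) :
  k + g * d + g * (a - (s + d)) = k + g * a - g * s.
Proof. by ring. Qed.

End ExpansionBound.

Section Decomposition.
Local Arguments scale : simpl never.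
Context {R : realType}.
Variable rho : R.
Hypothesis rho1 : 1 < rho.
Hypothesis rho2 : rho <= 2.
Implicit Types (t : R) (J : nat).

(** The Laplace tail in the logarithmic variable [t = - ln x]. *)
Definition ua t : R := tail (expR (- t)).
Definition ub t : R := tail (rho ^+ 2 * expR (- t)).

(** The leading behaviour of [ua] is [expR (- t / 2)] and that of [ub] is [rho]
    times this, so the two cancel. *)
Definition kappa t : R := rho * ua t - ub t.

(** The factor that converts a variation of [Bfun] into a variation of [kappa],
    see [kappa_expansion]. *)
Definition gain t : R := ub t ^+ 2 / (Bfun (ua t) * (rho * ua t + ub t)).

(** The part of the variation of [Bfun] that is due to level [J]. *)
Definition Bdrop J t : R := weight J * (geomS (ua t * scale J) - geomS (ub t * scale J)).

(** The contribution of level [J] to [kappa]. The expansion holds for small [x]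
    only, hence the threshold, which is the same in [high]. *)
Definition level J t : R := if 4 <= t then gain t * Bdrop J t else 0.

(** The contribution of all the levels above [J]. *)
Definition high J t : R := if 4 <= t then
  gain t * (Bfun (ua t) - Bfun (ub t) - \sum_(0 <= j < J.+1) Bdrop j t) else 0.

(** Defined as what is left, hence the signs: level [J] and the higher ones
    enter [kappa] with a negative sign. It collects the levels below [J] and
    the error of the expansion. *)
Definition low J t : R := kappa t + level J t + high J t.

Let rho0 : 0 < rho. Proof. exact: lt_trans ltr01 rho1. Qed.

Let y t : R := expR (- (t / 2)).

Let y_gt0 t : 0 < y t. Proof. exact: expR_gt0. Qed.

Let yy t : y t ^+ 2 = expR (- t).
Proof. by rewrite /y expr2 -expRD; congr expR; field. Qed.

Let ry t : (rho * y t) ^+ 2 = rho ^+ 2 * expR (- t).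
Proof. by rewrite exprMn yy. Qed.

Lemma ua_gt0 t : 0 < ua t. Proof. exact/tail_gt0/expR_gt0. Qed.
Lemma ua_lt1 t : ua t < 1. Proof. exact/tail_lt1/expR_gt0. Qed.
Lemma ub_gt0 t : 0 < ub t.
Proof. by apply: tail_gt0; rewrite mulr_gt0 ?exprn_gt0 ?expR_gt0. Qed.
Lemma ub_lt1 t : ub t < 1.
Proof. by apply: tail_lt1; rewrite mulr_gt0 ?exprn_gt0 ?expR_gt0. Qed.

Lemma ua_le t : ua t <= 5 * expR (- (t / 2)).
Proof. by rewrite /ua -(yy t); exact: tail_upper. Qed.

Lemma ub_le t : ub t <= 10 * expR (- (t / 2)).
Proof.
rewrite /ub -(ry t); apply: le_trans (tail_upper _) _; first by rewrite mulr_gt0.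
by have r2 := rho2; rewrite mulrA ler_wpM2r // ?expR_ge0 //; lra.
Qed.

Lemma ua_le_ub t : ua t <= ub t.
Proof.
have r1 := rho1.
apply: tail_mono; first exact: expR_gt0.
rewrite ler_peMl ?expR_ge0 // expr2.
have : 1 * 1 <= rho * rho by apply: ler_pM; lra.
lra.
Qed.

Let y_small t : 4 <= t -> y t ^+ 2 <= 13^-1.
Proof.
move=> t4; rewrite yy expRN lef_pV2 ?posrE ?expR_gt0 //.
have h := @expR_ge1Dxn R 4 1 (ler0n _ 4).
apply: (@le_trans _ _ (expR 4)); last by rewrite ler_expR.
have h2 := @expR_ge1Dxn R 2 1 (ler0n _ 2).
have e : expR 4 = expR 2 * expR 2 :> R by rewrite -expRD; congr expR; ring.
have h3 : 1 + 2 ^+ 2 / 2 = 3 :> R by field.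
have h3' : 2`!%:R = 2 :> R by [].
rewrite h3' h3 in h2.
have h4 := expR_ge1Dx (2 : R).
have h5 : 3 * 3 <= expR 2 * expR 2 :> R by rewrite ler_pM.
have h6 : 1 + 4 ^+ 2 / 2 = 9 :> R by field.
have h7 := expR_ge1Dx (1 : R).
have e2 : expR 4 = expR 1 ^+ 4 :> R by rewrite -expRM_natl; congr expR; ring.
have h8 : 2 ^+ 4 <= expR 1 ^+ 4 :> R.
  by rewrite lerXn2r // ?nnegrE ?expR_ge0 //; lra.
rewrite e2; apply: le_trans h8.
have -> : 2 ^+ 4 = 16 :> R by ring.
lra.
Qed.

Let y_le1 t : 4 <= t -> y t <= 3^-1.
Proof.
move=> /y_small h; rewrite leNgt; apply/negP => h2.
have : 3^-1 * 3^-1 <= y t * y t by apply: ler_pM; rewrite ?invr_ge0 // ltW.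
rewrite -expr2; lra.
Qed.

Lemma ua_ge t : 4 <= t -> expR (- (t / 2)) / 2 <= ua t.
Proof.
move=> t4; rewrite /ua -(yy t) -/(y t); apply: tail_lower; rewrite y_gt0 /=.
by have := y_le1 t4; lra.
Qed.

Lemma ub_ge t : 4 <= t -> expR (- (t / 2)) / 2 <= ub t.
Proof. by move=> t4; apply: le_trans (ua_ge t4) (ua_le_ub t). Qed.

Lemma Bua_ge t : 10^-1 <= Bfun (ua t).
Proof. by apply: Bfun_ge; rewrite !ltW ?ua_gt0 ?ua_lt1. Qed.

Let Bua_gt0 t : 0 < Bfun (ua t).
Proof. by apply: lt_le_trans (Bua_ge t); rewrite invr_gt0. Qed.

Let den_gt0 t : 0 < rho * ua t + ub t.
Proof. by rewrite addr_gt0 ?ub_gt0 // mulr_gt0 ?ua_gt0. Qed.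

Lemma gain_ge0 t : 0 <= gain t.
Proof. by rewrite divr_ge0 ?sqr_ge0 // mulr_ge0 // ltW. Qed.

Lemma gain_le t : gain t <= 10 * ub t.
Proof.
rewrite ler_pdivrMr ?mulr_gt0 //.
have h := Bua_ge t; have u0 := ub_gt0 t; have d0 := den_gt0 t.
have : ub t * (10^-1 * ub t) <= ub t * (Bfun (ua t) * (rho * ua t + ub t)).
  rewrite ler_wpM2l ?(ltW u0) // ler_pM ?(ltW u0) ?invr_ge0 // lerDr mulr_ge0 ?(ltW rho0) //.
  exact/ltW/ua_gt0.
have -> : ub t * (10^-1 * ub t) = 10^-1 * ub t ^+ 2 by ring.
lra.
Qed.

Lemma gain_le_exp t : gain t <= 100 * expR (- (t / 2)).
Proof. by have := gain_le t; have := ub_le t; lra. Qed.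

(** The variation of [Bfun] between [ua t] and [ub t] determines [kappa t] up
    to a term of the order of [x = expR (- t)], while [kappa] itself is of the
    order of the square root of [x] at the levels. *)
Lemma kappa_expansion t : 4 <= t ->
  `|kappa t + gain t * (Bfun (ua t) - Bfun (ub t))| <= 1600 * expR (- t).
Proof.
move=> t4.
have [_ a0 a1 ea] := tail_eq (expR_gt0 (- t)).
have x'0 : 0 < rho ^+ 2 * expR (- t) by rewrite mulr_gt0 ?exprn_gt0 ?expR_gt0.
have [_ b0 b1 eb] := tail_eq x'0.
have ys := y_small t4; rewrite yy in ys.
have h13 : 13^-1 <= 2^-1 :> R by rewrite lef_pV2 ?posrE ?ltr0n // ler_nat.
have hx2 : 0 <= expR (- t) <= 2^-1 by rewrite expR_ge0 /= (le_trans ys).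
have r4 : rho ^+ 2 <= 4.
  by have -> : 4 = 2 ^+ 2 :> R; [ring|rewrite lerXn2r ?nnegrE ?(ltW rho0)].
have h413 := @four_thirteenths R.
have hx2' : 0 <= rho ^+ 2 * expR (- t) <= 2^-1.
  rewrite (ltW x'0) /=; apply: le_trans h413.
  by apply: ler_pM; rewrite ?sqr_ge0 ?expR_ge0.
have hP := expRB1_le hx2; have hP' := expRB1_le hx2'.
have gP := expR_ge1Dx (expR (- t)); have gP' := expR_ge1Dx (rho ^+ 2 * expR (- t)).
apply: (@expansion_bound R rho (ua t) (ub t) (Bfun (ua t)) (Bfun (ub t)) (expR (- t))
  (expR (expR (- t)) - 1) (expR (rho ^+ 2 * expR (- t)) - 1) (y t)) => //.
- exact: expR_gt0.
- exact: y_le1.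
- by rewrite hP andbT lerBrDl.
- by rewrite hP' andbT lerBrDl.
- exact: ua_ge.
- exact: ua_le.
- exact: ub_ge.
- exact: ub_le.
- exact: Bua_ge.
Qed.

Lemma geomS_anti (p p' : R) : 0 <= p -> p <= p' -> geomS p' <= geomS p.
Proof. by move=> p0 pp; rewrite /geomS lef_pV2 ?posrE ?lerD2l // ltr_pwDl // (le_trans p0). Qed.

Lemma geomS_ge0 (p : R) : 0 <= p -> 0 <= geomS p.
Proof. by move=> p0; rewrite /geomS invr_ge0 addr_ge0. Qed.

Lemma geomS_le1 (p : R) : 0 <= p -> geomS p <= 1.
Proof. by move=> p0; rewrite /geomS invf_le1 ?ltr_pwDl // lerDl. Qed.

Lemma geomS_le_inv (p : R) : 0 < p -> geomS p <= p^-1.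
Proof. by move=> p0; rewrite /geomS lef_pV2 ?posrE ?ltr_pwDl ?(ltW p0) // lerDr. Qed.

Lemma geomS_ge1B (p : R) : 0 <= p -> 1 - p <= geomS p.
Proof.
move=> p0; rewrite /geomS -[_^-1]mul1r ler_pdivlMr ?ltr_pwDl //.
have -> : (1 - p) * (1 + p) = 1 - p ^+ 2 by ring.
by rewrite gerBl sqr_ge0.
Qed.

Let aM_ge0 t j : 0 <= ua t * scale j.
Proof. by rewrite mulr_ge0 // ltW ?ua_gt0 ?scale_gt0. Qed.

Let ab_M t j : ua t * scale j <= ub t * scale j.
Proof. by rewrite ler_wpM2r ?ua_le_ub // ltW // scale_gt0. Qed.

Lemma Bdrop_ge0 t j : 0 <= Bdrop j t.
Proof. by rewrite mulr_ge0 ?weight_ge0 // subr_ge0 geomS_anti. Qed.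

Lemma Bdrop_le t j : Bdrop j t <= weight j * (ub t * scale j).
Proof.
rewrite ler_wpM2l ?weight_ge0 //.
have h1 := geomS_le1 (aM_ge0 t j).
have h2 := geomS_ge1B (le_trans (aM_ge0 t j) (ab_M t j)).
lra.
Qed.

Lemma Bdrop_le_geomS t j : Bdrop j t <= weight j * geomS (ua t * scale j).
Proof.
rewrite ler_wpM2l ?weight_ge0 // gerBl geomS_ge0 //.
exact: le_trans (aM_ge0 t j) (ab_M t j).
Qed.

Lemma has_sum_Bdrop t : has_sum (Bdrop ^~ t) (Bfun (ua t) - Bfun (ub t)).
Proof.
have := has_sumB (has_sum_B (ltW (ua_gt0 t))) (has_sum_B (ltW (ub_gt0 t))).
rewrite (_ : (fun j => weight j / _ - _) = Bdrop ^~ t) //.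
by apply/funext => j; rewrite /Bdrop /geomS mulrBr.
Qed.

(** [geomS] is 1-Lipschitz, so a level [j <= J] varies by at most [weight j *
    ub t * scale J]. *)
Lemma psum_Bdrop_le t J : series (Bdrop ^~ t) J.+1 <= ub t * scale J.
Proof.
apply: (@le_trans _ _ (ub t * scale J * series weight J.+1)); last first.
  rewrite psum_weight ler_piMr ?gerBl ?exprn_ge0 ?invr_ge0 //.
  by rewrite mulr_ge0 // ltW ?ub_gt0 ?scale_gt0.
rewrite /series /= mulr_sumr !big_mkord; apply: ler_sum => j _.
apply: le_trans (Bdrop_le t j) _; rewrite mulrC ler_wpM2r ?weight_ge0 //.
rewrite ler_wpM2l ?(ltW (ub_gt0 t)) // scale_mono // -ltnS; exact: ltn_ord.
Qed.

(** The weights beyond [J] sum up to [weight J]. *)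
Lemma has_sum_tail_bound (f : nat -> R) l c J : has_sum f l ->
  (forall j, (J < j)%N -> 0 <= f j <= c * weight j) ->
  0 <= l - series f J.+1 <= c * weight J.
Proof.
move=> hf hc.
pose trunc (g : nat -> R) j := if (j < J.+1)%N then g j else 0.
have trunc_sum g : has_sum (trunc g) (series g J.+1).
  have -> : series g J.+1 = series (trunc g) J.+1.
    rewrite /series /= !big_mkord; apply: eq_bigr => j _.
    by rewrite /trunc ltn_ord.
  by apply: has_sum_finite => n Jn; rewrite /trunc ltnNge Jn.
have h1 := has_sumB hf (trunc_sum f).
have h2 := has_sumZ (c := c) (has_sumB (@has_sum_weight R) (trunc_sum weight)).
rewrite psum_weight in h2.
have e : 1 - (1 - 2^-1 ^+ J.+1) = weight J :> R by rewrite opprB addrC subrK.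
rewrite e in h2; apply/andP; split.
  apply: has_sum_ge0 h1 => j; rewrite /trunc; case: ltnP => [_|h]; first by rewrite subrr.
  by rewrite subr0; case/andP: (hc j h).
apply: has_sum_le h1 h2 _ => j; rewrite /trunc; case: ltnP => [_|h]; first by rewrite !subrr mulr0.
by rewrite !subr0; case/andP: (hc j h).
Qed.

(** Each level above [J] contributes at most [geomS (ua t * scale J.+1)] times
    its weight. *)
Lemma high_core t J : 0 <= Bfun (ua t) - Bfun (ub t) - series (Bdrop ^~ t) J.+1 <=
  geomS (ua t * scale J.+1) * weight J.
Proof.
apply: has_sum_tail_bound; first exact: has_sum_Bdrop.
move=> j Jj; rewrite Bdrop_ge0 andTb; apply: le_trans (Bdrop_le_geomS t j) _.
rewrite [leLHS]mulrC; apply: ler_wpM2r; first exact: weight_ge0.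
apply: geomS_anti; first exact: aM_ge0.
by rewrite ler_wpM2l ?(ltW (ua_gt0 t)) // scale_mono.
Qed.

(** The levels below [J.+1] vary by at most [ub t * scale J], and [gain t] is
    of the order of [expR (- t / 2)] just as [ub t]: their product is of the
    order of [expR (- t)], and so is the error of the expansion. *)
Lemma low_ge4 t J : 4 <= t -> `|low J.+1 t| <= 2600 * scale J * expR (- t).
Proof.
move=> t4; rewrite /low /level /high t4.
have -> : kappa t + gain t * Bdrop J.+1 t + gain t * (Bfun (ua t) - Bfun (ub t) - \sum_(0 <= j < J.+2) Bdrop j t) =
  (kappa t + gain t * (Bfun (ua t) - Bfun (ub t))) - gain t * series (Bdrop ^~ t) J.+1.
  by rewrite (@big_nat_recr _ _ _ J.+1 0) //; exact: regroup_level.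
apply: le_trans (ler_normB _ _) _.
have h1 := kappa_expansion t4.
have s0 : 0 <= series (Bdrop ^~ t) J.+1.
  by rewrite /series /= sumr_ge0 // => j _; exact: Bdrop_ge0.
rewrite [`|gain t * _|]ger0_norm; last by rewrite mulr_ge0 ?gain_ge0.
have h2 : gain t * series (Bdrop ^~ t) J.+1 <= (100 * y t) * (10 * y t * scale J).
  apply: ler_pM => //; [exact: gain_ge0|exact: gain_le_exp|].
  apply: le_trans (psum_Bdrop_le t J) _.
  by rewrite ler_wpM2r ?ub_le // ltW // scale_gt0.
have h3 : (100 * y t) * (10 * y t * scale J) = 1000 * (scale J * expR (- t)).
  by rewrite -(yy t); ring.
rewrite h3 in h2.
have h4 : 1 * expR (- t) <= scale J * expR (- t).
  rewrite ler_wpM2r ?expR_ge0 //; have := @scale_ge4 R J; lra.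
rewrite mul1r in h4; rewrite -mulrA; exact: add_bound_2600 h1 h2 h4.
Qed.

End Decomposition.

(** * Measurability and weighted bounds *)

Section Bounds.
Context {R : realType}.
Local Arguments scale : simpl never.

(** Through [expR] and [ln], which are known to be measurable. *)
Lemma measurable_inv_pos (f : R -> R) : measurable_fun setT f -> (forall t, 0 < f t) ->
  measurable_fun setT (fun t => (f t)^-1).
Proof.
move=> mf f0; have -> : (fun t => (f t)^-1) = (fun t => expR (- ln (f t))).
  by apply/funext => t; rewrite expRN lnK // posrE.
apply: (measurableT_comp (@measurable_expR R)); apply: measurable_funN.
exact: (measurableT_comp (@measurable_ln R)).
Qed.

Lemma expRN1_le : expR (- 1) <= 2^-1 :> R.
Proof.
rewrite expRN lef_pV2 ?posrE ?expR_gt0 //.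
by have := expR_ge1Dx (1 : R); lra.
Qed.

Lemma log_bound (e t l m : R) : 0 <= e -> - (t / 2) - 1 <= l ->
  - (e * (l + m)) <= e * (t / 2 + 1) - e * m.
Proof. by move=> e0 h; have := ler_wpM2l e0 h; lra. Qed.

Lemma Bfun_anti (u v : R) : 0 <= u -> u <= v -> Bfun v <= Bfun u.
Proof.
move=> u0 uv; apply: has_sum_le (has_sum_B (le_trans u0 uv)) (has_sum_B u0) _ => j.
rewrite ler_wpM2l ?weight_ge0 //; apply: (@geomS_anti R (u * scale j)).
  by rewrite mulr_ge0 // ltW // scale_gt0.
by rewrite ler_wpM2r // ltW // scale_gt0.
Qed.

Variable rho : R.
Hypothesis rho1 : 1 < rho.
Hypothesis rho2 : rho <= 2.
Implicit Types (t : R) (J : nat).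

Let rho0 : 0 < rho. Proof. exact: lt_trans ltr01 rho1. Qed.

Let ua_anti : {homo (ua : R -> R) : s t / s <= t >-> t <= s}.
Proof. by move=> s t st; apply: tail_mono; rewrite ?expR_gt0 // ler_expR lerN2. Qed.

Let ub_anti : {homo (ub rho) : s t / s <= t >-> t <= s}.
Proof.
move=> s t st; apply: tail_mono; first by rewrite mulr_gt0 ?expR_gt0 ?exprn_gt0.
by rewrite ler_wpM2l ?sqr_ge0 // ler_expR lerN2.
Qed.

Lemma measurable_ua : measurable_fun setT (ua : R -> R).
Proof. exact: (nonincreasing_measurable measurableT ua_anti). Qed.

Lemma measurable_ub : measurable_fun setT (ub rho).
Proof. exact: (nonincreasing_measurable measurableT ub_anti). Qed.

Lemma measurable_Bua : measurable_fun setT (fun t : R => Bfun (ua t)).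
Proof.
have h : nondecreasing_fun (fun t : R => Bfun (ua t)).
  by move=> s t st; apply: Bfun_anti; [exact/ltW/ua_gt0|exact: ua_anti].
exact: (nondecreasing_measurable measurableT h).
Qed.

Lemma measurable_Bub : measurable_fun setT (fun t : R => Bfun (ub rho t)).
Proof.
have h : nondecreasing_fun (fun t : R => Bfun (ub rho t)).
  by move=> s t st; apply: Bfun_anti; [exact/ltW/ub_gt0|exact: ub_anti].
exact: (nondecreasing_measurable measurableT h).
Qed.

Lemma measurable_kappa : measurable_fun setT (kappa rho).
Proof.
apply: measurable_funB; last exact: measurable_ub.
by apply: measurable_funM => //; exact: measurable_ua.
Qed.

Lemma measurable_gain : measurable_fun setT (gain rho).
Proof.
apply: measurable_funM; first by apply: measurable_funX; exact: measurable_ub.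
apply: measurable_inv_pos; last first.
  move=> t; rewrite mulr_gt0 //; last by rewrite addr_gt0 ?ub_gt0 // mulr_gt0 ?ua_gt0.
  by apply: lt_le_trans (Bua_ge t); rewrite invr_gt0.
apply: measurable_funM; first exact: measurable_Bua.
apply: measurable_funD; last exact: measurable_ub.
by apply: measurable_funM => //; exact: measurable_ua.
Qed.

Lemma measurable_Bdrop J : measurable_fun setT (Bdrop rho J).
Proof.
have s0 : 0 < scale J :> R by exact: scale_gt0.
apply: measurable_funM => //; apply: measurable_funB.
  apply: measurable_inv_pos; last by move=> t; rewrite addr_gt0 // mulr_gt0 ?ua_gt0.
  apply: measurable_funD => //.
  by apply: measurable_funM => //; exact: measurable_ua.
apply: measurable_inv_pos; last by move=> t; rewrite addr_gt0 // mulr_gt0 ?ub_gt0.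
apply: measurable_funD => //.
by apply: measurable_funM => //; exact: measurable_ub.
Qed.

Let measurable_late (f : R -> R) : measurable_fun setT f ->
  measurable_fun setT (fun t => if 4 <= t then f t else 0).
Proof.
move=> mf; apply: measurable_fun_ifT => //.
exact: measurable_fun_ler.
Qed.

Lemma measurable_level J : measurable_fun setT (level rho J).
Proof.
apply: measurable_late; apply: measurable_funM; [exact: measurable_gain|exact: measurable_Bdrop].
Qed.

Lemma measurable_high J : measurable_fun setT (high rho J).
Proof.
apply: measurable_late; apply: measurable_funM; first exact: measurable_gain.
apply: measurable_funB.
  by apply: measurable_funB; [exact: measurable_Bua|exact: measurable_Bub].
by apply: measurable_sum => j; exact: measurable_Bdrop.
Qed.

Lemma measurable_low J : measurable_fun setT (low rho J).
Proof.
apply: measurable_funD; last exact: measurable_high.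
by apply: measurable_funD; [exact: measurable_kappa|exact: measurable_level].
Qed.

Lemma measurable_expM s (f : R -> R) : measurable_fun setT f ->
  measurable_fun setT (fun t => expR (s * t) * f t).
Proof.
move=> mf; apply: measurable_funM => //.
apply: (measurableT_comp (@measurable_expR R)).
exact: measurable_funM.
Qed.

Lemma kappa_le3 t : `|kappa rho t| <= 3.
Proof.
have r2 := rho2; have u0 := ua_gt0 t; have u1 := ua_lt1 t.
have v0 := ub_gt0 rho1 t; have v1 := ub_lt1 rho1 t.
apply: le_trans (ler_normB _ _) _.
rewrite ger0_norm ?mulr_ge0 ?(ltW rho0) ?(ltW u0) // ger0_norm ?(ltW v0) //.
have : rho * ua t <= 2 * 1 by apply: ler_pM => //; exact: ltW.
lra.
Qed.

(** At [+oo] the weight nearly compensates the decay [expR (- t / 2)] of the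
    tails, up to [expR (- e * t)]; at [-oo] the tails are bounded and the
    weight decays. *)
Lemma kappa_weighted s e t : s = 2^-1 - e -> 0 < e -> e <= s ->
  expR (s * t) * (rho * ua t + ub rho t) <= 20 * expabs e t.
Proof.
move=> sE e0 es; rewrite /expabs.
have u0 := ua_gt0 t; have v0 := ub_gt0 rho1 t.
have [t0|t0] := leP 0 t.
  rewrite ger0_norm //.
  have h : rho * ua t + ub rho t <= 20 * expR (- (t / 2)).
    have -> : 20 * expR (- (t / 2)) = 2 * (5 * expR (- (t / 2))) + 10 * expR (- (t / 2)) by ring.
    apply: lerD; last exact: ub_le.
    by apply: ler_pM; rewrite ?(ltW rho0) ?(ltW u0) // ua_le.
  apply: le_trans (ler_wpM2l (expR_ge0 _) h) _.
  by rewrite mulrCA -expRD sE ler_wpM2l // ler_expR; lra.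
rewrite ltr0_norm // mulrN opprK [leLHS]mulrC; apply: ler_pM.
- by rewrite addr_ge0 ?mulr_ge0 ?(ltW rho0) ?(ltW u0) ?(ltW v0).
- exact: expR_ge0.
- have : rho * ua t <= 2 * 1 by apply: ler_pM; rewrite ?(ltW rho0) ?(ltW u0) // ltW // ua_lt1.
  have := ub_lt1 rho1 t; lra.
have h : s * t <= e * t by rewrite ler_nM2r.
by rewrite ler_expR.
Qed.

(** Uniform in the weight up to [s = 1 / 2], because the decay for [t >= 4] is
    [expR (- t)]. *)
Lemma low_weighted s J t : 4^-1 <= s -> s <= 2^-1 ->
  `|expR (s * t) * low rho J.+1 t| <= (2600 + 3 * expR 3) * scale J * expabs 4^-1 t.
Proof.
move=> s1 s2; rewrite normrM [`|expR _|]ger0_norm ?expR_ge0 // /expabs.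
have M4 : 4 <= scale J :> R := scale_ge4 J.
have [t4|t4] := leP 4 t.
  apply: le_trans (ler_wpM2l (expR_ge0 _) (low_ge4 rho1 rho2 J t4)) _.
  rewrite mulrCA -expRD; apply: ler_pM; [|exact: expR_ge0| |].
  - by rewrite mulr_ge0 ?ler0n // ltW // scale_gt0.
  - by rewrite ler_wpM2r ?(ltW (scale_gt0 J)) // lerDl mulr_ge0 ?expR_ge0 ?ler0n.
  have h : s * t <= 2^-1 * t by rewrite ler_wpM2r //; lra.
  by rewrite ler_expR ger0_norm; lra.
have -> : low rho J.+1 t = kappa rho t.
  by rewrite /low /level /high leNgt t4 !addr0.
apply: le_trans (ler_wpM2l (expR_ge0 _) (kappa_le3 t)) _.
have h : expR (s * t) <= expR 3 * expR (- (4^-1 * `|t|)).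
  rewrite -expRD ler_expR; have [t0|t0] := leP 0 t.
    rewrite ger0_norm //; have : s * t <= 2^-1 * t by rewrite ler_wpM2r //; lra.
    lra.
  rewrite ltr0_norm //; have : s * t <= 4^-1 * t by rewrite ler_nM2r.
  lra.
rewrite mulrC; apply: le_trans (ler_wpM2l (ler0n _ 3) h) _; rewrite mulrA ler_wpM2r ?expR_ge0 //.
have e3 : 0 <= 3 * expR 3 :> R by rewrite mulr_ge0 ?expR_ge0 ?ler0n.
apply: (@le_trans _ _ (2600 + 3 * expR 3)); first by rewrite lerDr ler0n.
have M1 : 1 <= scale J :> R by lra.
by rewrite ler_peMr; [|exact: addr_ge0 (ler0n _ _) e3|exact: M1].
Qed.

(** Here [geomS p <= expR (- e * ln p)] interpolates between [geomS p <= 1] and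
    [geomS p <= p^-1]. With [p] at least [expR (- t / 2) * scale J.+1 / 2], the
    power [e] trades half of the decay [expR (- e * t)] for the factor [expR (-
    e * ln (scale J.+1))], which is tiny. *)
Lemma high_weighted s e J t : s = 2^-1 - e -> 0 < e -> e <= 1 ->
  `|expR (s * t) * high rho J t| <=
  100 * expR 1 * weight J * expR (- (e * scale J ^+ 2)) * expabs (e / 2) t.
Proof.
move=> sE e0 e1; rewrite normrM [`|expR _|]ger0_norm ?expR_ge0 // /high.
have w0 : 0 <= weight J :> R := weight_ge0 J.
case: ifP => t4; last by rewrite normr0 mulr0 !mulr_ge0 // ?expR_ge0.
have /andP[c0 c1] := high_core rho1 t J.
rewrite [`|_ * _|]ger0_norm; last by rewrite mulr_ge0 ?gain_ge0.
have S0 := @scale_gt0 R J.+1; have u0 := ua_gt0 t.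
have p0 : 0 < ua t * scale J.+1 :> R by rewrite mulr_gt0.
have gE : geomS (ua t * scale J.+1) <= expR (- (e * ln (ua t * scale J.+1))).
  have [l0|l0] := leP 0 (ln (ua t * scale J.+1)).
    apply: le_trans (geomS_le_inv p0) _.
    rewrite -[X in X^-1 <= _](lnK p0) -expRN ler_expR lerN2.
    by rewrite ler_piMl.
  apply: le_trans (geomS_le1 (ltW p0)) _.
  by rewrite -expR0 ler_expR oppr_ge0 pmulr_rle0 // ltW.
have lnE : - (e * ln (ua t * scale J.+1)) <= e * (t / 2 + 1) - e * scale J ^+ 2.
  rewrite lnM ?posrE // {2}/scale -/scale expRK.
  have h : - (t / 2) - 1 <= ln (ua t).
    have h1 : expR (- (t / 2) - 1) <= ua t.
      apply: le_trans (ua_ge t4); rewrite expRD ler_wpM2l ?expR_ge0 //.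
      exact: expRN1_le.
    by rewrite -(expRK (- (t / 2) - 1)) ler_ln ?posrE ?expR_gt0.
  exact: log_bound (ltW e0) h.
apply: (@le_trans _ _ (expR (s * t) * (100 * expR (- (t / 2)) *
   (expR (e * (t / 2 + 1) - e * scale J ^+ 2) * weight J)))).
  rewrite ler_wpM2l ?expR_ge0 //; apply: ler_pM => //; first exact: gain_ge0.
    exact: gain_le_exp.
  apply: le_trans c1 _; rewrite ler_wpM2r //; apply: le_trans gE _.
  by rewrite ler_expR.
rewrite (_ : expR (s * t) * _ = 100 * weight J * (expR (s * t) * expR (- (t / 2)) * expR (e * (t / 2 + 1) - e * scale J ^+ 2))); last by ring.
rewrite -!expRD /expabs ger0_norm; last exact: le_trans (ler0n _ 4) t4.
have -> : s * t + - (t / 2) + (e * (t / 2 + 1) - e * scale J ^+ 2) =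
   e + (- (e * scale J ^+ 2) + - (e / 2 * t)) by rewrite sE; field.
rewrite 2!expRD mulrA [leRHS](_ : _ = 100 * weight J * (expR 1 * expR (- (e * scale J ^+ 2)) * expR (- (e / 2 * t)))); last by ring.
rewrite -[leLHS]mulrA ler_wpM2l ?mulr_ge0 // mulrA !ler_wpM2r ?expR_ge0 //.
by rewrite ler_expR.
Qed.

End Bounds.

(** * The transform of kappa as a multiple of the Dirichlet series *)

Section KappaTransform.
Context {R : realType}.
Local Notation normc := (@Normc.normc R).
Local Notation q := (@progeny R).
Implicit Types (s t tau a x : R).

(** From [x <= expR x]. *)
Lemma abs_expabs a t : 0 < a -> `|t| * expabs (2 * a) t <= a^-1 * expabs a t.
Proof.
move=> a0; rewrite /expabs.
have -> : - (2 * a * `|t|) = - (a * `|t|) + - (a * `|t|) by ring.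
rewrite expRD mulrA ler_wpM2r ?expR_ge0 // expRN ler_pdivrMr ?expR_gt0 //.
rewrite ler_pdivlMl //; have := expR_ge1Dx (a * `|t|); lra.
Qed.

Variable rho : R.
Hypothesis rho1 : 1 < rho.
Hypothesis rho2 : rho <= 2.

Let rho0 : 0 < rho. Proof. exact: lt_trans ltr01 rho1. Qed.

(** The trace in [kappa] of one value of the total progeny: [kappa t] is the
    mean of [kern (n * expR (- t))] over the law of [n]. *)
Definition kern x : R := rho * (1 - expR (- x)) - (1 - expR (- (rho ^+ 2 * x))).

Let kern_fun s t : R := expR (s * t) * kern (expR (- t)).

(** The Fourier transform of the weighted kernel, the factor in front of the
    Dirichlet series in [FT_kappa]. *)
Definition ccoef s tau : CC R := FT (kern_fun s) tau.

Lemma onem_expR x : 0 <= x -> 0 <= 1 - expR (- x) <= 1 /\ 1 - expR (- x) <= x.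
Proof.
move=> x0; have h := expR_ge1Dx (- x); have h2 := expR_ge0 (- x).
have h3 : expR (- x) <= 1 by rewrite -expR0 ler_expR oppr_le0.
by split; first (apply/andP; split); lra.
Qed.

Lemma kern_le x : 0 <= x -> `|kern x| <= 6 /\ `|kern x| <= 6 * x.
Proof.
move=> x0; have r0 := rho0; have r1 := rho1; have r2 := rho2.
have r4 : rho ^+ 2 <= 4.
  by have -> : 4 = 2 ^+ 2 :> R; [ring|rewrite lerXn2r ?nnegrE ?(ltW rho0)].
have x'0 : 0 <= rho ^+ 2 * x by rewrite mulr_ge0 ?sqr_ge0.
have [/andP[a0 a1] ax] := onem_expR x0; have [/andP[b0 b1] bx] := onem_expR x'0.
have h2 : rho ^+ 2 * x <= 4 * x by rewrite ler_wpM2r.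
rewrite /kern; set u := 1 - expR (- x) in a0 a1 ax *.
set v := 1 - expR _ in b0 b1 bx *.
have h : `|rho * u - v| <= rho * u + v.
  apply: le_trans (ler_normB _ _) _.
  by rewrite !ger0_norm // mulr_ge0 // ltW.
have h3 : rho * u <= 2 * u by rewrite ler_wpM2r.
by split; apply: le_trans h _; lra.
Qed.

Let kern_fun_le s t : 4^-1 <= s -> s <= 2^-1 -> `|kern_fun s t| <= 6 * expabs 4^-1 t.
Proof.
move=> s1 s2; rewrite normrM [`|expR _|]ger0_norm ?expR_ge0 // /expabs.
have [h1 h2] := kern_le (expR_ge0 (- t)).
have [t0|t0] := leP 0 t.
  apply: le_trans (ler_wpM2l (expR_ge0 _) h2) _.
  rewrite mulrCA -expRD ler_wpM2l // ler_expR ger0_norm //.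
  have : s * t <= 2^-1 * t by rewrite ler_wpM2r //; lra.
  lra.
apply: le_trans (ler_wpM2l (expR_ge0 _) h1) _.
rewrite mulrC ler_wpM2l // ler_expR ltr0_norm // mulrN opprK.
by rewrite ler_nM2r.
Qed.

Let measurable_kern_fun s : measurable_fun setT (kern_fun s).
Proof.
apply: measurable_expM.
have m : measurable_fun setT (fun t : R => expR (- t)).
  by apply: (measurableT_comp (@measurable_expR R)); exact: measurable_funN.
apply: measurable_funB; first apply: measurable_funM => //.
  apply: measurable_funB => //.
  by apply: (measurableT_comp (@measurable_expR R)); exact: measurable_funN.
apply: measurable_funB => //.
apply: (measurableT_comp (@measurable_expR R)); apply: measurable_funN.
exact: measurable_funM.
Qed.

Let quarter_gt0 : 0 < 4^-1 :> R. Proof. by rewrite invr_gt0. Qed.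

Let integrableR_kern_fun s : 4^-1 <= s -> s <= 2^-1 -> integrableR (kern_fun s).
Proof.
move=> s1 s2; apply: integrableR_le (measurable_kern_fun s) (integrableRZ 6 (integrableR_expabs quarter_gt0)) _ => t.
exact: kern_fun_le.
Qed.

Lemma ccoef_bound : exists C : R, forall s tau, 4^-1 <= s -> s <= 2^-1 ->
  normc (ccoef s tau) <= C.
Proof.
exists (2 * intR (fun t => 6 * expabs 4^-1 t)) => s tau s1 s2.
apply: FT_norm_le => //; first by apply: integrableRZ; exact: integrableR_expabs.
by move=> t; exact: kern_fun_le.
Qed.

Lemma ccoef_lip : exists C : R, forall s tau tau', 4^-1 <= s -> s <= 2^-1 ->
  normc (ccoef s tau - ccoef s tau') <= C * `|tau - tau'|.
Proof.
pose b t : R := 6 * (8 * expabs 8^-1 t).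
have hb : integrableR b by apply: integrableRZ; apply: integrableRZ; apply: integrableR_expabs; rewrite invr_gt0.
exists (2 * intR b) => s tau tau' s1 s2.
rewrite -mulrA [intR b * _]mulrC; apply: FT_lip => //; first exact: integrableR_kern_fun.
move=> t; rewrite normrM /b.
apply: le_trans (ler_wpM2l (normr_ge0 _) (kern_fun_le t s1 s2)) _.
rewrite mulrCA ler_wpM2l //.
have h8 : 0 < 8^-1 :> R by rewrite invr_gt0.
have := abs_expabs t h8; rewrite invrK.
by have -> : 2 * 8^-1 = 4^-1 :> R by field.
Qed.

Lemma integrableR_kappa s e : s = 2^-1 - e -> 0 < e -> e <= s ->
  integrableR (fun t => expR (s * t) * kappa rho t).
Proof.
move=> sE e0 es; apply: (integrableR_le (g := fun t => 20 * expabs e t)).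
- by apply: measurable_expM; exact: measurable_kappa.
- by apply: integrableRZ; exact: integrableR_expabs.
move=> t; rewrite normrM ger0_norm ?expR_ge0 //.
apply: le_trans (kappa_weighted rho1 rho2 t sE e0 es).
rewrite ler_wpM2l ?expR_ge0 //; apply: le_trans (ler_normB _ _) _.
rewrite ger0_norm ?mulr_ge0 ?(ltW rho0) ?(ltW (ua_gt0 t)) //.
by rewrite ger0_norm // ltW // ub_gt0.
Qed.

(** Multiplying [x] by [n] translates [t] by [ln n], so the transform of [kern
    (n * expR (- t))] is [ccoef s tau] times the power [s + i tau] of [n].
    Summing over the progeny law and exchanging the sum with the integral by
    dominated convergence gives the Dirichlet series. *)
Lemma FT_kappa s e tau : s = 2^-1 - e -> 0 < e -> e <= s ->
  FT (fun t => expR (s * t) * kappa rho t) tau = ccoef s tau * dsum q (s +i* tau).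
Proof.
move=> sE e0 es.
have s1 : 4^-1 <= s by lra.
have s2 : s < 2^-1 by lra.
pose F n t := q n * (expR (s * t) * kern (n%:R * expR (- t))).
have FE n : F n.+1 = fun t => (q n.+1 * expR (s * ln n.+1%:R)) * kern_fun s (t - ln n.+1%:R).
  apply/funext => t; rewrite /F /kern_fun -mulrA; congr (_ * _).
  rewrite mulrA -expRD; congr (expR _ * kern _); first by ring.
  by rewrite opprB expRD lnK // posrE ltr0n.
have F0 : F 0%N = fun=> 0 by apply/funext => t; rewrite /F progeny0 mul0r.
have ig0 : integrableR (fun=> 0 : R).
  apply: (integrableR_le (g := expabs 1)) => //; first exact: integrableR_expabs.
  by move=> t; rewrite normr0 expR_ge0.
have igF n : integrableR (F n).
  case: n => [|n]; first by rewrite F0.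
  by rewrite FE; apply: integrableRZ; apply: integrableR_shift; apply: integrableR_kern_fun => //; exact: ltW.
have FTF n : FT (F n) tau = ccoef s tau * dterm q n (s +i* tau).
  case: n => [|n].
    rewrite F0 /dterm progeny0 (_ : (0:R)%:C = 0) // !mulr0.
    have := FTZ 0 tau ig0; rewrite (_ : (fun=> 0 * 0) = (fun=> 0)); last first.
      by apply/funext => t; rewrite mul0r.
    by move=> ->; rewrite (_ : (0:R)%:C = 0) // mul0r.
  rewrite FE FTZ; last by apply: integrableR_shift; apply: integrableR_kern_fun => //; exact: ltW.
  rewrite FT_shift; last by apply: integrableR_kern_fun => //; exact: ltW.
  rewrite -/(ccoef s tau) /dterm /natpowC.
  set l := ln _.
  have -> : (s +i* tau) * l%:C = (s * l)%:C + (0 +i* (tau * l)).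
    by apply: complex_eq; rewrite ?ReCD ?ImCD ?ReCM ?ImCM /=; ring.
  rewrite CexpD.
  have -> : Cexp (s * l)%:C = (expR (s * l))%:C.
    by apply: complex_eq; rewrite ?Re_Cexp ?Im_Cexp /= ?cos0 ?sin0 ?mulr1 ?mulr0.
  by rewrite rmorphM /=; ring.
have hs : csum (fun n => ccoef s tau * dterm q n (s +i* tau)) (ccoef s tau * dsum q (s +i* tau)).
  apply: csumZ; apply: csum_dsum => //.
  - exact: progeny_ge0.
  - exact: progeny_moment.
apply: csum_unique hs.
have := @FT_cvg R (fun N t => \sum_(0 <= n < N) F n t) (fun t => expR (s * t) * kappa rho t)
  (fun t => 20 * expabs e t) tau.
move=> h; rewrite /csum.
have -> : (fun N => \sum_(0 <= n < N) ccoef s tau * dterm q n (s +i* tau)) =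
   (fun N => FT (fun t => \sum_(0 <= n < N) F n t) tau).
  apply/funext => N; have [_ ->] := FT_sum (index_iota 0 N) tau igF.
  by apply: eq_bigr => n _; rewrite FTF.
apply: h.
- by move=> N; have [/integrableR_measurable] := FT_sum (index_iota 0 N) tau igF.
- by apply: integrableRZ; exact: integrableR_expabs.
- move=> N t; apply: le_trans (kappa_weighted rho1 rho2 t sE e0 es).
  have x0 := expR_gt0 (- t).
  have x'0 : 0 < rho ^+ 2 * expR (- t) by rewrite mulr_gt0 ?exprn_gt0.
  have h2 := has_sumD (has_sumZ (c := rho) (tail_sum x0)) (tail_sum x'0).
  have b0 n : 0 <= 1 - expR (- (n%:R * expR (- t))).
    by have [/andP[]] := onem_expR (mulr_ge0 (ler0n _ n) (ltW x0)).
  have b0' n : 0 <= 1 - expR (- (n%:R * (rho ^+ 2 * expR (- t)))).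
    by have [/andP[]] := onem_expR (mulr_ge0 (ler0n _ n) (ltW x'0)).
  have pos n : 0 <= rho * (q n * (1 - expR (- (n%:R * expR (- t))))) +
      q n * (1 - expR (- (n%:R * (rho ^+ 2 * expR (- t))))).
    by rewrite addr_ge0 // ?mulr_ge0 ?progeny_ge0 ?(ltW rho0).
  apply: le_trans (ler_wpM2l (expR_ge0 (s * t)) (psum_le N pos h2)).
  rewrite /series /= mulr_sumr.
  apply: le_trans (ler_norm_sum _ _ _) _; apply: ler_sum => n _.
  rewrite /F mulrCA normrM ger0_norm ?expR_ge0 // ler_wpM2l ?expR_ge0 //.
  have -> : q n * kern (n%:R * expR (- t)) =
    rho * (q n * (1 - expR (- (n%:R * expR (- t))))) -
    q n * (1 - expR (- (n%:R * (rho ^+ 2 * expR (- t))))).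
    by rewrite /kern [rho ^+ 2 * (_ * _)]mulrCA; ring.
  apply: le_trans (ler_normB _ _) _.
  by rewrite !ger0_norm // ?mulr_ge0 ?progeny_ge0 ?(ltW rho0).
move=> t.
have x0 := expR_gt0 (- t).
have x'0 : 0 < rho ^+ 2 * expR (- t) by rewrite mulr_gt0 ?exprn_gt0.
have h2 := has_sumZ (c := expR (s * t))
  (has_sumB (has_sumZ (c := rho) (tail_sum x0)) (tail_sum x'0)).
have e2 : (fun n => expR (s * t) * (rho * (q n * (1 - expR (- (n%:R * expR (- t))))) -
      q n * (1 - expR (- (n%:R * (rho ^+ 2 * expR (- t))))))) = F ^~ t.
  by apply/funext => n; rewrite /F /kern [rho ^+ 2 * (_ * _)]mulrCA; ring.
by rewrite e2 in h2; exact: h2.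
Qed.

End KappaTransform.

(** * The profile of a level *)

Section PartLimit.
Context {R : realType}.
Local Arguments scale : simpl never.
Local Notation normc := (@Normc.normc R).
Implicit Types (s t tau a x : R) (K : nat).

(** By comparison with the powers of 4. *)
Lemma scale_inv_cvg0 : (fun K => (scale K)^-1 : R) @ \oo --> (0 : R).
Proof.
have h : `|4^-1 : R| < 1 by rewrite ger0_norm ?invr_ge0 // invf_lt1 // ltr1n.
have h2 : (fun K => 4^-1 ^+ K) @ \oo --> (0 : R) := cvg_expr h.
apply: (squeeze_cvgr _ (cvg_cst 0) h2); apply: nearW => K.
rewrite invr_ge0 (ltW (scale_gt0 K)) /= exprVn.
rewrite lef_pV2 ?posrE ?exprn_gt0 ?scale_gt0 //.
by apply: le_trans (scale_geX K); rewrite exprS ler_peMl ?exprn_ge0 // ler1n.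
Qed.

Lemma late_bound (x m : R) : 4 <= m -> `|x| + 4 <= m -> 4 <= x + 2 * m ^+ 2.
Proof.
move=> m4 h; have h2 := ler_norm (- x); rewrite normrN in h2.
have h3 : m <= m ^+ 2 by rewrite expr2 ler_peMl; lra.
lra.
Qed.

Variable rho : R.
Hypothesis rho1 : 1 < rho.
Hypothesis rho2 : rho <= 2.

Let rho0 : 0 < rho. Proof. exact: lt_trans ltr01 rho1. Qed.

(** The logarithm of [scale K.+1]; half of the place where level [K.+1] sits in
    the variable [t]. *)
Definition logscale K : R := scale K ^+ 2.

(** At this distance from the critical abscissa the weight takes only the
    constant factor [expR (- 2)] from level [K.+1], which sits at [2 * logscale
    K], whereas the next level sits so much further that it is damped. *)
Definition abscissa K : R := 2^-1 - (logscale K)^-1.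

(** Level [K.+1], centred at 0 and normalized by its weight and its scale. *)
Definition rescaled K s : R := expR (abscissa K * s) *
  (scale K.+1 * (level rho K.+1 (s + 2 * logscale K) / weight K.+1)).

Lemma logscale_gt0 K : 0 < logscale K.
Proof. by rewrite exprn_gt0 ?scale_gt0. Qed.

Lemma logscale_ge16 K : 16 <= logscale K.
Proof.
have -> : 16 = 4 * 4 :> R by ring.
by rewrite /logscale expr2; apply: ler_pM => //; exact: scale_ge4.
Qed.

Lemma scale_expR K : scale K.+1 = expR (logscale K). Proof. by []. Qed.

Lemma abscissa_bounds K : [/\ 4^-1 <= abscissa K, abscissa K < 2^-1,
  0 < (logscale K)^-1 & (logscale K)^-1 <= 4^-1].
Proof.
have h := logscale_ge16 K; have h0 := logscale_gt0 K.
have i0 : 0 < (logscale K)^-1 by rewrite invr_gt0.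
have i1 : (logscale K)^-1 <= 4^-1.
  by rewrite lef_pV2 ?posrE // (le_trans _ h) // ler_nat.
by rewrite /abscissa; split => //; lra.
Qed.

Lemma measurable_rescaled K : measurable_fun setT (rescaled K).
Proof.
apply: measurable_expM; apply: measurable_funM => //.
apply: measurable_funM => //.
exact: (measurable_fun_shift (2 * logscale K) (measurable_level rho1 K.+1)).
Qed.

Lemma half_shift K s : expR (- ((s + 2 * logscale K) / 2)) = expR (- (s / 2)) / scale K.+1.
Proof. by rewrite scale_expR -expRN -expRD; congr expR; field. Qed.

(** For [s >= 0] the variation of a level is at most [ub t * scale K.+1], and
    for [s <= 0] it is at most [(ua t * scale K.+1)^-1]. The weight [expR
    (abscissa K * s)], whose exponent lies between [1 / 4] and [1 / 2], leaves
    an exponential decay on both sides. *)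
Lemma rescaled_le K s : `|rescaled K s| <= 1000 * expabs 4^-1 s.
Proof.
have [s1 s2 _ _] := abscissa_bounds K.
rewrite /rescaled normrM [`|expR _|]ger0_norm ?expR_ge0 // /level.
case: ifP => t4; last by rewrite mul0r mulr0 normr0 mulr0 mulr_ge0 ?ler0n ?expR_ge0.
set t := s + _ in t4 *; have M0 := @scale_gt0 R K.+1; have w0 := @weight_gt0 R K.+1.
have -> : scale K.+1 * (gain rho t * Bdrop rho K.+1 t / weight K.+1) =
  (scale K.+1 * gain rho t) * (geomS (ua t * scale K.+1) - geomS (ub rho t * scale K.+1)).
  rewrite /Bdrop; set d := geomS _ - _.
  by field; rewrite gt_eqF.
have d0 : 0 <= geomS (ua t * scale K.+1) - geomS (ub rho t * scale K.+1).
  rewrite subr_ge0; apply: geomS_anti; first by rewrite mulr_ge0 // ltW ?ua_gt0.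
  by rewrite ler_wpM2r ?(ltW M0) // ua_le_ub.
have g0 : 0 <= scale K.+1 * gain rho t by rewrite mulr_ge0 ?gain_ge0 // ltW.
have g1 : scale K.+1 * gain rho t <= 100 * expR (- (s / 2)).
  apply: le_trans (ler_wpM2l (ltW M0) (gain_le_exp rho1 rho2 t)) _.
  by rewrite half_shift mulrCA ler_wpM2l // mulrCA divff ?mulr1 // gt_eqF.
rewrite normrM ger0_norm // [`|_ - _|]ger0_norm // /expabs.
have pu : 0 < ua t * scale K.+1 :> R by rewrite mulr_gt0 ?ua_gt0.
have pb : 0 < ub rho t * scale K.+1 :> R by rewrite mulr_gt0 ?ub_gt0.
have [s0|s0] := leP 0 s.
  have d1 : geomS (ua t * scale K.+1) - geomS (ub rho t * scale K.+1) <= 10 * expR (- (s / 2)).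
    have h1 := geomS_le1 (ltW pu); have h2 := geomS_ge1B (ltW pb).
    apply: (@le_trans _ _ (1 - (1 - ub rho t * scale K.+1))); first exact: lerB.
    rewrite opprB addrC subrK.
    apply: le_trans (ler_wpM2r (ltW M0) (ub_le rho1 rho2 t)) _.
    by rewrite half_shift -!mulrA mulVf ?mulr1 // gt_eqF.
  apply: (@le_trans _ _ (expR (abscissa K * s) * ((100 * expR (- (s / 2))) * (10 * expR (- (s / 2)))))).
    by rewrite ler_wpM2l ?expR_ge0 // ler_pM.
  rewrite (_ : expR (abscissa K * s) * _ = (100 * 10) * (expR (abscissa K * s) * expR (- (s / 2)) * expR (- (s / 2)))); last by ring.
  have -> : 100 * 10 = 1000 :> R by rewrite -natrM.
  rewrite -!expRD ler_wpM2l ?ler0n // ler_expR ger0_norm //.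
  have h : abscissa K * s <= 2^-1 * s by rewrite ler_wpM2r // ltW.
  move: h; set z := abscissa K * s => h; clear -s0 h; lra.
have d1 : geomS (ua t * scale K.+1) - geomS (ub rho t * scale K.+1) <= 2 * expR (s / 2).
  apply: (@le_trans _ _ (geomS (ua t * scale K.+1))).
    by rewrite gerBl; apply: geomS_ge0; exact: ltW.
  apply: le_trans (geomS_le_inv pu) _.
  have -> : 2 * expR (s / 2) = ((expR (- (s / 2)) / scale K.+1 / 2) * scale K.+1)^-1.
    by rewrite expRN; field; rewrite !gt_eqF ?expR_gt0.
  rewrite lef_pV2 ?posrE //; last by rewrite mulr_gt0 // !divr_gt0 ?expR_gt0.
  by rewrite ler_wpM2r ?(ltW M0) // -half_shift ua_ge.
apply: (@le_trans _ _ (expR (abscissa K * s) * ((100 * expR (- (s / 2))) * (2 * expR (s / 2))))).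
  by rewrite ler_wpM2l ?expR_ge0 // ler_pM.
rewrite (_ : expR (abscissa K * s) * _ = (100 * 2) * (expR (abscissa K * s) * (expR (- (s / 2)) * expR (s / 2)))); last by ring.
rewrite -expRD addNr expR0 mulr1.
apply: ler_pM; rewrite ?mulr_ge0 ?ler0n ?expR_ge0 //.
  by rewrite -natrM ler_nat.
by rewrite ler_expR ltr0_norm // mulrN opprK ler_nM2r.
Qed.

(** In the variable [s], the quantity [ua t * scale K.+1] tends to [v = expR (-
    s / 2)] and [ub t * scale K.+1] to [rho * v], while [Bfun] tends to 1; so
    [gain t * scale K.+1] tends to [rho * v / 2], and the weight tends to
    [v^-1]. *)
Lemma rescaled_cvg s : rescaled ^~ s @ \oo --> rho / 2 * profile rho s.
Proof.
pose v := expR (- (s / 2)); have v0 : 0 < v by exact: expR_gt0.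
pose M K : R := scale K.+1; have M0 K : 0 < M K by exact: scale_gt0.
pose y K := v / M K.
have y0 K : 0 < y K by rewrite divr_gt0.
have cM : (fun K => (M K)^-1) @ \oo --> (0 : R).
  by have := scale_inv_cvg0; rewrite -cvg_shiftS.
have cy : y @ \oo --> (0 : R) by rewrite -(mulr0 v); exact: cvgMr.
pose a K := tail (y K ^+ 2); pose b K := tail ((rho * y K) ^+ 2).
have ca : (fun K => a K * M K) @ \oo --> v.
  have h := tail_equiv y0 cy.
  have -> : (fun K => a K * M K) = (fun K => v * (a K / y K)).
    apply/funext => K; rewrite /y; have := M0 K; set m := M K => m0.
    by field; rewrite !gt_eqF.
  by rewrite -[X in _ --> X]mulr1; exact: cvgMr.
have cb : (fun K => b K * M K) @ \oo --> rho * v.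
  have ry0 K : 0 < rho * y K by rewrite mulr_gt0.
  have cry : (fun K => rho * y K) @ \oo --> (0 : R) by rewrite -(mulr0 rho); exact: cvgMr.
  have h := tail_equiv ry0 cry.
  have -> : (fun K => b K * M K) = (fun K => (rho * v) * (b K / (rho * y K))).
    apply/funext => K; rewrite /y; have := M0 K; set m := M K => m0.
    by field; rewrite !gt_eqF.
  by rewrite -[X in _ --> X]mulr1; exact: cvgMr.
have cB : (fun K => Bfun (a K)) @ \oo --> (1 : R).
  apply: Bfun_cvg1; last exact: tail_cvg0.
  by move=> K; apply/ltW/tail_gt0; rewrite exprn_gt0.
have cgeom (f : nat -> R) (l : R) : 0 < l -> f @ \oo --> l -> (fun K => geomS (f K)) @ \oo --> geomS l.
  move=> l0 hf; apply: cvgV; first by rewrite gt_eqF // addr_gt0.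
  by apply: cvgD => //; exact: cvg_cst.
have cE : (fun K => expR (abscissa K * s)) @ \oo --> expR (2^-1 * s).
  have h : (fun K => abscissa K * s) @ \oo --> 2^-1 * s.
    apply: cvgMl; rewrite -[X in _ --> X]subr0; apply: cvgB; first exact: cvg_cst.
    rewrite -(mulr0 (0 : R)).
    have -> : (fun K => (logscale K)^-1) = (fun K => (scale K)^-1 * (scale K)^-1).
      by apply/funext => K; rewrite /logscale expr2 invfM.
    by apply: cvgM; exact: scale_inv_cvg0.
  exact: (cvg_comp _ _ h (@continuous_expR R (2^-1 * s))).
have rv0 : 0 < rho * v by rewrite mulr_gt0.
have cD : (fun K => (b K * M K) ^+ 2 / (Bfun (a K) * (rho * (a K * M K) + b K * M K)))
    @ \oo --> (rho * v) ^+ 2 / (1 * (rho * v + rho * v)).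
  apply: cvgM; first by rewrite expr2; under eq_fun do rewrite expr2; exact: cvgM.
  apply: cvgV; first by rewrite mul1r gt_eqF // addr_gt0.
  apply: cvgM => //; apply: cvgD => //; exact: cvgMr.
have cL : (fun K => expR (abscissa K * s) *
    ((b K * M K) ^+ 2 / (Bfun (a K) * (rho * (a K * M K) + b K * M K)) *
     (geomS (a K * M K) - geomS (b K * M K)))) @ \oo --> expR (2^-1 * s) *
    ((rho * v) ^+ 2 / (1 * (rho * v + rho * v)) * (geomS v - geomS (rho * v))).
  by apply: (cvgM cE (cvgM cD (cvgB (cgeom _ _ v0 ca) (cgeom _ _ rv0 cb)))).
have -> : rho / 2 * profile rho s =
   expR (2^-1 * s) * ((rho * v) ^+ 2 / (1 * (rho * v + rho * v)) * (geomS v - geomS (rho * v))).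
  rewrite -/(profile rho s) mulrA; congr (_ * _).
  have -> : expR (2^-1 * s) = v^-1 by rewrite /v -expRN opprK mulrC.
  by field; rewrite !gt_eqF // addr_gt0.
apply: cvg_trans cL; apply: near_eq_cvg; near=> K.
have t4 : 4 <= s + 2 * logscale K.
  have d0 : 0 < `|s| + 4 by rewrite ltr_wpDl.
  have h : (scale K)^-1 < (`|s| + 4)^-1.
    near: K; apply: (cvgr_lt 0 scale_inv_cvg0); by rewrite invr_gt0.
  rewrite ltf_pV2 ?posrE ?scale_gt0 // in h.
  apply: late_bound (scale_ge4 K) (ltW h).
have vE : expR (- (s + 2 * logscale K)) = y K ^+ 2.
  by rewrite /y /M -half_shift -expRM_natl; congr expR; field.
have aE : ua (s + 2 * logscale K) = a K by rewrite /ua vE.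
have bE : ub rho (s + 2 * logscale K) = b K by rewrite /ub vE -exprMn.
rewrite /rescaled. rewrite /level t4 /gain /Bdrop aE bE. rewrite -/(M K).
have a0 : 0 < a K by rewrite tail_gt0 // exprn_gt0.
have b0 : 0 < b K by rewrite tail_gt0 // exprn_gt0 // mulr_gt0.
have B0 : 0 < Bfun (a K).
  by rewrite -aE; apply: lt_le_trans (Bua_ge _); rewrite invr_gt0.
have w0 := @weight_gt0 R K.+1.
congr (_ * _); set d := geomS _ - _.
move: (M0 K) a0 b0 B0 w0; set m := M K; set aK := a K; set bK := b K; set B := Bfun _; set w := weight _.
move=> m0 a0 b0 B0 w0.
have n0 : 0 < rho * aK + bK by rewrite addr_gt0 // mulr_gt0.
have n1 : 0 < rho * (aK * m) + bK * m by rewrite addr_gt0 // !mulr_gt0.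
by field; rewrite !gt_eqF.
Unshelve. all: by end_near.
Qed.

End PartLimit.

(** * Comparison of two frequencies *)

Section BlowUp.
Context {R : realType}.

Lemma third_lt (u r : R) : u < r / 3 -> 2 * u + u < r.
Proof. by move=> h; lra. Qed.

Lemma factor_eight (a b T : R) : a * b <= a * (4 * T) -> 2 * (a * b) <= 8 * (a * T).
Proof. by move=> h; lra. Qed.

Lemma quad_le (z T : R) : 1 + T ^+ 2 / 2`!%:R <= z -> T ^+ 2 <= 2 * z.
Proof. by rewrite (_ : 2`!%:R = 2) // => h; lra. Qed.

(** From [expR (- x) <= x^-1]. *)
Lemma gaussian_small (T S M : R) : 0 < T -> 0 < M -> M <= S -> T ^+ 2 <= 2 * S ->
  T * expR (- (T^-1 * S ^+ 2)) <= 2 / M.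
Proof.
move=> T0 M0 MS TS; have S0 := lt_le_trans M0 MS.
have x0 : 0 < T^-1 * S ^+ 2 by rewrite mulr_gt0 ?invr_gt0 ?exprn_gt0.
have h : expR (- (T^-1 * S ^+ 2)) <= (T^-1 * S ^+ 2)^-1.
  rewrite expRN lef_pV2 ?posrE ?expR_gt0 //.
  by have := expR_ge1Dx (T^-1 * S ^+ 2); lra.
apply: le_trans (ler_wpM2l (ltW T0) h) _.
have -> : T * (T^-1 * S ^+ 2)^-1 = T ^+ 2 / S ^+ 2 by field; rewrite !gt_eqF.
apply: (@le_trans _ _ (2 * S / S ^+ 2)).
  by rewrite ler_wpM2r // invr_ge0 sqr_ge0.
have -> : 2 * S / S ^+ 2 = 2 / S by field; rewrite gt_eqF.
by rewrite ler_wpM2l // lef_pV2.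
Qed.

Lemma intR_ge0 (f : R -> R) : (forall t, 0 <= f t) -> 0 <= intR f.
Proof. by move=> f0; apply: Rintegral_ge0. Qed.
Local Arguments scale : simpl never.
Local Notation normc := (@Normc.normc R).
Local Notation Re := complex.Re.
Local Notation q := (@progeny R).
Implicit Types (s t tau a x : R) (K : nat).

Variable rho : R.
Hypothesis rho1 : 1 < rho.
Hypothesis rho2 : rho <= 2.

Let rho0 : 0 < rho. Proof. exact: lt_trans ltr01 rho1. Qed.

Definition wkappa K t : R := expR (abscissa K * t) * kappa rho t.
Definition wlevel K t : R := expR (abscissa K * t) * level rho K.+1 t.
Definition whigh K t : R := expR (abscissa K * t) * high rho K.+1 t.
Definition wlow K t : R := expR (abscissa K * t) * low rho K.+1 t.

(** The frequency is moved by half a turn of the phase [2 * logscale K * tau].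
    *)
Definition twist K tau : R := tau + pi / (2 * logscale K).

Let quarter_gt0 : 0 < 4^-1 :> R. Proof. by rewrite invr_gt0. Qed.

Lemma integrableR_rescaled K : integrableR (rescaled rho K).
Proof.
apply: integrableR_le (measurable_rescaled rho1 K) (integrableRZ 1000 (integrableR_expabs quarter_gt0)) _ => t.
exact: rescaled_le.
Qed.

(** The weight at the position [2 * logscale K] of the level is [expR (- 2) *
    scale K.+1], by the choice of [abscissa]. *)
Lemma wlevel_rescaled K t :
  wlevel K t = expR (- 2) * weight K.+1 * rescaled rho K (t - 2 * logscale K).
Proof.
rewrite /wlevel /rescaled subrK mulrBr expRD.
have T0 := @logscale_gt0 R K; have w0 := @weight_gt0 R K.+1.
have -> : - (abscissa K * (2 * logscale K)) = 2 - logscale K :> R.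
  by rewrite /abscissa; field; rewrite gt_eqF.
rewrite expRD scale_expR !expRN.
have e1 := expR_gt0 (2 : R); have e2 := expR_gt0 (logscale K : R).
by field; rewrite !gt_eqF.
Qed.

Lemma FT_wlevel K tau : FT (wlevel K) tau =
  Cexp (0 +i* (tau * (2 * logscale K))) * ((expR (- 2) * weight K.+1)%:C * FT (rescaled rho K) tau).
Proof.
rewrite -FTZ; last exact: integrableR_rescaled.
rewrite -(@FT_shift R (fun s => expR (- 2) * weight K.+1 * rescaled rho K s)); last first.
  by apply: integrableRZ; exact: integrableR_rescaled.
by congr FT; apply/funext => t; exact: wlevel_rescaled.
Qed.

Lemma Cexp_twist K tau : Cexp (0 +i* (twist K tau * (2 * logscale K))) =
  - Cexp (0 +i* (tau * (2 * logscale K))) :> CC R.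
Proof.
have -> : twist K tau * (2 * logscale K) = tau * (2 * logscale K) + pi.
  by rewrite /twist; field; rewrite gt_eqF ?logscale_gt0.
by apply: complex_eq; rewrite ?ReCN ?ImCN ?Re_Cexp ?Im_Cexp /= ?cosDpi ?sinDpi mulrN.
Qed.

Lemma normc_phase x : normc (Cexp (0 +i* x)) = 1.
Proof. by rewrite normc_Cexp /= expR0. Qed.

(** Because of the opposite phases the difference of the transforms of the
    level becomes the sum of the transforms of its centred version. *)
Lemma wlevel_difference K tau : normc (FT (wlevel K) tau - FT (wlevel K) (twist K tau)) =
  expR (- 2) * weight K.+1 * normc (FT (rescaled rho K) tau + FT (rescaled rho K) (twist K tau)).
Proof.
rewrite !FT_wlevel Cexp_twist mulNr opprK -mulrDr -mulrDr normcM normc_phase mul1r normcM.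
by rewrite normc_real ger0_norm // mulr_ge0 ?expR_ge0 ?weight_ge0.
Qed.

Lemma twist_dist K tau : `|tau - twist K tau| = pi / 2 / logscale K.
Proof.
rewrite /twist opprD addrA subrr add0r normrN ger0_norm.
  by field; rewrite gt_eqF ?logscale_gt0.
by rewrite divr_ge0 ?pi_ge0 // mulr_ge0 // ltW ?logscale_gt0.
Qed.

Lemma twist_dist_le K tau : `|tau - twist K tau| <= 2 / logscale K.
Proof.
rewrite twist_dist ler_wpM2r ?invr_ge0 ?(ltW (logscale_gt0 K)) //.
exact/ltW/pihalf_lt2.
Qed.

Let integrableR_wkappa K : integrableR (wkappa K).
Proof.
have [h1 h2 h3 h4] := @abscissa_bounds R K.
apply: (@integrableR_kappa R rho rho1 rho2 _ (logscale K)^-1) => //.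
exact: le_trans h4 h1.
Qed.

Let wlow_le : exists2 c : R, 0 <= c & forall K t,
  `|wlow K t| <= c * scale K * expabs 4^-1 t.
Proof.
exists (2600 + 3 * expR 3).
  by rewrite addr_ge0 ?ler0n // mulr_ge0 ?expR_ge0 ?ler0n.
move=> K t; have [h1 /ltW h2 h3 h4] := @abscissa_bounds R K.
exact: low_weighted.
Qed.

Let integrableR_wlow K : integrableR (wlow K).
Proof.
have [c c0 hc] := wlow_le.
apply: (integrableR_le (g := fun t => c * scale K * expabs 4^-1 t)).
- apply: measurable_expM; exact: measurable_low.
- by apply: integrableRZ; exact: integrableR_expabs.
- by move=> t; exact: hc.
Qed.

Let highc K : R := 100 * expR 1 * weight K.+1 * expR (- ((logscale K)^-1 * scale K.+1 ^+ 2)).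

Let whigh_le K t : `|whigh K t| <= highc K * expabs ((logscale K)^-1 / 2) t.
Proof.
have [h1 h2 h3 h4] := @abscissa_bounds R K.
apply: (@high_weighted R rho rho1 rho2 _ (logscale K)^-1) => //.
by apply: le_trans h4 _; rewrite invf_le1 // ler1n.
Qed.

Let integrableR_whigh K : integrableR (whigh K).
Proof.
have [h1 h2 h3 h4] := @abscissa_bounds R K.
apply: (integrableR_le (g := fun t => highc K * expabs ((logscale K)^-1 / 2) t)).
- apply: measurable_expM; exact: measurable_high.
- by apply: integrableRZ; apply: integrableR_expabs; rewrite divr_gt0.
- exact: whigh_le.
Qed.

Let integrableR_wlevel K : integrableR (wlevel K).
Proof.
have -> : wlevel K = fun t => wlow K t + (-1 * wkappa K t + -1 * whigh K t).
  by apply/funext => t; rewrite /wlow /wkappa /whigh /wlevel /low; ring.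
by apply: integrableRD => //; apply: integrableRD; apply: integrableRZ.
Qed.

Lemma FT_wlow K tau : FT (wlow K) tau = FT (wkappa K) tau + FT (wlevel K) tau + FT (whigh K) tau.
Proof.
rewrite -!FTD //; last by apply: integrableRD.
by congr FT; apply/funext => t; rewrite /wlow /wkappa /whigh /wlevel /low; ring.
Qed.

(** The factor [expR (- (scale K.+1) ^+ 2 / logscale K)] beats the width
    [logscale K] of the domination by a large margin, as [scale K.+1] is the
    exponential of [logscale K]. *)
Lemma whigh_difference : exists C : R, forall K tau tau',
  normc (FT (whigh K) tau - FT (whigh K) tau') <= C / scale K.
Proof.
exists (100 * expR 1 * 32) => K tau tau'.
have [h1 h2 h3 h4] := @abscissa_bounds R K.
have T0 := @logscale_gt0 R K.
have c0 : 0 <= 100 * expR 1 :> R by rewrite mulr_ge0 ?ler0n ?expR_ge0.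
have r0 : 0 <= highc K by rewrite mulr_ge0 ?expR_ge0 // mulr_ge0 ?weight_ge0.
have hig : integrableR (fun t => highc K * expabs ((logscale K)^-1 / 2) t).
  by apply: integrableRZ; apply: integrableR_expabs; rewrite divr_gt0.
have hn tau1 : normc (FT (whigh K) tau1) <= 8 * (highc K * logscale K).
  have m := integrableR_measurable (integrableR_whigh K).
  apply: le_trans (FT_norm_le tau1 m hig (whigh_le K)) _.
  rewrite intRZ; last by apply: integrableR_expabs; rewrite divr_gt0.
  have h5 : intR (expabs ((logscale K)^-1 / 2)) <= 4 * logscale K :> R.
    apply: le_trans (intR_expabs_le _) _; first by rewrite divr_gt0.
    by rewrite le_eqVlt; apply/orP; left; apply/eqP; field; rewrite gt_eqF.
  have := ler_wpM2l r0 h5; set I := intR _; set rc := highc K.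
  set T := logscale K => h; exact: factor_eight h.
apply: le_trans (normcD _ _) _; rewrite normcN.
apply: le_trans (lerD (hn tau) (hn tau')) _.
have hT : logscale K * expR (- ((logscale K)^-1 * scale K.+1 ^+ 2)) <= 2 / scale K :> R.
  apply: gaussian_small => //; [exact: scale_gt0|exact: scale_mono|].
  rewrite scale_expR; have := expR_ge1Dxn 1 (ltW T0).
  by set z := expR _ => h; exact: quad_le h.
have w1 : weight K.+1 <= 1 :> R by rewrite exprn_ile1 ?invr_ge0 // invf_le1 // ler1n.
rewrite /highc; set E := expR (- _) in hT *; set w := weight K.+1 in w1 *.
set c := 100 * expR 1 in c0 *.
have w0 : 0 <= w by exact: weight_ge0.
have TE0 : 0 <= logscale K * E by rewrite mulr_ge0 ?expR_ge0 // ltW.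
have -> : 8 * (c * w * E * logscale K) + 8 * (c * w * E * logscale K) =
   c * 16 * (w * (logscale K * E)) by ring.
have -> : c * 32 / scale K = c * 16 * (1 * (2 / scale K)) by ring.
rewrite ler_wpM2l ?(mulr_ge0 c0) ?ler0n //; exact: ler_pM.
Qed.

(** The transform is Lipschitz in the frequency with constant [O (scale K)],
    and the two frequencies are at distance [O ((scale K) ^- 2)]. *)
Lemma wlow_difference : exists C : R, forall K tau,
  normc (FT (wlow K) tau - FT (wlow K) (twist K tau)) <= C / scale K.
Proof.
have [c c0 hc] := wlow_le.
have h8 : 0 < 8^-1 :> R by rewrite invr_gt0.
pose I : R := intR (expabs 8^-1).
exists (2 * (2 * (c * 8 * I))) => K tau.
apply: le_trans (FT_lip (b := fun t => c * scale K * 8 * expabs 8^-1 t) _ _ (integrableR_wlow K) _ _) _.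
- by apply: integrableRZ; exact: integrableR_expabs.
- move=> t; rewrite normrM.
  apply: le_trans (ler_wpM2l (normr_ge0 _) (hc K t)) _.
  rewrite mulrCA -[leRHS]mulrA ler_wpM2l //.
    by rewrite mulr_ge0 ?(ltW (scale_gt0 K)).
  have := abs_expabs t h8; rewrite invrK.
  by have -> : 2 * 8^-1 = 4^-1 :> R by field.
rewrite intRZ ?integrableR_expabs // -/I.
have I0 : 0 <= I by apply: intR_ge0 => t; exact: expR_ge0.
have M0 := @scale_gt0 R K.
apply: (@le_trans _ _ (2 * (2 / logscale K * (c * scale K * 8 * I)))).
  rewrite ler_wpM2l // ler_wpM2r ?twist_dist_le //.
  by rewrite !mulr_ge0 ?ler0n // ltW.
rewrite le_eqVlt; apply/orP; left; apply/eqP; rewrite /logscale.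
by field; rewrite gt_eqF.
Qed.

(** By [FT_kappa] the transform of [kappa] is a product of two functions that
    are bounded and Lipschitz in the frequency, uniformly in [K]. *)
Lemma wkappa_difference tau0 r A : 0 < r ->
  (forall a : CC R, Re a < 2^-1 -> normc (a - (2^-1 +i* tau0)) < r -> normc (dcoef q a 1) <= A) ->
  exists C : R, \forall K \near \oo,
    normc (FT (wkappa K) tau0 - FT (wkappa K) (twist K tau0)) <= C / scale K.
Proof.
move=> r0 hA.
have [Cc hCc] := @ccoef_bound R rho rho1 rho2.
have [Cl hCl] := @ccoef_lip R rho rho1 rho2.
(* a reference point in the half disc: with the Lipschitz bound it yields a
   bound of the series itself on the half disc *)
pose p : CC R := (2^-1 - Num.min r 1 / 2) +i* tau0.
have m0 : 0 < Num.min r 1 by rewrite lt_min r0 ltr01.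
have hp : Re p < 2^-1 by rewrite /p /=; lra.
have norm_re (x y : R) tau : normc ((x +i* tau) - (y +i* tau) : CC R) = `|x - y|.
  have -> : (x +i* tau) - (y +i* tau) = (x - y)%:C :> CC R.
    by apply: complex_eq; rewrite ?ReCD ?ImCD ?ReCN ?ImCN /= ?subrr.
  exact: normc_real.
have norm_im (x tau tau' : R) : normc ((x +i* tau) - (x +i* tau') : CC R) <= `|tau - tau'|.
  apply: le_trans (normc_le_ReIm _) _.
  by rewrite ReCD ImCD ReCN ImCN /= subrr normr0 add0r.
have hpr : normc (p - (2^-1 +i* tau0)) < r.
  rewrite /p norm_re addrAC subrr sub0r normrN ger0_norm ?divr_ge0 ?(ltW m0) //.
  have h : Num.min r 1 <= r by rewrite ge_min lexx.
  lra.
have A0 : 0 <= A by apply: le_trans (hA p hp hpr); exact: normc_ge0.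
pose Bm := normc (dsum q p) + A * (2 * r).
have Bm0 : 0 <= Bm by rewrite addr_ge0 ?normc_ge0 // !mulr_ge0 // ltW.
have q4 : 4^-1 <= 2^-1 :> R by rewrite lef_pV2 ?posrE // ler_nat.
have Cc0 : 0 <= Cc by apply: le_trans (hCc 4^-1 0 (lexx _) q4); exact: normc_ge0.
have Cl0 : 0 <= Cl.
  have := le_trans (normc_ge0 _) (hCl 4^-1 1 0 (lexx _) q4).
  by rewrite subr0 normr1 mulr1.
have lip : forall z w : CC R, Re z < 2^-1 -> Re w < 2^-1 ->
   normc (z - (2^-1 +i* tau0)) < r -> normc (w - (2^-1 +i* tau0)) < r ->
   normc (dsum q w - dsum q z) <= A * normc (w - z).
  by apply: dsum_lipschitz => *; solve [exact: progeny0|exact: progeny_ge0|exact: progeny_moment|exact: hA].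
exists ((Cc * A + Cl * Bm) * 2); near=> K.
have [h1 h2 h3 h4] := @abscissa_bounds R K.
have hK : (scale K)^-1 < r / 3.
  by near: K; apply: (cvgr_lt 0 scale_inv_cvg0); rewrite divr_gt0.
have hT : (logscale K)^-1 <= (scale K)^-1 :> R.
  rewrite lef_pV2 ?posrE ?scale_gt0 ?logscale_gt0 // /logscale expr2 ler_peMl ?(ltW (scale_gt0 K)) //.
  by apply: le_trans (scale_ge4 K); rewrite ler1n.
have hd : `|tau0 - twist K tau0| <= 2 / scale K.
  by apply: le_trans (twist_dist_le K tau0) _; rewrite ler_wpM2l.
have FTE tau : FT (wkappa K) tau = ccoef rho (abscissa K) tau * dsum q (abscissa K +i* tau).
  apply: (@FT_kappa R rho rho1 rho2 _ (logscale K)^-1) => //; exact: le_trans h4 h1.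
rewrite !FTE; set z : CC R := abscissa K +i* tau0; set w : CC R := abscissa K +i* _.
have nz : normc (z - (2^-1 +i* tau0)) < r.
  rewrite /z norm_re /abscissa addrAC subrr sub0r normrN ger0_norm ?(ltW h3) //.
  by apply: le_lt_trans hT _; apply: lt_trans hK _; rewrite ltr_pdivrMr // ltr_pMr // ltr1n.
have nzw : normc (z - w) <= `|tau0 - twist K tau0| by exact: norm_im.
have nw : normc (w - (2^-1 +i* tau0)) < r.
  have -> : w - (2^-1 +i* tau0) = (w - z) + (z - (2^-1 +i* tau0)) by rewrite addrA subrK.
  apply: le_lt_trans (normcD _ _) _; rewrite normcB.
  have nz' : normc (z - (2^-1 +i* tau0)) <= (scale K)^-1.
    by rewrite /z norm_re /abscissa addrAC subrr sub0r normrN ger0_norm ?(ltW h3).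
  apply: le_lt_trans (lerD (le_trans nzw hd) nz') _.
  move: hK; set u := (scale K)^-1; exact: third_lt.
have hzw : normc (dsum q z - dsum q w) <= A * `|tau0 - twist K tau0|.
  by apply: le_trans (lip w z h2 h2 nw nz) _; rewrite ler_wpM2l.
have hw : normc (dsum q w) <= Bm.
  rewrite -[dsum q w](subrK (dsum q p)) addrC; apply: le_trans (normcD _ _) _.
  rewrite lerD2l; apply: le_trans (lip p w hp h2 hpr nw) _; rewrite ler_wpM2l //.
  have -> : w - p = (w - (2^-1 +i* tau0)) - (p - (2^-1 +i* tau0)) by rewrite opprB addrA subrK.
  apply: le_trans (normcD _ _) _; rewrite normcN mulr2n mulrDl mul1r.
  by apply: lerD; exact: ltW.
have -> : ccoef rho (abscissa K) tau0 * dsum q z - ccoef rho (abscissa K) (twist K tau0) * dsum q w =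
   ccoef rho (abscissa K) tau0 * (dsum q z - dsum q w) +
   (ccoef rho (abscissa K) tau0 - ccoef rho (abscissa K) (twist K tau0)) * dsum q w by ring.
have c1 := hCc (abscissa K) tau0 h1 (ltW h2).
have c2 := hCl (abscissa K) tau0 (twist K tau0) h1 (ltW h2).
apply: le_trans (normcD _ _) _; rewrite !normcM.
apply: (@le_trans _ _ (Cc * (A * `|tau0 - twist K tau0|) + Cl * `|tau0 - twist K tau0| * Bm)).
  by apply: lerD; apply: ler_pM => //; exact: normc_ge0.
have -> : Cc * (A * `|tau0 - twist K tau0|) + Cl * `|tau0 - twist K tau0| * Bm =
  (Cc * A + Cl * Bm) * `|tau0 - twist K tau0| by ring.
by rewrite -mulrA ler_wpM2l // addr_ge0 // mulr_ge0.
Unshelve. all: by end_near.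
Qed.

End BlowUp.

(** * Blow-up of the derivative *)

Section Blow.
Context {R : realType}.
Local Arguments scale : simpl never.
Local Notation normc := (@Normc.normc R).
Local Notation Re := complex.Re.
Local Notation q := (@progeny R).
Implicit Types (K : nat).

(** The marks of the levels decay slower than the inverse scales. *)
Lemma weight_scale_ge K : 2 ^+ K <= weight K.+1 * scale K :> R.
Proof.
apply: le_trans (ler_wpM2l (weight_ge0 K.+1) (scale_geX K)).
have -> : 4 ^+ K.+1 = 2 ^+ K.+2 * 2 ^+ K :> R.
  have -> : 4 = 2 ^+ 2 :> R by ring.
  by rewrite -exprM -exprD; congr (_ ^+ _); rewrite mul2n -addnn addSn addnS addSn.
by rewrite /weight mulrA -exprMn mulVf // expr1n mul1r.
Qed.

Lemma twist_cvg (tau : R) : (fun K => twist K tau) @ \oo --> tau.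
Proof.
rewrite -[X in _ --> X]addr0; apply: cvgD; first exact: cvg_cst.
have -> : (fun K => pi / (2 * logscale K)) = (fun K => pi / 2 * ((scale K)^-1 * (scale K)^-1)) :> (nat -> R).
  by apply/funext => K; rewrite /logscale; field; rewrite gt_eqF ?scale_gt0.
have h : (fun K => (scale K)^-1 * (scale K)^-1) @ \oo --> (0 * 0 : R).
  by apply: cvgM; exact: scale_inv_cvg0.
by rewrite mulr0 in h; rewrite -[X in _ --> X](mulr0 (pi / 2)); exact: cvgMr.
Qed.

(** If the derivative were bounded by [A] on the half disc, the difference of
    the transforms of level [K.+1] would be [O ((scale K)^-1)], hence [o
    (weight K.+1)]. But after division by [weight K.+1] its norm is bounded
    below by a sequence that tends to a positive multiple of the transform of
    the profile. *)
Theorem progeny_blowup (a0 : CC R) (r A : R) : Re a0 = 2^-1 -> 0 < r ->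
  exists a : CC R, [/\ Re a < 2^-1, normc (a - a0) < r & A < normc (dcoef q a 1)].
Proof.
move=> ha0 r0; apply: contrapT => hno.
pose tau0 := complex.Im a0.
have a0E : a0 = 2^-1 +i* tau0 by apply: complex_eq.
have hA (a : CC R) : Re a < 2^-1 -> normc (a - (2^-1 +i* tau0)) < r -> normc (dcoef q a 1) <= A.
  by move=> h1 h2; rewrite leNgt; apply/negP => h3; apply: hno; exists a; rewrite a0E.
have [rho [rho1 rho2 p0]] := profile_transform_gt0 tau0.
have rho0 : 0 < rho := lt_trans ltr01 rho1.
have [Ck hk] := wkappa_difference rho1 rho2 r0 hA.
have [Cr hr] := whigh_difference rho1 rho2.
have [Cm hm] := wlow_difference rho1 rho2.
pose C := `|Ck| + `|Cr| + `|Cm|.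
pose G K := Re (FT (rescaled rho K) tau0 + FT (rescaled rho K) (twist K tau0)).
have hq : 0 < 4^-1 :> R by rewrite invr_gt0.
have cG : G @ \oo --> rho / 2 * intR (fun t => cos (tau0 * t) * profile rho t) +
     rho / 2 * intR (fun t => cos (tau0 * t) * profile rho t).
  rewrite -!intRZ; try exact: integrableR_cos_profile.
  have e : (fun t => rho / 2 * (cos (tau0 * t) * profile rho t)) =
      (fun t => cos (tau0 * t) * (rho / 2 * profile rho t)).
    by apply/funext => t; rewrite mulrCA.
  rewrite e; apply: cvgD.
    apply: (@cos_transform_cvg R (rescaled rho) _ (fun t => 1000 * expabs 4^-1 t) (fun=> tau0)).
    - by move=> K; exact: measurable_rescaled.
    - by apply: integrableRZ; exact: integrableR_expabs.
    - by move=> K t; exact: rescaled_le.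
    - by move=> t; exact: rescaled_cvg.
    - exact: cvg_cst.
  apply: (@cos_transform_cvg R (rescaled rho) _ (fun t => 1000 * expabs 4^-1 t) (fun K => twist K tau0)).
  - by move=> K; exact: measurable_rescaled.
  - by apply: integrableRZ; exact: integrableR_expabs.
  - by move=> K t; exact: rescaled_le.
  - by move=> t; exact: rescaled_cvg.
  - exact: twist_cvg.
have cB : (fun K => C * expR 2 * 2^-1 ^+ K) @ \oo --> (0 : R).
  rewrite -[X in _ --> X](mulr0 (C * expR 2)); apply: cvgMr.
  have h : `|2^-1 : R| < 1 by rewrite ger0_norm ?invr_ge0 // invf_lt1 // ltr1n.
  exact: (cvg_expr h).
have hGB : \forall K \near \oo, G K <= C * expR 2 * 2^-1 ^+ K.
  near=> K.
  have hkK : normc (FT (wkappa rho K) tau0 - FT (wkappa rho K) (twist K tau0)) <= Ck / scale K.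
    by near: K.
  have hd : normc (FT (wlevel rho K) tau0 - FT (wlevel rho K) (twist K tau0)) <= C / scale K.
    have -> : FT (wlevel rho K) tau0 - FT (wlevel rho K) (twist K tau0) =
      (FT (wlow rho K) tau0 - FT (wlow rho K) (twist K tau0)) +
      (- (FT (wkappa rho K) tau0 - FT (wkappa rho K) (twist K tau0)) +
       - (FT (whigh rho K) tau0 - FT (whigh rho K) (twist K tau0))).
      by rewrite !FT_wlow //; ring.
    apply: le_trans (normcD _ _) _.
    apply: le_trans (lerD (hm K tau0) (normcD _ _)) _; rewrite !normcN.
    apply: le_trans (lerD (lexx _) (lerD hkK (hr K tau0 (twist K tau0)))) _.
    rewrite -!mulrDl; apply: ler_wpM2r; first by rewrite invr_ge0 ltW // scale_gt0.
    by rewrite /C addrC; apply: lerD; [apply: lerD|]; exact: ler_norm.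
  rewrite wlevel_difference // in hd.
  have M0 := @scale_gt0 R K; have w0 := @weight_gt0 R K.+1; have e0 := expR_gt0 (2 : R).
  have C0 : 0 <= C by rewrite !addr_ge0.
  have hG : G K <= normc (FT (rescaled rho K) tau0 + FT (rescaled rho K) (twist K tau0)).
    exact: le_trans (ler_norm _) (Re_le_normc _).
  apply: le_trans hG _; move: hd; set N := normc _ => hd.
  have hN : N <= C * expR 2 * (weight K.+1 * scale K)^-1.
    have -> : C * expR 2 * (weight K.+1 * scale K)^-1 = (C / scale K) / (expR (- 2) * weight K.+1).
      by rewrite expRN; field; rewrite !gt_eqF.
    have ew : 0 < expR (- 2) * weight K.+1 :> R by exact: mulr_gt0 (expR_gt0 _) w0.
    by rewrite ler_pdivlMr // mulrC.
  apply: le_trans hN _; rewrite ler_wpM2l ?mulr_ge0 ?expR_ge0 // exprVn.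
  rewrite lef_pV2 ?posrE; [exact: weight_scale_ge|exact: mulr_gt0|exact: exprn_gt0].
have hle : rho / 2 * intR (fun t => cos (tau0 * t) * profile rho t) +
    rho / 2 * intR (fun t => cos (tau0 * t) * profile rho t) <= 0.
  exact: ler_cvg_to cG cB hGB.
have : 0 < rho / 2 * intR (fun t => cos (tau0 * t) * profile rho t) by rewrite mulr_gt0 // divr_gt0.
by move=> h; have := lt_le_trans (addr_gt0 h h) hle; rewrite ltxx.
Unshelve. all: by end_near.
Qed.

End Blow.

(** * The main theorem *)

Section OffspringProbability.
Context {R : realType}.

Let point_mass n : {measure set nat -> \bar R} :=
  mscale (NngNum (@offspring_pmf_ge0 R n)) (dirac n).

Definition offspring_prob : set nat -> \bar R := mseries point_mass 0.

HB.instance Definition _ := Measure.on offspring_prob.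

(** Integrals against a countable mixture of point masses are series. *)
Lemma integral_offspring (f : nat -> R) l : (forall n, 0 <= f n) ->
  has_sum (fun n => offspring_pmf n * f n) l ->
  (\int[offspring_prob]_n (f n)%:E = l%:E)%E.
Proof.
move=> f0 hl.
rewrite ge0_integral_measure_series //; last by move=> n _; rewrite lee_fin.
have h n : (\int[point_mass n]_x (f x)%:E = (offspring_pmf n * f n)%:E)%E.
  rewrite ge0_integral_mscale //; last by move=> x _; rewrite lee_fin.
  by rewrite integral_dirac // diracT mul1e.
under eq_eseriesr do rewrite h.
apply/has_sum_EFin => // n; by rewrite mulr_ge0 ?offspring_pmf_ge0.
Qed.

Lemma offspring_prob1 k : offspring_prob [set k] = (offspring_pmf k)%:E.
Proof.
have h : has_sum (fun n => offspring_pmf n * \1_[set k] n) (offspring_pmf k : R).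
  have := @has_sum_finite R (fun n => offspring_pmf n * \1_[set k] n) k.+1.
  have -> : series (fun n => offspring_pmf n * \1_[set k] n) k.+1 = offspring_pmf k :> R.
    rewrite /series /= big_nat_recr //= big_nat big1 ?add0r.
      by rewrite indicE mem_set // mulr1.
    by move=> i /andP[_ ik]; rewrite indicE memNset ?mulr0 //= => ik'; rewrite ik' ltnn in ik.
  apply=> n kn; rewrite indicE memNset ?mulr0 //= => nk.
  by rewrite nk ltnn in kn.
have := integral_offspring _ h; rewrite integral_indic // setIT; apply=> n.
by rewrite indicE.
Qed.

Lemma offspring_prob_setT : offspring_prob [set: nat] = 1%E.
Proof.
have := @integral_offspring (fun=> 1) 1 (fun=> ler01).
rewrite integral_cst //= mul1e; apply.
have := @offspring_total R; by congr has_sum; apply/funext => n; rewrite mulr1.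
Qed.

HB.instance Definition _ :=
  @Measure_isProbability.Build _ _ R offspring_prob offspring_prob_setT.

Definition offspring_value : nat -> nat := idfun.

HB.instance Definition _ := isMeasurableFun.Build _ _ nat nat offspring_value (@measurable_id _ nat setT).

Definition offspring_rv : {RV offspring_prob >-> nat} := offspring_value.

Lemma offspring_expectation :
  ('E_offspring_prob[fun w => ((offspring_rv w)%:R : R)%R] = 1)%E.
Proof.
rewrite unlock; apply: integral_offspring => [n|]; first exact: ler0n.
exact: offspring_mean.
Qed.

Lemma offspring_variance :
  ('V_offspring_prob[fun w => ((offspring_rv w)%:R : R)%R] = 2%:E)%E.
Proof.
rewrite /variance unlock offspring_expectation unlock.
transitivity (\int[offspring_prob]_n ((n%:R - 1) ^+ 2 : R)%:E)%E.
  by apply: eq_integral => n _; rewrite expr2.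
apply: integral_offspring => [n|]; first exact: sqr_ge0.
have := has_sumD (has_sumB (@offspring_sqr R) (has_sumZ (c := 2) (@offspring_mean R))) (@offspring_total R).
have -> : 3 - 2 * 1 + 1 = 2 :> R by ring.
by congr has_sum; apply/funext => n; ring.
Qed.

End OffspringProbability.

Theorem theorem11p1 (R : realType) :
  exists (d0 : measure_display) (T0 : measurableType d0)
         (P0 : probability T0 R) (xi : {RV P0 >-> nat}),
    [/\ ('E_P0[fun w => ((xi w)%:R : R)%R] = 1)%E,
        (0 < 'V_P0[fun w => ((xi w)%:R : R)%R])%E,
        ('V_P0[fun w => ((xi w)%:R : R)%R] < +oo)%E
      & forall (d : measure_display) (T : measurableType d)
               (P : probability T R) (X : seq nat -> {RV P >-> nat}),
          iid_copies xi X ->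
          [/\ forall a0 : CC R, complex.Re a0 = 2^-1 ->
                limf_esup (fun a : CC R => (Normc.normc (derive1 (gw_mu X) a))%:E)
                          (within (@left_half_plane R) (nbhs a0)) = +oo%E,
              forall a0 : CC R, complex.Re a0 = 2^-1 ->
                ~ has_analytic_extension_near (@left_half_plane R) (gw_mu X) a0
            & natural_boundary (@left_half_plane R) (@critical_line R)
                               (gw_mu X)]].
Proof.
exists _, _, (offspring_prob : probability nat R), offspring_rv; split.
- exact: offspring_expectation.
- by rewrite offspring_variance lte_fin.
- by rewrite offspring_variance ltry.
move=> d T P X [Xind Xlaw].
have law u k : P (X u @^-1` [set k]) = (@offspring_pmf R k)%:E.
  have := Xlaw u [set k]; rewrite /distribution /pushforward /= => -> //.
  exact: offspring_prob1.
have muE : gw_mu X = dsum (@progeny R).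
  apply/funext => a; rewrite /gw_mu /dsum.
  rewrite (_ : (fun N => _) = (fun N => \sum_(1 <= n < N) dterm (@progeny R) n a)) //.
  apply/funext => N; apply: eq_bigr => n _.
  by rewrite (gw_size_prob_forest Xind law).
have blow := @progeny_blowup R.
have esup (a0 : CC R) : complex.Re a0 = 2^-1 -> limf_esup
    (fun a : CC R => (Normc.normc (derive1 (dsum (@progeny R)) a))%:E)
    (within (@left_half_plane R) (nbhs a0)) = +oo%E.
  by apply: dsum_limf_esup => *; solve [exact: progeny0|exact: progeny_ge0|exact: progeny_moment|exact: blow].
have noext (a0 : CC R) : complex.Re a0 = 2^-1 ->
    ~ has_analytic_extension_near (@left_half_plane R) (dsum (@progeny R)) a0.
  by apply: dsum_not_extendable => *; solve [exact: progeny0|exact: progeny_ge0|exact: progeny_moment|exact: blow].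
rewrite muE; split => //; split => // a ha.
by apply: dsum_analytic => *; solve [exact: progeny0|exact: progeny_ge0|exact: progeny_moment|exact: ha].
Qed.
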